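(* Let $n \ge 2$ and $m \ge 1$ be integers and let $f:\mathbb{F}_2^n \to \mathbb{F}_2^m$ be an arbitrary $n$-input $m$-output Boolean function. Then there is a Clifford+T quantum circuit (with measurement-based uncomputation allowed) that implements the unitary $U_f:\lvert \mathbf{x}\rangle\lvert \mathbf{y}\rangle \mapsto \lvert \mathbf{x}\rangle\lvert \mathbf{y}\oplus f(\mathbf{x})\rangle$ for all $\mathbf{x}\in\mathbb{F}_2^n$, $\mathbf{y}\in\mathbb{F}_2^m$, and that has T depth $\lceil \log_2 n\rceil$ (the paper describes this T depth as optimal). This circuit uses (i) at most $2^{n-1}(3n-2) - 3n + m + 1$ reusable ancilla qubits, (ii) at most $2^{n+1}(n-2) + 4$ T gates, (iii) at most $2^{n-1}(11n + 2m - 18) - 4n - m + 9$ CNOT gates, (iv) a CNOT depth of at most $2^n + 2n + 9\lceil \log_2 n\rceil - 3$.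
   Context: $\mathbb{F}_2=\{0,1\}$ and $\oplus$ denotes bitwise addition mod 2. Every $f:\mathbb{F}_2^n\to\mathbb{F}_2^m$ consists of $m$ coordinate functions $f_j:\mathbb{F}_2^n\to\mathbb{F}_2$. Each coordinate function has a unique algebraic normal form (ANF) $f_j(x_1,\dots,x_n)=\bigoplus_{I\subseteq\{1,\dots,n\}} a_I\prod_{i\in I}x_i$ with $a_I\in\mathbb{F}_2$, where the empty product equals $1$. A Clifford+T circuit is a quantum circuit built from the Hadamard gate $H$, the phase gate $S$, the CNOT gate, the $T=\mathrm{diag}(1,e^{i\pi/4})$ gate and its inverse $T^\dagger$. Measurement-based uncomputation means the circuit may additionally perform computational-basis measurements of qubits together with classically controlled Clifford corrections. Ancilla qubits are qubits beyond the $n$ input qubits $\lvert\mathbf{x}\rangle$ and the $m$ output qubits $\lvert\mathbf{y}\rangle$. Each ancilla starts in $\lvert 0\rangle$. An ancilla is reusable if it is returned to $\lvert 0\rangle$ by the end of the computation. Circuit depth is the number of layers of gates, where gates acting on disjoint sets of qubits may be executed in the same layer. The T depth is the number of layers that contain at least one $T$ or $T^\dagger$ gate. The CNOT depth is defined in the same way, counting layers that contain CNOT gates. *)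

(* Defs.v *)
From mathcomp Require Import all_boot all_order all_algebra all_field.
Set Implicit Arguments. Unset Strict Implicit. Unset Printing Implicit Defensive.
Import Order.TTheory GRing.Theory Num.Theory.
Local Open Scope ring_scope.

(* Clifford generators: Hadamard, phase gate S, CNOT (control, target). *)
Inductive cgate (N : nat) : Type :=
| CH of 'I_N
| CS of 'I_N
| CX of 'I_N & 'I_N.

(* Operations of a Clifford+T circuit with measurement-based uncomputation:
   a Clifford gate, T, T^dagger, a computational-basis measurement, or a
   Clifford gate classically controlled by the outcome of the j-th
   measurement performed so far (measurements numbered 0,1,2,... in
   circuit order). *)
Inductive op (N : nat) : Type :=
| OCl of cgate N
| OT of 'I_N
| OTdg of 'I_N
| OMeas of 'I_N
| OCC of nat & cgate N.

Definition circuit (N : nat) := seq (seq (op N)).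

Definition basis (N : nat) := 'I_N -> bool.
Definition qstate (N : nat) := basis N -> algC.

Definition upd N (s : basis N) (q : 'I_N) (v : bool) : basis N :=
  fun i => if i == q then v else s i.

Definition omega : algC := (1 + 'i) / sqrtC 2.
Definition omega_inv : algC := (1 - 'i) / sqrtC 2.

Definition apply_cgate N (g : cgate N) (psi : qstate N) : qstate N :=
  match g with
  | CH q => fun s =>
      (psi (upd s q false) + (if s q then -1 else 1) * psi (upd s q true))
        / sqrtC 2
  | CS q => fun s => (if s q then 'i else 1) * psi s
  | CX c t => fun s => psi (upd s t (s t (+) s c))
  end.

(* One operation, given the measurement-outcome record b; the nat is the
   number of measurements performed so far.  A measurement with outcome
   b k is the (unnormalised) projection onto that outcome. *)
Definition apply_op N (b : nat -> bool) (o : op N) (p : qstate N * nat)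
  : qstate N * nat :=
  let: (psi, k) := p in
  match o with
  | OCl g => (apply_cgate g psi, k)
  | OT q => ((fun s => (if s q then omega else 1) * psi s), k)
  | OTdg q => ((fun s => (if s q then omega_inv else 1) * psi s), k)
  | OMeas q => ((fun s => if s q == b k then psi s else 0), k.+1)
  | OCC j g => ((if b j then apply_cgate g psi else psi), k)
  end.

Definition run N (b : nat -> bool) (C : circuit N) (psi : qstate N) : qstate N :=
  (foldl (fun p o => apply_op b o p) (psi, 0%N) (flatten C)).1.

Definition cgate_qubits N (g : cgate N) : seq 'I_N :=
  match g with CH q => [:: q] | CS q => [:: q] | CX c t => [:: c; t] end.

Definition op_qubits N (o : op N) : seq 'I_N :=
  match o with
  | OCl g => cgate_qubits g
  | OT q => [:: q]
  | OTdg q => [:: q]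
  | OMeas q => [:: q]
  | OCC _ g => cgate_qubits g
  end.

(* Operations in one layer act on pairwise disjoint sets of qubits
   (this also forces control <> target for every CNOT). *)
Definition layer_ok N (L : seq (op N)) : bool :=
  uniq (flatten (map (@op_qubits N) L)).

Definition is_meas N (o : op N) : bool := if o is OMeas _ then true else false.

Fixpoint cc_ok N (m0 : nat) (C : circuit N) : bool :=
  match C with
  | [::] => true
  | L :: C' =>
      all (fun o => if o is OCC j _ then (j < m0)%N else true) L
      && cc_ok (m0 + count (@is_meas N) L) C'
  end.

Definition wf_circuit N (C : circuit N) : bool :=
  all (@layer_ok N) C && cc_ok 0 C.

Definition is_T N (o : op N) : bool :=
  match o with OT _ => true | OTdg _ => true | _ => false end.

(* CNOT gates, including classically controlled ones (worst case). *)
Definition is_CNOT N (o : op N) : bool :=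
  match o with
  | OCl (CX _ _) => true
  | OCC _ (CX _ _) => true
  | _ => false
  end.

Definition T_count N (C : circuit N) : nat := count (@is_T N) (flatten C).
Definition CNOT_count N (C : circuit N) : nat := count (@is_CNOT N) (flatten C).
Definition T_depth N (C : circuit N) : nat := count (has (@is_T N)) C.
Definition CNOT_depth N (C : circuit N) : nat := count (has (@is_CNOT N)) C.

Definition in_q n m a (i : 'I_n) : 'I_(n + m + a) := lshift a (lshift m i).
Definition out_q n m a (j : 'I_m) : 'I_(n + m + a) := lshift a (rshift n j).
Definition anc_q n m a (k : 'I_a) : 'I_(n + m + a) := rshift (n + m) k.

Definition basis_state (n m a : nat) (x : {ffun 'I_n -> bool}) (y : {ffun 'I_m -> bool})
  : qstate (n + m + a) :=
  fun s => if [forall i, s (in_q m a i) == x i]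
              && [forall j, s (out_q n a j) == y j]
              && [forall k, ~~ s (anc_q n m k)]
           then 1 else 0.

Definition xorv m (y z : {ffun 'I_m -> bool}) : {ffun 'I_m -> bool} :=
  [ffun j => y j (+) z j].

(* C implements U_f with the a ancillas starting and ending in |0>:
   for every measurement-outcome record b, the branch operator maps
   |x>|y>|0> to c_b |x>|y (+) f x>|0>, with a scalar c_b independent of
   x, y (so by linearity it acts as c_b (U_f (x) id) on all inputs). *)
Definition implements n m a (f : {ffun 'I_n -> bool} -> {ffun 'I_m -> bool})
  (C : circuit (n + m + a)) : Prop :=
  forall b : nat -> bool, exists c : algC,
    forall x y s,
      run b C (@basis_state n m a x y) s = c * @basis_state n m a x (xorv y (f x)) s.

(* Main.v *)
Require Import Defs.
From mathcomp Require Import all_boot all_order all_algebra all_field.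
From mathcomp Require Import zify ring.
From Stdlib Require Import FunctionalExtensionality.
Set Implicit Arguments. Unset Strict Implicit. Unset Printing Implicit Defensive.
Import GRing.Theory Num.Theory.

(* Every Boolean function is a sum of monomials (its algebraic normal form).
   A monomial of degree d is the AND of two monomials of degree at most
   ceil(d / 2), so that all monomials are computed in ceil(log2 n) levels. The
   AND gates of a level act on pairwise disjoint qubits, and each of them uses
   four T gates in a single layer, hence T depth ceil(log2 n) and 4 T gates for
   each of the 2^n - n - 1 monomials of degree at least 2.

   A qubit needed in many places at once is copied along a chain: the parity of
   each copy (initially |+>) with its predecessor is measured, and the outcomes
   are corrected by X gates. Whatever the number of copies, this takes two CNOT
   layers. Measuring in the X basis, followed by Z corrections, erases copies
   and uncomputes AND gates; only the latter use CNOTs, one for each gate.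

   The outputs are served in blocks, each block having its own copies of all
   the monomials, by a cyclic schedule. The CNOTs spent on these copies are
   compensated by replacing, for four fixed monomials, three or four of them by
   their sum and the complementary ones. For n = 2 each output receives instead
   a single CNOT from a copy of the combination of x_1, x_2, x_1 x_2 it needs. *)

(** * Branch semantics *)

(** The bounds leave little room, and this shapes the constructions. A monomial of degree at least 2
    is charged 11 CNOTs: 6 for its AND gate, 1 for uncomputing it, 2 for a copy of each of its two
    factors. In the CNOT bound the coefficient of m is 2^n - 1, one CNOT per nonconstant monomial
    and output, so copies for further blocks of outputs must be paid by savings. A chain link yields
    two copies for 3 CNOTs, because its parity qubit is turned into a copy as well; for large m the
    copies then cost about 3m/2 CNOTs and m ancillas, while the sum of four monomials saves 2 CNOTs
    per output. As the CNOT depth may not depend on m, all outputs are served at once, over 2^n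
    layers. *)

Section Semantics.
Variable N : nat.
Implicit Types (s v : basis N) (psi phi : qstate N) (o : op N) (q c t d p : 'I_N).
Implicit Types (P : seq (op N)) (C : circuit N).

Definition ket v : qstate N := fun s => (if [forall i, s i == v i] then 1 else 0)%R.

Definition qscale (a : algC) psi : qstate N := fun s => (a * psi s)%R.
Definition qplus psi phi : qstate N := fun s => (psi s + phi s)%R.

(* In a single stage each qubit is measured at most once, so the outcomes are
   recorded at the index of the measured qubit, independently of the order of
   the measurements; [OCC j g] refers to the outcome at qubit [j]. *)
Definition lapply (b : nat -> bool) o psi : qstate N :=
  match o with
  | OCl g => apply_cgate g psi
  | OT q => fun s => ((if s q then omega else 1) * psi s)%R
  | OTdg q => fun s => ((if s q then omega_inv else 1) * psi s)%R
  | OMeas q => fun s => if s q == b q then psi s else 0%R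
  | OCC j g => if b j then apply_cgate g psi else psi
  end.

Definition lrun b P psi := foldl (fun f o => lapply b o f) psi P.

Lemma lrun_cat b P1 P2 psi : lrun b (P1 ++ P2) psi = lrun b P2 (lrun b P1 psi).
Proof. exact: foldl_cat. Qed.

Lemma ketP s v : reflect (s = v) [forall i, s i == v i].
Proof.
apply: (iffP forallP) => [e|->] //.
by apply: functional_extensionality => i; apply/eqP.
Qed.

Lemma upd_eq v q x : upd v q x q = x.
Proof. by rewrite /upd eqxx. Qed.

Lemma upd_ne v q x q' : q' != q -> upd v q x q' = v q'.
Proof. by rewrite /upd => /negbTE ->. Qed.

Lemma upd_id v q : upd v q (v q) = v.
Proof. by apply: functional_extensionality => i; rewrite /upd; case: eqP => // ->. Qed.

Lemma updK v q x y : upd (upd v q x) q y = upd v q y.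
Proof. by apply: functional_extensionality => i; rewrite /upd; case: eqP. Qed.

Lemma updC v q q' x y : q != q' -> upd (upd v q x) q' y = upd (upd v q' y) q x.
Proof.
move=> ne; apply: functional_extensionality => i; rewrite /upd.
by case: eqP => // ->; case: eqP => // e; rewrite e eqxx in ne.
Qed.

(** Gates read amplitudes at updated basis states; this turns such a read into an amplitude of an
    updated ket. *)
Lemma ket_upd v s q x : ket v (upd s q x) = (if v q == x then ket (upd v q (s q)) s else 0)%R.
Proof.
rewrite /ket; case: ketP => [e|ne].
  have e1 : v q = x by rewrite -e upd_eq.
  rewrite e1 eqxx; case: ketP => //= -[].
  by rewrite -e updK upd_id.
case: eqP => // e1; case: ketP => // e; case: ne.
by rewrite e updK -e1 upd_id.
Qed.

Definition nota (x : bool) : algC := (if x then -1 else 1)%R.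

Lemma lapplyH b v q :
  lapply b (OCl (CH q)) (ket v) =
  qscale ((sqrtC 2)^-1)%R (qplus (ket (upd v q false)) (qscale (nota (v q)) (ket (upd v q true)))).
Proof.
apply: functional_extensionality => s; rewrite /qscale /qplus /= !ket_upd.
have E x : s q != x -> ket (upd v q x) s = 0%R.
  by move=> ne; rewrite /ket; case: ketP => // e; rewrite e upd_eq eqxx in ne.
have := E (~~ s q); case sq: (s q); case vq: (v q) => /= /(_ isT) ->; rewrite /nota; ring.
Qed.

Lemma lapplyS b v q : lapply b (OCl (CS q)) (ket v) = qscale (if v q then 'i else 1)%R (ket v).
Proof.
apply: functional_extensionality => s; rewrite /qscale /= /ket.
by case: ketP => [->//|_]; rewrite !mulr0.
Qed.

Lemma lapplyT b v q : lapply b (OT q) (ket v) = qscale (if v q then omega else 1)%R (ket v).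
Proof.
apply: functional_extensionality => s; rewrite /qscale /= /ket.
by case: ketP => [->//|_]; rewrite !mulr0.
Qed.

Lemma lapplyTd b v q : lapply b (OTdg q) (ket v) = qscale (if v q then omega_inv else 1)%R (ket v).
Proof.
apply: functional_extensionality => s; rewrite /qscale /= /ket.
by case: ketP => [->//|_]; rewrite !mulr0.
Qed.

Lemma lapplyM b v q : lapply b (OMeas q) (ket v) = qscale (if v q == b q then 1 else 0)%R (ket v).
Proof.
apply: functional_extensionality => s; rewrite /qscale /= /ket.
by case: ketP => [->|_]; case: ifP; rewrite ?mulr0 ?mulr1.
Qed.

Lemma lapplyX b v c t : c != t ->
  lapply b (OCl (CX c t)) (ket v) = ket (upd v t (v t (+) v c)).
Proof.
move=> ne; apply: functional_extensionality => s; rewrite /= /ket.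
case: ketP => [e|ne1]; case: ketP => [e2|ne2] //.
- case: ne2; rewrite -e upd_eq upd_ne // addbK updK upd_id //.
- by case: ne1; rewrite e2 upd_eq upd_ne // addbK updK upd_id.
Qed.

Lemma lapply_lin b o a1 a2 psi phi :
  lapply b o (qplus (qscale a1 psi) (qscale a2 phi)) =
  qplus (qscale a1 (lapply b o psi)) (qscale a2 (lapply b o phi)).
Proof.
have G g f1 f2 : apply_cgate g (qplus (qscale a1 f1) (qscale a2 f2)) =
    qplus (qscale a1 (apply_cgate g f1)) (qscale a2 (apply_cgate g f2)).
  by apply: functional_extensionality => s; rewrite /qplus /qscale; case: g => * /=; ring.
apply: functional_extensionality => s; rewrite /qplus /qscale.
case: o => [g|q|q|q|j g] /=; rewrite ?G //; try by ring.
- by case: ifP => // _; ring.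
- by case: (b j); rewrite ?G.
Qed.

Lemma qscale1 psi : qscale 1%R psi = psi.
Proof. by apply: functional_extensionality => s; rewrite /qscale mul1r. Qed.

Lemma qscaleM a1 a2 psi : qscale a1 (qscale a2 psi) = qscale (a1 * a2)%R psi.
Proof. by apply: functional_extensionality => s; rewrite /qscale mulrA. Qed.

Lemma lrun_lin b P a1 a2 psi phi :
  lrun b P (qplus (qscale a1 psi) (qscale a2 phi)) =
  qplus (qscale a1 (lrun b P psi)) (qscale a2 (lrun b P phi)).
Proof. by elim: P psi phi => //= o P IH psi phi; rewrite lapply_lin IH. Qed.

Lemma lrun_scale b P a psi : lrun b P (qscale a psi) = qscale a (lrun b P psi).
Proof.
have E f : qscale a f = qplus (qscale a f) (qscale 0%R (fun=> 0%R)).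
  by apply: functional_extensionality => s; rewrite /qplus /qscale; ring.
rewrite (E psi) lrun_lin; apply: functional_extensionality => s; rewrite /qplus /qscale; ring.
Qed.

Lemma lapply_scale b o a psi : lapply b o (qscale a psi) = qscale a (lapply b o psi).
Proof. exact: (lrun_scale b [:: o]). Qed.

Definition supp P : seq 'I_N := flatten [seq op_qubits o | o <- P].
Definition disj P1 P2 := ~~ has (mem (supp P1)) (supp P2).

Lemma supp_cat P1 P2 : supp (P1 ++ P2) = supp P1 ++ supp P2.
Proof. by rewrite /supp map_cat flatten_cat. Qed.

(** For a fixed record every operation acts as a Hadamard gate, a diagonal operator on one qubit or
    a CNOT: a measurement is a diagonal projection, and a controlled gate that does not fire is the
    identity. Commutation is checked on these three kinds only. *)
Inductive prim := PH of 'I_N | PD of 'I_N & (bool -> algC) | PX of 'I_N & 'I_N.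

Definition aprim (g : prim) psi : qstate N :=
  match g with
  | PH q => apply_cgate (CH q) psi
  | PD q f => fun s => (f (s q) * psi s)%R
  | PX c t => apply_cgate (CX c t) psi
  end.

Definition prim_qubits (g : prim) :=
  match g with PH q => [:: q] | PD q f => [:: q] | PX c t => [:: c; t] end.

Definition prim_of_cgate (g : cgate N) : prim :=
  match g with
  | CH q => PH q
  | CS q => PD q (fun x => if x then 'i else 1)%R
  | CX c t => PX c t
  end.

Lemma aprimC g1 g2 psi : ~~ has (mem (prim_qubits g1)) (prim_qubits g2) ->
  aprim g1 (aprim g2 psi) = aprim g2 (aprim g1 psi).
Proof.
have swap (a a' : 'I_N) : a != a' -> (a' != a) * (a != a') by rewrite eq_sym => ->.
case: g1 => [q|q f|c t]; case: g2 => [q'|q' f'|c' t'] /=; rewrite ?inE ?orbF ?negb_or => ne;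
  apply: functional_extensionality => s /=;
  repeat (match goal with H : is_true (_ && _) |- _ => case/andP: H => ? ? end);
  repeat (match goal with H : is_true (?a != ?b) |- _ => move/swap: H => H end);
  repeat (match goal with H : (is_true (?a != ?b) * _)%type |- _ =>
    rewrite ?(upd_ne _ _ H.1) ?(upd_ne _ _ H.2); move: H end); intros;
  try ring.
all: match goal with H : (is_true (?a != ?b) * _)%type |- context [upd (upd _ ?a _) ?b _] =>
    rewrite !(updC _ _ _ H.1); first [done | ring] end.
Qed.

Lemma lapplyC b o1 o2 psi : ~~ has (mem (op_qubits o1)) (op_qubits o2) ->
  lapply b o1 (lapply b o2 psi) = lapply b o2 (lapply b o1 psi).
Proof.
have E o : exists2 g, lapply b o = aprim g & {subset prim_qubits g <= op_qubits o}.
  case: o => [g|q|q|q|j g] /=.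
  - exists (prim_of_cgate g); last by move=> x; case: g.
    by apply: functional_extensionality => f; case: g.
  - exists (PD q (fun x => if x then omega else 1)%R); last by move=> x.
    by apply: functional_extensionality => f.
  - exists (PD q (fun x => if x then omega_inv else 1)%R); last by move=> x.
    by apply: functional_extensionality => f.
  - exists (PD q (fun x => if x == b q then 1 else 0)%R); last by move=> x.
    apply: functional_extensionality => f; apply: functional_extensionality => s /=.
    by case: ifP; rewrite ?mul1r ?mul0r.
  - case bj: (b j).
      exists (prim_of_cgate g); last by move=> x; case: g.
      by apply: functional_extensionality => f; rewrite /= bj; case: g.
    (* The gate does not fire. The identity is written as a diagonal operator on one of its own
       qubits, which keeps the support inside that of the operation. *)
    have [q gq] : {q | q \in cgate_qubits g}.
      by case: g => [q|q|q t]; exists q; rewrite inE eqxx.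
    exists (PD q (fun=> 1%R)); last by move=> x; rewrite inE => /eqP ->.
    apply: functional_extensionality => f; apply: functional_extensionality => s /=.
    by rewrite bj mul1r.
have [g1 -> s1] := E o1; have [g2 -> s2] := E o2 => H.
apply: aprimC; apply: contra H => /hasP [q q2 q1]; apply/hasP.
by exists q; [exact: s2|exact: s1].
Qed.

Lemma disj_cons o1 P1 P2 :
  disj (o1 :: P1) P2 = ~~ has (mem (op_qubits o1)) (supp P2) && disj P1 P2.
Proof.
rewrite /disj /= -negb_or -has_predU; congr (~~ _); apply: eq_has => q /=.
by rewrite mem_cat.
Qed.

Lemma lrunC1 b o P psi : ~~ has (mem (op_qubits o)) (supp P) ->
  lrun b P (lapply b o psi) = lapply b o (lrun b P psi).
Proof.
elim: P psi => //= o' P IH psi; rewrite /supp /= has_cat negb_or => /andP [H1 H2].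
by rewrite -lapplyC // IH.
Qed.

Lemma lrunC b P1 P2 psi : disj P1 P2 -> lrun b P2 (lrun b P1 psi) = lrun b P1 (lrun b P2 psi).
Proof.
by elim: P1 psi => //= o P1 IH psi; rewrite disj_cons => /andP [H1 H2]; rewrite IH // lrunC1.
Qed.

Lemma disj_sub P1 P2 P1' P2' : {subset supp P1' <= supp P1} -> {subset supp P2' <= supp P2} ->
  disj P1 P2 -> disj P1' P2'.
Proof.
move=> s1 s2; apply: contra => /hasP [q q2 q1]; apply/hasP.
by exists q; [exact: s2|exact: s1].
Qed.

(** * Parallel composition *)

Fixpoint zipcat C1 C2 : circuit N :=
  match C1, C2 with
  | L1 :: C1', L2 :: C2' => (L1 ++ L2) :: zipcat C1' C2'
  | [::], _ => C2
  | _, [::] => C1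
  end.

(* An operation of [C2] is only ever moved before the operations of [C1] lying
   in the same or in a later layer. *)
Fixpoint par_ok C1 C2 : bool :=
  match C1, C2 with
  | L1 :: C1', L2 :: C2' => disj (L1 ++ flatten C1') L2 && par_ok C1' C2'
  | _, _ => true
  end.

Lemma lrun_zipcat b C1 C2 psi : par_ok C1 C2 ->
  lrun b (flatten (zipcat C1 C2)) psi = lrun b (flatten C2) (lrun b (flatten C1) psi).
Proof.
elim: C1 C2 psi => [|L1 C1 IH] [|L2 C2] psi //= /andP [H /IH E].
have H' : disj (flatten C1) L2.
  by apply: disj_sub H => // q; rewrite supp_cat mem_cat => ->; rewrite orbT.
by rewrite !lrun_cat E (lrunC _ _ H').
Qed.

Lemma count_zipcat (a : pred (op N)) C1 C2 :
  count a (flatten (zipcat C1 C2)) = count a (flatten C1) + count a (flatten C2).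
Proof.
elim: C1 C2 => [|L1 C1 IH] [|L2 C2] //=; first by rewrite addn0.
by rewrite !count_cat IH; lia.
Qed.

Lemma supp_zipcat C1 C2 :
  perm_eq (supp (flatten (zipcat C1 C2))) (supp (flatten C1) ++ supp (flatten C2)).
Proof.
elim: C1 C2 => [|L1 C1 IH] [|L2 C2] //=; first by rewrite cats0.
rewrite !supp_cat -!catA perm_cat2l (permPr (permEl (perm_catCA _ _ _))) perm_cat2l.
exact: IH.
Qed.

Lemma layers_zipcat C1 C2 : par_ok C1 C2 -> all (@layer_ok N) C1 -> all (@layer_ok N) C2 ->
  all (@layer_ok N) (zipcat C1 C2).
Proof.
elim: C1 C2 => [|L1 C1 IH] [|L2 C2] //= /andP [H c] /andP [k1 o1] /andP [k2 o2].
rewrite IH // andbT /layer_ok map_cat flatten_cat cat_uniq; apply/and3P; split=> //.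
by apply: disj_sub H => // q; rewrite supp_cat mem_cat => ->.
Qed.

(** With equal shapes, the layers containing T gates (or CNOTs) coincide, so that gadgets run in
    parallel have the depth of a single one. *)
Lemma has_zipcat (a : pred (op N)) sh C1 C2 : map (has a) C1 = sh -> map (has a) C2 = sh ->
  map (has a) (zipcat C1 C2) = sh.
Proof.
elim: C1 C2 sh => [|L1 C1 IH] [|L2 C2] [|x sh] //= [<- e1] [e2 e3].
by rewrite has_cat e2 orbb (IH C2 sh).
Qed.

Lemma par_ok_disj C1 C2 : disj (flatten C1) (flatten C2) -> par_ok C1 C2.
Proof.
elim: C1 C2 => [|L1 C1 IH] [|L2 C2] //= H; apply/andP; split.
  by apply: disj_sub H => // q; rewrite supp_cat mem_cat => ->.
by apply: IH; apply: disj_sub H => q; rewrite supp_cat mem_cat => ->; rewrite orbT.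
Qed.

(** * Measurement records *)

Definition labs P : seq nat := pmap (fun o => if o is OMeas q then Some (q : nat) else None) P.

Lemma labs_cat P1 P2 : labs (P1 ++ P2) = labs P1 ++ labs P2.
Proof. exact: pmap_cat. Qed.

Lemma labs_zipcat C1 C2 :
  perm_eq (labs (flatten (zipcat C1 C2))) (labs (flatten C1) ++ labs (flatten C2)).
Proof.
elim: C1 C2 => [|L1 C1 IH] [|L2 C2] //=; first by rewrite cats0.
rewrite !labs_cat -!catA perm_cat2l (permPr (permEl (perm_catCA _ _ _))) perm_cat2l.
exact: IH.
Qed.

Lemma size_labs P : size (labs P) = count (@is_meas N) P.
Proof. by elim: P => //= -[g|q|q|q|j g] P IH //=; rewrite -IH. Qed.

(** The counterpart of [cc_ok] for outcomes labelled by qubits. Membership in [seen], unlike a bound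
    on an index, survives parallel merging, where the numbering of the measurements changes. *)
Fixpoint cc_closed (seen : seq nat) C : bool :=
  match C with
  | [::] => true
  | L :: C' => all (fun o => if o is OCC j _ then j \in seen else true) L
               && cc_closed (seen ++ labs L) C'
  end.

Lemma cc_closed_sub seen seen' C : {subset seen <= seen'} -> cc_closed seen C -> cc_closed seen' C.
Proof.
elim: C seen seen' => //= L C IH seen seen' ss /andP [cL cC]; apply/andP; split.
  by apply: sub_all cL => -[] // j g /ss.
by apply: IH cC => j; rewrite !mem_cat => /orP [/ss ->//|->]; rewrite orbT.
Qed.

Lemma cc_closed_cat seen C1 C2 :
  cc_closed seen (C1 ++ C2) = cc_closed seen C1 && cc_closed (seen ++ labs (flatten C1)) C2.
Proof.
elim: C1 seen => [|L C1 IH] seen /=; first by rewrite cats0.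
by rewrite IH -andbA labs_cat catA.
Qed.

Lemma cc_closed_zipcat seen1 seen2 C1 C2 :
  cc_closed seen1 C1 -> cc_closed seen2 C2 -> cc_closed (seen1 ++ seen2) (zipcat C1 C2).
Proof.
elim: C1 C2 seen1 seen2 => [|L1 C1 IH] [|L2 C2] seen1 seen2 //.
- by move=> _; apply: cc_closed_sub => j; rewrite mem_cat => ->; rewrite orbT.
- by move=> + _; apply: cc_closed_sub => j; rewrite mem_cat => ->.
move=> /= /andP [k1 c1] /andP [k2 c2]; rewrite all_cat -andbA; apply/and3P; split.
- by apply: sub_all k1 => -[] // j g; rewrite mem_cat => ->.
- by apply: sub_all k2 => -[] // j g; rewrite mem_cat => ->; rewrite orbT.
apply: cc_closed_sub (IH _ _ _ c1 c2) => j.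
by rewrite labs_cat !mem_cat => /orP [] /orP [] ->; rewrite ?orbT.
Qed.

(* From records indexed by qubits to records in circuit order. *)
Definition renum (idx : nat -> nat) o := if o is OCC j g then OCC (idx j) g else o.

Definition nrun (b : nat -> bool) P (r : qstate N * nat) := foldl (fun r0 o => apply_op b o r0) r P.

Lemma nrun_renum b idx P k psi :
  (forall i, i < size (labs P) -> idx (nth 0 (labs P) i) = k + i) ->
  nrun b (map (renum idx) P) (psi, k) = (lrun (b \o idx) P psi, k + size (labs P)).
Proof.
elim: P k psi => [|o P IH] k psi /=; first by rewrite addn0.
case: o => [g|q|q|q|j g] H; rewrite /nrun /= -/(nrun _ _ _); try exact: IH.
rewrite IH => [|i ii]; last by have := H i.+1 ii; rewrite /= addSnnS.
rewrite addSnnS; congr (lrun _ _ _, _).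
by apply: functional_extensionality => s; have /= := H 0 isT; rewrite addn0 => ->.
Qed.

Lemma cc_ok_renum idx k seen C :
  (forall j, j \in seen -> idx j < k) ->
  (forall i, i < size (labs (flatten C)) -> idx (nth 0 (labs (flatten C)) i) = k + i) ->
  cc_closed seen C -> cc_ok k (map (map (renum idx)) C).
Proof.
elim: C k seen => //= L C IH k seen Hs Hi /andP [cL cC]; apply/andP; split.
  by rewrite all_map; apply: sub_all cL => -[] //= j g /Hs.
have -> : count (@is_meas N) (map (renum idx) L) = size (labs L).
  by rewrite size_labs count_map; apply: eq_count => -[].
have Hn i : nth 0 (labs (L ++ flatten C)) i =
    if i < size (labs L) then nth 0 (labs L) i else nth 0 (labs (flatten C)) (i - size (labs L)).
  by rewrite labs_cat nth_cat.
apply: IH cC => [j|i ii].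
  rewrite mem_cat => /orP [/Hs|/(nthP 0) [i ii <-]]; first lia.
  have := Hi i; rewrite Hn ii labs_cat size_cat => ->; rewrite ?ltn_add2l ?ltn_addr //.
have := Hi (size (labs L) + i); rewrite Hn labs_cat size_cat.
rewrite ltn_add2l ii => /(_ isT); rewrite ltnNge leq_addr /= addKn => ->; rewrite addnA //.
Qed.
End Semantics.

(** * Implementations *)

Section Implementations.
Variables (N : nat).
Implicit Types (s v : basis N) (psi phi : qstate N) (o : op N) (q : 'I_N).
Implicit Types (P : seq (op N)) (C : circuit N).

(* Families of basis states are indexed by [X] so that the scalar of each
   measurement branch is visibly the same for all members of the family. *)
Definition impl (X : Type) (s s' : X -> basis N) (tc td cc cd : nat) : Prop :=
  exists k, forall off, exists C : circuit N,
  [/\ all (@layer_ok N) C && cc_ok off C, count (@is_meas N) (flatten C) = k,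
      T_count C <= tc /\ T_depth C = td, CNOT_count C <= cc /\ CNOT_depth C <= cd &
      forall b, exists a, forall x,
        nrun b (flatten C) (ket (s x), off) = (qscale a (ket (s' x)), off + k)].

Lemma nrun_scale b P a psi k : nrun b P (qscale a psi, k) =
  (qscale a (nrun b P (psi, k)).1, (nrun b P (psi, k)).2).
Proof.
elim: P psi k => //= o P IH psi k.
have G g f : apply_cgate g (qscale a f) = qscale a (apply_cgate g f).
  by have := lapply_scale (fun=> true) (OCl g) a f.
rewrite /nrun /=; case: o => [g|q|q|q|j g] /=; rewrite -!/(nrun _ _ _).
- by rewrite G IH.
- rewrite -IH; congr nrun; congr (_, _).
  by apply: functional_extensionality => s; rewrite /qscale mulrCA.
- rewrite -IH; congr nrun; congr (_, _).
  by apply: functional_extensionality => s; rewrite /qscale mulrCA.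
- rewrite -IH; congr nrun; congr (_, _).
  by apply: functional_extensionality => s; rewrite /qscale; case: ifP; rewrite ?mulr0.
- by case: (b j); rewrite ?G IH.
Qed.

Lemma cc_ok_cat k C1 C2 :
  cc_ok k (C1 ++ C2) = cc_ok k C1 && cc_ok (k + count (@is_meas N) (flatten C1)) C2.
Proof.
elim: C1 k => [|L C1 IH] k /=; first by rewrite addn0.
by rewrite IH -andbA count_cat addnA.
Qed.

(** The second circuit is taken at offset [off + k1], because its classical controls count
    measurements from the beginning of the whole run; this is why [impl] quantifies over [off]. *)
Lemma impl_seq X (s1 s2 s3 : X -> basis N) t1 d1 c1 e1 t2 d2 c2 e2 :
  impl s1 s2 t1 d1 c1 e1 -> impl s2 s3 t2 d2 c2 e2 ->
  impl s1 s3 (t1 + t2) (d1 + d2) (c1 + c2) (e1 + e2).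
Proof.
move=> [k1 H1] [k2 H2]; exists (k1 + k2) => off.
have [C1 [/andP [ok1 cc1] m1 [T1 D1] [N1 E1] S1]] := H1 off.
have [C2 [/andP [ok2 cc2] m2 [T2 D2] [N2 E2] S2]] := H2 (off + k1).
exists (C1 ++ C2); split.
- by rewrite all_cat ok1 ok2 cc_ok_cat cc1 m1 cc2.
- by rewrite flatten_cat count_cat m1 m2.
- by rewrite /T_count /T_depth flatten_cat !count_cat leq_add // -D1 -D2.
- by rewrite /CNOT_count /CNOT_depth flatten_cat !count_cat !leq_add.
move=> b; have [a1 E1'] := S1 b; have [a2 E2'] := S2 b.
exists (a1 * a2)%R => x.
by rewrite flatten_cat /nrun foldl_cat -!/(nrun _ _ _) E1' nrun_scale E2' /= qscaleM addnA.
Qed.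

Lemma impl_le X (s1 s2 : X -> basis N) t1 d c1 e1 t2 c2 e2 :
  impl s1 s2 t1 d c1 e1 -> t1 <= t2 -> c1 <= c2 -> e1 <= e2 -> impl s1 s2 t2 d c2 e2.
Proof.
move=> [k H] lt lc le; exists k => off; have [C [ok m [T D] [A E] S]] := H off.
by exists C; split=> //; split=> //; [apply: leq_trans lt|apply: leq_trans lc|apply: leq_trans le].
Qed.

(** Meant for uncomputation stages, which have to work after the outputs have been changed. *)
Lemma impl_reindex X Y (h : Y -> X) (s1 s2 : X -> basis N) t d c e :
  impl s1 s2 t d c e -> impl (s1 \o h) (s2 \o h) t d c e.
Proof.
move=> [k H]; exists k => off; have [C [ok m T A S]] := H off.
exists C; split=> // b; have [a E] := S b; exists a => x; exact: E.
Qed.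

(** As the labels are distinct, [index] recovers the position of a measurement from its qubit.
    Renumbering the controls changes neither the qubits nor the kinds of the operations, so all
    costs are kept. *)
Lemma impl_labelled X (s1 s2 : X -> basis N) C :
  all (@layer_ok N) C -> uniq (labs (flatten C)) -> cc_closed [::] C ->
  (forall b, exists a, forall x, lrun b (flatten C) (ket (s1 x)) = qscale a (ket (s2 x))) ->
  impl s1 s2 (T_count C) (T_depth C) (CNOT_count C) (CNOT_depth C).
Proof.
move=> ok ul cl S; exists (size (labs (flatten C))) => off.
pose idx j := off + index j (labs (flatten C)).
have fl : flatten (map (map (renum idx)) C) = map (renum idx) (flatten C).
  by rewrite map_flatten.
have Hi i : i < size (labs (flatten C)) -> idx (nth 0 (labs (flatten C)) i) = off + i.
  by move=> ii; rewrite /idx index_uniq.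
have isT o : is_T (renum idx o) = is_T o by case: o.
have isC o : is_CNOT (renum idx o) = is_CNOT o by case: o.
have isM o : is_meas (renum idx o) = is_meas o by case: o.
exists (map (map (renum idx)) C); split.
- apply/andP; split; last exact: (cc_ok_renum (seen := [::])).
  rewrite all_map; apply: sub_all ok => L; rewrite /layer_ok /= -map_comp.
  by rewrite (@eq_map _ _ _ (@op_qubits N)) // => -[].
- by rewrite fl count_map (eq_count (a2 := @is_meas N)) ?size_labs.
- rewrite /T_count /T_depth fl !count_map (eq_count isT); split=> //.
  by apply: eq_count => L /=; rewrite has_map; apply: eq_has.
- rewrite /CNOT_count /CNOT_depth fl !count_map (eq_count isC); split=> //.
  by rewrite (@eq_count _ _ (has (@is_CNOT N))) // => L /=; rewrite has_map; apply: eq_has.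
move=> b; have [a E] := S (b \o idx); exists a => x.
by rewrite fl nrun_renum // E.
Qed.

End Implementations.

(** * Elementary gadgets *)

Section Gadgets.
Variables (N : nat).
Implicit Types (s v w : basis N) (psi phi : qstate N) (o : op N) (q c t d p : 'I_N).
Implicit Types (P : seq (op N)) (C : circuit N).

Definition xorl v (l : seq 'I_N) : bool := \big[addb/false]_(r <- l) v r.

Definition r2 : algC := ((sqrtC 2)^-1)%R.

Lemma r2_sqr : (r2 * r2 = 2^-1)%R.
Proof. by rewrite /r2 -invfM -expr2 sqrtCK. Qed.

Lemma nota_add x y : (nota (x (+) y) = nota x * nota y)%R.
Proof. by case: x; case: y; rewrite /nota /= ?mulr1 ?mul1r ?mulrNN ?mulr1. Qed.

Lemma lapply_add b o psi phi : lapply b o (qplus psi phi) = qplus (lapply b o psi) (lapply b o phi).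
Proof. by have := lapply_lin b o 1%R 1%R psi phi; rewrite !qscale1. Qed.

Lemma lrun_add b P psi phi : lrun b P (qplus psi phi) = qplus (lrun b P psi) (lrun b P phi).
Proof. by have := lrun_lin b P 1%R 1%R psi phi; rewrite !qscale1. Qed.

Lemma lrun_cons b o P psi : lrun b (o :: P) psi = lrun b P (lapply b o psi).
Proof. by []. Qed.

(** The generators contain neither X nor Z nor CZ, whence X = H S S H, Z = S S, and CZ as a CNOT
    between two Hadamard gates on its target. *)
Definition notP q : seq (op N) := [:: OCl (CH q); OCl (CS q); OCl (CS q); OCl (CH q)].
Definition ccX (j : nat) q : seq (op N) := [:: OCC j (CH q); OCC j (CS q); OCC j (CS q); OCC j (CH q)].
Definition ccZ (j : nat) q : seq (op N) := [:: OCC j (CS q); OCC j (CS q)].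
Definition ccCZ (j : nat) c t : seq (op N) := [:: OCC j (CH t); OCC j (CX c t); OCC j (CH t)].
Definition measX q : seq (op N) := [:: OCl (CH q); OMeas q].
Definition erase q (l : seq 'I_N) : seq (op N) :=
  measX q ++ flatten [seq ccZ q r | r <- l] ++ ccX q q.

Lemma sgni (x : bool) : ((if x then 'i else 1) * (if x then 'i else 1) = nota x :> algC)%R.
Proof. by case: x; rewrite /nota ?mulr1 // -expr2 sqrCi. Qed.

Lemma notP_ket b q v : lrun b (notP q) (ket v) = ket (upd v q (~~ v q)).
Proof.
rewrite /notP !lrun_cons lapplyH !lapply_scale !lapply_add !lapply_scale !lapplyS.
rewrite !lapply_scale !lapplyS !qscaleM !lapply_scale !lapplyH !upd_eq !updK -/r2 /lrun /=.
apply: functional_extensionality => s; rewrite /qplus /qscale.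
set k0 := ket _ s; set k1 := ket _ s.
rewrite [LHS](_ : _ = r2 * r2 * (k0 + k1 + nota (v q) * ('i * 'i) * (k0 - k1)))%R; last by ring.
rewrite r2_sqr -expr2 sqrCi /k0 /k1; case: (v q); rewrite /nota /=; field => //.
Qed.

Lemma lrun_cc b j (gs : seq (cgate N)) psi :
  lrun b [seq OCC j g | g <- gs] psi = if b j then lrun b [seq OCl g | g <- gs] psi else psi.
Proof.
by case E: (b j); elim: gs psi => //= g gs IH psi; rewrite E IH.
Qed.

Lemma ccX_ket b j q v : lrun b (ccX j q) (ket v) = ket (upd v q (v q (+) b j)).
Proof.
rewrite (lrun_cc b j [:: CH q; CS q; CS q; CH q]); case: (b j); last by rewrite addbF upd_id.
by rewrite addbT -(notP_ket b).
Qed.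

Lemma ccZ_ket b j q v : lrun b (ccZ j q) (ket v) = qscale (if b j then nota (v q) else 1)%R (ket v).
Proof.
rewrite (lrun_cc b j [:: CS q; CS q]); case: (b j); last by rewrite qscale1.
by rewrite [map _ _]/= !lrun_cons lapplyS lapply_scale lapplyS qscaleM sgni.
Qed.

Lemma ccZs_ket b j l v : lrun b (flatten [seq ccZ j r | r <- l]) (ket v) =
  qscale (if b j then nota (xorl v l) else 1)%R (ket v).
Proof.
elim: l => [|r l IH]; first by rewrite /xorl big_nil /nota /= if_same qscale1.
rewrite -[flatten _]/(ccZ j r ++ flatten [seq ccZ j r' | r' <- l]) lrun_cat ccZ_ket lrun_scale IH qscaleM /xorl big_cons nota_add.
by case: (b j); rewrite ?mulr1.
Qed.

Lemma ccCZ_ket b j c t v : c != t ->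
  lrun b (ccCZ j c t) (ket v) = qscale (if b j then nota (v c && v t) else 1)%R (ket v).
Proof.
move=> ne; rewrite (lrun_cc b j [:: CH t; CX c t; CH t]); case: (b j); last by rewrite qscale1.
have X w : lapply b (OCl (CX c t)) (ket w) = ket (upd w t (w t (+) w c)) by exact: lapplyX.
have U x : upd v t x c = v c by rewrite upd_ne.
rewrite [map _ _]/= !(lrun_cons, lapply_scale, lapply_add, lapplyH, X, upd_eq, updK, U) -/r2 /lrun /=.
apply: functional_extensionality => s; rewrite /qplus /qscale.
have -> : ket v s = if v t then ket (upd v t true) s else ket (upd v t false) s.
  by rewrite -{1}(upd_id v t); case: (v t).
have e : (r2 * r2 * 2 = 1)%R by rewrite r2_sqr mulVf // pnatr_eq0.
have E (k x : algC) : (x = r2 * r2 * 2 * k -> x = k)%R by rewrite e mul1r.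
by case: (v c); case: (v t); rewrite /nota /=; apply: E; ring.
Qed.

Lemma measX_ket b q v : lrun b (measX q) (ket v) =
  qscale (r2 * (if b q then nota (v q) else 1))%R (ket (upd v q (b q))).
Proof.
rewrite /measX !lrun_cons lapplyH lapply_scale lapply_add lapply_scale !lapplyM !upd_eq -/r2 /lrun /=.
by apply: functional_extensionality => s; rewrite /qplus /qscale; case: (b q) => /=; ring.
Qed.

Lemma xorl_upd v q x l : q \notin l -> xorl (upd v q x) l = xorl v l.
Proof.
move=> nl; rewrite /xorl; apply: eq_big_seq => r rl.
by rewrite upd_ne //; apply: contra nl => /eqP <-.
Qed.

(** The X measurement produces the sign (-1)^(b q * v q). Since [v q] is the parity of [l],
    controlled Z gates on [l] produce the same sign and cancel it; the controlled X then resets [q].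
    No CNOT is involved. *)
Lemma erase_ket b q l v : q \notin l -> v q = xorl v l ->
  lrun b (erase q l) (ket v) = qscale r2 (ket (upd v q false)).
Proof.
move=> nl e; rewrite /erase !lrun_cat measX_ket !lrun_scale ccZs_ket lrun_scale ccX_ket qscaleM.
rewrite xorl_upd // -e upd_eq updK addbb; congr qscale.
by case: (b q); case: (v q); rewrite /nota; ring.
Qed.

(** The qubits of the lists are not erased themselves, so each parity is still available when its
    turn comes. *)
Lemma erase_family b (es : seq ('I_N * seq 'I_N)) v v' :
  uniq (map fst es) ->
  (forall q l, (q, l) \in es -> v q = xorl v l /\ v' q = false) ->
  (forall q l r, (q, l) \in es -> r \in l -> r \notin map fst es) ->
  (forall q, q \notin map fst es -> v' q = v q) ->
  lrun b (flatten [seq erase e.1 e.2 | e <- es]) (ket v) = qscale (r2 ^+ size es)%R (ket v').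
Proof.
elim: es v => [|[q l] es IH] v.
  by move=> _ _ _ H; rewrite expr0 qscale1; congr ket; apply: functional_extensionality => q; rewrite H.
rewrite -[flatten _]/(erase q l ++ flatten [seq erase e.1 e.2 | e <- es]) lrun_cat [size _]/=.
rewrite [map fst _]/= cons_uniq => /andP [nq us] H1 H2 H3.
have [e1 e2] := H1 q l (mem_head _ _).
have ql : q \notin l by apply/negP => /(H2 q l q (mem_head _ _)); rewrite inE eqxx.
rewrite erase_ket // lrun_scale (IH (upd v q false)) //.
- by rewrite qscaleM -exprS.
- move=> q' l' i'; have [|e1' ->] := H1 q' l'; first by rewrite inE i' orbT.
  rewrite xorl_upd; last first.
    by apply/negP => /(H2 q' l' q); rewrite !inE i' orbT eqxx => /(_ isT).
  rewrite upd_ne ?e1' //; apply: contraNneq nq => <-.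
  by apply/mapP; exists (q', l').
- move=> q' l' r i' ir; have := H2 q' l' r; rewrite !inE i' orbT negb_or => /(_ isT ir).
  by case/andP.
- move=> q' n'; rewrite /upd; case: eqP => [->//|/eqP ne].
  by apply: H3; rewrite inE negb_or ne.
Qed.

End Gadgets.

(** * The AND gate, its uncomputation, and links of a chain *)

Section Gadgets2.
Variables (N : nat).
Implicit Types (s v : basis N) (psi phi : qstate N) (o : op N) (q c t d p a b z w : 'I_N).
Implicit Types (P : seq (op N)) (C : circuit N).

Definition seqc P : circuit N := [seq [:: o] | o <- P].

Lemma flatten_seqc P : flatten (seqc P) = P.
Proof. by elim: P => //= o P ->. Qed.

Definition cxs (l : seq ('I_N * 'I_N)) : seq (op N) := [seq OCl (CX e.1 e.2) | e <- l].

(** No control is ever a target, so each CNOT reads an initial value and the contributions to a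
    target add up. *)
Lemma cxs_ket r l v : (forall e e', e \in l -> e' \in l -> e.1 != e'.2) ->
  lrun r (cxs l) (ket v) =
  ket (fun q => v q (+) \big[addb/false]_(e <- l | e.2 == q) v e.1).
Proof.
elim: l v => [|[c t] l IH] v H.
  by congr ket; apply: functional_extensionality => q; rewrite big_nil addbF.
have ct : c != t by apply: (H (c, t) (c, t)); rewrite mem_head.
rewrite [cxs _]/= lrun_cons lapplyX // IH => [|e e' i i']; last by apply: H; rewrite inE ?i ?i' orbT.
congr ket; apply: functional_extensionality => q; rewrite big_cons /=.
have -> : \big[addb/false]_(e <- l | e.2 == q) upd v t (v t (+) v c) e.1 =
          \big[addb/false]_(e <- l | e.2 == q) v e.1.
  rewrite big_seq_cond [RHS]big_seq_cond; apply: eq_bigr => e /andP [i _].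
  by rewrite upd_ne // (H e (c, t)) // inE ?i ?eqxx ?orbT.
by rewrite /upd eq_sym; case: eqP => [->|//]; rewrite addbA.
Qed.

Lemma omega_sqr : (omega * omega = 'i)%R.
Proof.
have e : ((1 + 'i) * (1 + 'i) = 2 * 'i :> algC)%R.
  by rewrite -expr2 sqrrD sqrCi expr1n mul1r; ring.
rewrite /omega -/r2 mulrACA r2_sqr e mulrAC mulfV ?mul1r // pnatr_eq0 //.
Qed.

Lemma omega_invV : (omega * omega_inv = 1)%R.
Proof.
have e : ((1 + 'i) * (1 - 'i) = 2 :> algC)%R by rewrite mulrC -subr_sqr sqrCi expr1n opprK.
by rewrite /omega /omega_inv -/r2 mulrACA r2_sqr e mulfV // pnatr_eq0.
Qed.

Lemma omega_inv_sqr : (omega_inv * omega_inv = - 'i)%R.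
Proof.
have e : ((1 - 'i) * (1 - 'i) = 2 * - 'i :> algC)%R.
  by rewrite -expr2 sqrrB sqrCi expr1n mul1r; ring.
by rewrite /omega_inv -/r2 mulrACA r2_sqr e mulrAC mulfV ?mul1r // pnatr_eq0.
Qed.

Definition and_phase (z x y : bool) : algC :=
  ((if z then omega else 1) * (if x (+) z then omega_inv else 1)
   * (if y (+) z then omega_inv else 1) * (if x (+) y (+) z then omega else 1))%R.

Lemma and_phaseE (z x y : bool) : and_phase z x y = (if x && y then if z then 'i else - 'i else 1)%R.
Proof.
have e1 := omega_sqr; have e2 := omega_invV; have e3 := omega_inv_sqr.
have e4 : (omega_inv * omega = 1)%R by rewrite mulrC.
rewrite /and_phase; case: z; case: x; case: y; rewrite /= ?mulr1 ?mul1r ?e2 ?mul1r ?e4 //.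
Qed.

(** The second contribution to [w] is read from [a] once it holds a + z, so two layers load all four
    parities. Afterwards only [a] and [b] are restored: [w] keeps a + b + z and is erased by a
    measurement, which limits the gate to six CNOTs in four layers. *)
Definition and_mid a b z w : circuit N :=
  [:: [:: OCl (CX z a); OCl (CX b w)]; [:: OCl (CX a w); OCl (CX z b)];
      [:: OT z; OTdg a; OTdg b; OT w]; [:: OCl (CX z a)]; [:: OCl (CX z b)]].

(* In the T layer the four qubits hold z, x+z, y+z and x+y+z, so that the
   phase is (-1)^(xyz) (-i)^(xy); the Hadamard gate on z then yields xy and
   the S gate removes the factor (-i)^(xy). *)
Definition andC a b z w : circuit N :=
  [:: OCl (CH z)] :: and_mid a b z w ++
  seqc (erase w [:: a; b; z] ++ [:: OCl (CH z); OCl (CS z)]).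

Lemma uniq3P a b z : uniq [:: a; b; z] -> [/\ a != b, a != z & b != z].
Proof. by rewrite /= !inE !negb_or => /and3P [/andP [-> ->] -> _]. Qed.

Lemma uniq4P a b z w : uniq [:: a; b; z; w] ->
  [/\ [/\ a != b, a != z & a != w], b != z /\ b != w & z != w].
Proof.
by rewrite /= !inE !negb_or => /and4P [/and3P [-> -> ->] /andP [-> ->] -> _].
Qed.

Lemma and_mid_ket r a b z w v : uniq [:: a; b; z; w] -> v w = false ->
  lrun r (flatten (and_mid a b z w)) (ket v) =
  qscale (and_phase (v z) (v a) (v b)) (ket (upd v w (v a (+) v b (+) v z))).
Proof.
move=> /uniq4P [[ab az aw] [bz bw] zw] w0.
have za : z != a by rewrite eq_sym. have zb : z != b by rewrite eq_sym.
have ba : b != a by rewrite eq_sym. have wa : w != a by rewrite eq_sym.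
have wb : w != b by rewrite eq_sym. have wz : w != z by rewrite eq_sym.
have X c t (ne : c != t) u : lapply r (OCl (CX c t)) (ket u) = ket (upd u t (u t (+) u c)).
  exact: lapplyX.
have U q q' (ne : q' != q) u x : upd u q x q' = u q' by exact: upd_ne.
have UU := (upd_eq, U _ _ ab, U _ _ az, U _ _ aw, U _ _ bz, U _ _ bw, U _ _ zw,
  U _ _ za, U _ _ zb, U _ _ ba, U _ _ wa, U _ _ wb, U _ _ wz).
rewrite -[flatten _]/[:: OCl (CX z a); OCl (CX b w); OCl (CX a w); OCl (CX z b); OT z; OTdg a;
  OTdg b; OT w; OCl (CX z a); OCl (CX z b)].
rewrite !(lrun_cons, lapply_scale, lapplyT, lapplyTd, X _ _ za, X _ _ zb, X _ _ aw, X _ _ bw, UU).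
rewrite /lrun /= !qscaleM w0 addFb; congr qscale.
  rewrite /and_phase; case: (v a); case: (v b); case: (v z) => /=; ring.
congr ket; apply: functional_extensionality => q; rewrite /upd.
case: (q =P b) => [->|_]; first by rewrite (negbTE bw) addbK.
case: (q =P a) => [->|_]; first by rewrite (negbTE aw) addbK.
by case: (q =P w) => // _; rewrite addbA [v b (+) v a]addbC.
Qed.

Lemma and_ket r a b z w v : uniq [:: a; b; z; w] -> v z = false -> v w = false ->
  lrun r (flatten (andC a b z w)) (ket v) = qscale r2 (ket (upd v z (v a && v b))).
Proof.
move=> un z0 w0.
have [[ab az aw] [bz bw] zw] := uniq4P un.
have wz : w != z by rewrite eq_sym.
rewrite -[flatten _]/(OCl (CH z) :: flatten (and_mid a b z w ++
  seqc (erase w [:: a; b; z] ++ [:: OCl (CH z); OCl (CS z)]))) flatten_cat flatten_seqc.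
rewrite lrun_cons lapplyH -/r2 z0 !(lrun_scale, lrun_add).
(* The first Hadamard gate creates both branches z = 0 and z = 1. [M] runs the rest of the gate on
   the branch z = x; the two results then interfere. *)
have M x : lrun r (flatten (and_mid a b z w) ++ erase w [:: a; b; z] ++ [:: OCl (CH z); OCl (CS z)])
    (ket (upd v z x)) = qscale (and_phase x (v a) (v b) * r2 * r2)%R
      (qplus (ket (upd v z false)) (qscale (nota x * 'i)%R (ket (upd v z true)))).
  have U u : (upd v z x) u = if u == z then x else v u by [].
  have Uw : upd (upd v z x) w false = upd v z x.
    by rewrite -{2}(upd_id (upd v z x) w) upd_ne // w0.
  rewrite lrun_cat lrun_cat and_mid_ket // ?U ?(negbTE wz) // lrun_scale erase_ket.
  - rewrite updK Uw eqxx (negbTE az) (negbTE bz) !(lrun_scale, lrun_cons) lapplyH upd_eq !updK -/r2.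
    rewrite !(lapply_scale, lapply_add) !lapplyS !upd_eq /lrun /= !qscaleM.
    by apply: functional_extensionality => s; rewrite /qplus /qscale; ring.
  - by rewrite !inE !negb_or ![w == _]eq_sym aw bw.
  - rewrite upd_eq xorl_upd; last by rewrite !inE !negb_or ![w == _]eq_sym aw bw.
    by rewrite /xorl !big_cons big_nil !U addbF addbA.
rewrite !M !and_phaseE.
have e : (r2 * r2 * 2 = 1)%R by rewrite r2_sqr mulVf // pnatr_eq0.
have i2 : ('i * 'i = -1 :> algC)%R by rewrite -expr2 sqrCi.
apply: functional_extensionality => s; rewrite /qplus /qscale.
rewrite /nota; case: (v a && v b); set k0 := ket (upd v z false) s; set k1 := ket (upd v z true) s.
  transitivity (r2 * (r2 * r2 * 2) * (- ('i * 'i)) * k1)%R; first by ring.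
  by rewrite e i2; ring.
transitivity (r2 * (r2 * r2 * 2) * k0)%R; first by ring.
by rewrite e; ring.
Qed.

(** The X measurement leaves the sign (-1)^(r z * v a * v b), which is undone by a CZ gate
    controlled by the outcome. The cost is the one CNOT inside CZ, and no T gate. *)
Lemma uand_ket r a b z v : uniq [:: a; b; z] -> v z = v a && v b ->
  lrun r (measX z ++ ccCZ z a b ++ ccX z z) (ket v) = qscale r2 (ket (upd v z false)).
Proof.
move=> /uniq3P [ab az bz] e.
rewrite lrun_cat lrun_cat measX_ket !lrun_scale ccCZ_ket // lrun_scale ccX_ket qscaleM.
rewrite upd_eq updK addbb !upd_ne // -e; congr qscale.
by case: (r z); case: (v z); rewrite /nota; ring.
Qed.

Definition link d c p : circuit N :=
  [:: [:: OCl (CH c)]; [:: OCl (CX c p)]; [:: OCl (CX d p)]; [:: OMeas p]].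

(** The measured parity c + d selects one of the two branches of |+> on [c], so [c] becomes equal to
    [d] up to the outcome. *)
Lemma link_ket r d c p v : uniq [:: d; c; p] -> v c = false -> v p = false ->
  lrun r (flatten (link d c p)) (ket v) =
  qscale r2 (ket (upd (upd v c (v d (+) r p)) p (r p))).
Proof.
move=> /uniq3P [dc dp cp] c0 p0.
rewrite -[flatten _]/[:: OCl (CH c); OCl (CX c p); OCl (CX d p); OMeas p].
have pc : p != c by rewrite eq_sym.
have X (x y : 'I_N) (ne : x != y) u : lapply r (OCl (CX x y)) (ket u) = ket (upd u y (u y (+) u x)).
  exact: lapplyX.
have U q q' (ne : q' != q) u x : upd u q x q' = u q' by exact: upd_ne.
rewrite !(lrun_cons, lapplyH, lapply_scale, lapply_add, X _ _ cp, X _ _ dp, lapplyM).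
rewrite !(upd_eq, updK, U _ _ dc, U _ _ dp, U _ _ cp, U _ _ pc, c0, p0) -/r2 /lrun /=.
apply: functional_extensionality => s; rewrite /qplus /qscale.
by case: (v d); case: (r p); rewrite /nota /=; ring.
Qed.

End Gadgets2.

(** * Families of gadgets on disjoint qubits *)

Section Families.
Variables (N : nat).
Implicit Types (s v : basis N) (psi phi : qstate N) (o : op N) (q c t d p a b z w : 'I_N).
Implicit Types (P : seq (op N)) (C : circuit N).

Lemma disjP P1 P2 : (forall q, q \in supp P1 -> q \in supp P2 -> false) -> disj P1 P2.
Proof. by move=> H; apply/hasPn => q q2; apply/negP => q1; by have := H q q1 q2. Qed.

Lemma supp_mapP (T : eqType) (f : T -> op N) (l : seq T) q :
  q \in supp (map f l) -> exists2 x, x \in l & q \in op_qubits (f x).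
Proof. by rewrite /supp -map_comp => /flatten_mapP. Qed.

Lemma labs_supp P j : j \in labs P -> exists2 q, q \in supp P & j = q.
Proof.
elim: P => //= o P IH; rewrite /supp /=.
case: o => [g|q|q|q|i g] /=; rewrite ?inE; try by move=> /IH [q' h ->]; exists q' => //; rewrite ?inE ?mem_cat h ?orbT.
case/orP => [/eqP ->|/IH [q' h ->]]; first by exists q; rewrite ?inE ?eqxx.
by exists q' => //; rewrite inE h orbT.
Qed.

Section Parallel.
Variables (G : eqType) (F : G -> circuit N) (qs : G -> seq 'I_N).
Hypothesis Fqs : forall g, {subset supp (flatten (F g)) <= qs g}.
Implicit Type gs : seq G.

Definition parl gs : circuit N := foldr (fun g C => zipcat (F g) C) [::] gs.

Lemma supp_parl gs : {subset supp (flatten (parl gs)) <= flatten (map qs gs)}.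
Proof.
elim: gs => //= g gs IH q; rewrite (perm_mem (supp_zipcat _ _)) !mem_cat.
by case/orP => [/Fqs ->//|/IH ->]; rewrite orbT.
Qed.

Lemma par_ok_parl g gs : uniq (flatten (map qs (g :: gs))) -> par_ok (F g) (parl gs).
Proof.
rewrite /= cat_uniq => /and3P [_ /hasPn H _]; apply/par_ok_disj/disjP => q /Fqs q1 /supp_parl /H.
by rewrite /= q1.
Qed.

Lemma lrun_parl r gs psi : uniq (flatten (map qs gs)) ->
  lrun r (flatten (parl gs)) psi = lrun r (flatten [seq flatten (F g) | g <- gs]) psi.
Proof.
elim: gs psi => // g gs IH psi un; rewrite lrun_zipcat ?par_ok_parl // IH.
  by rewrite -lrun_cat.
by move: un; rewrite /= cat_uniq => /and3P [].
Qed.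

Lemma layers_parl gs : uniq (flatten (map qs gs)) ->
  (forall g, g \in gs -> all (@layer_ok N) (F g)) -> all (@layer_ok N) (parl gs).
Proof.
elim: gs => // g gs IH un H; apply: layers_zipcat; first exact: par_ok_parl.
  by apply: H; rewrite mem_head.
apply: IH => [|h hgs]; last by apply: H; rewrite inE hgs orbT.
by move: un; rewrite /= cat_uniq => /and3P [].
Qed.

Lemma uniq_labs_parl gs : uniq (flatten (map qs gs)) ->
  (forall g, g \in gs -> uniq (labs (flatten (F g)))) -> uniq (labs (flatten (parl gs))).
Proof.
elim: gs => // g gs IH un H.
rewrite [parl _]/= (perm_uniq (labs_zipcat _ _)) cat_uniq H ?mem_head //=; apply/andP; split.
  apply/hasPn => j /labs_supp [q q2 ->]; apply/negP => /labs_supp [q' q1 /ord_inj e].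
  move: un; rewrite /= cat_uniq => /and3P [_ /hasPn/(_ q (supp_parl q2)) + _].
  by rewrite /= e (Fqs q1).
apply: IH => [|h hgs]; last by apply: H; rewrite inE hgs orbT.
by move: un; rewrite /= cat_uniq => /and3P [].
Qed.

Lemma closed_parl gs : (forall g, cc_closed [::] (F g)) -> cc_closed [::] (parl gs).
Proof. by move=> H; elim: gs => //= g gs IH; exact: (cc_closed_zipcat (H g) IH). Qed.

Lemma count_parl (a : pred (op N)) k gs : (forall g, count a (flatten (F g)) = k) ->
  count a (flatten (parl gs)) = k * size gs.
Proof. by move=> H; elim: gs => [|g gs IH] /=; rewrite ?muln0 // count_zipcat IH H mulnS. Qed.

Lemma depth_parl (a : pred (op N)) sh gs : (forall g, map (has a) (F g) = sh) ->
  count (has a) (parl gs) = count id sh * (0 < size gs).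
Proof.
move=> H; have cnt (C : circuit N) : count (has a) C = count id (map (has a) C).
  by rewrite count_map; apply: eq_count.
rewrite cnt; case: gs => [|g gs] /=; first by rewrite muln0.
rewrite muln1; congr (count id); elim: gs g => [|h gs IH] g /=; last exact/has_zipcat/IH.
by case: (F g) (H g).
Qed.

End Parallel.

Definition plain P := all (fun o => [&& ~~ is_T o, ~~ is_CNOT o & uniq (op_qubits o)]) P.

Lemma plain_count (a : pred (op N)) P : plain P ->
  (forall o, [&& ~~ is_T o, ~~ is_CNOT o & uniq (op_qubits o)] -> ~~ a o) ->
  count a P = 0 /\ count (has a) (seqc P) = 0.
Proof.
move=> pl H; have H0 : ~~ has a P by rewrite -all_predC; apply: sub_all pl => o /H.
split; first by apply/eqP; rewrite -leqn0 leqNgt -has_count.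
apply/eqP; rewrite -leqn0 leqNgt -has_count; apply: contra H0.
by elim: (P) => //= o l IH; rewrite orbF => /orP [->//|/IH ->]; rewrite orbT.
Qed.

Lemma plain_layers P : plain P -> all (@layer_ok N) (seqc P).
Proof.
by move=> pl; rewrite all_map; apply: sub_all pl => o /and3P [_ _]; rewrite /layer_ok /= cats0.
Qed.

Lemma cc_closed_all seen P :
  all (fun o => if o is OCC j _ then j \in seen else true) P -> cc_closed seen (seqc P).
Proof.
elim: P seen => //= o P IH seen /andP [oo oP]; rewrite oo /=; apply: IH.
by apply: sub_all oP => -[] // j g; rewrite mem_cat => ->.
Qed.

Lemma cc_closed_seqc_cat seen P1 P2 : cc_closed seen (seqc (P1 ++ P2)) =
  cc_closed seen (seqc P1) && cc_closed (seen ++ labs P1) (seqc P2).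
Proof. by rewrite /seqc map_cat cc_closed_cat flatten_seqc. Qed.

(** Only layers with T gates or CNOTs are counted, so here each operation gets a layer of its own
    and no disjointness has to be shown. *)
Lemma impl_plain X (s1 s2 : X -> basis N) P :
  plain P -> uniq (labs P) -> cc_closed [::] (seqc P) ->
  (forall r, exists k, forall x, lrun r P (ket (s1 x)) = qscale k (ket (s2 x))) ->
  impl s1 s2 0 0 0 0.
Proof.
move=> pl ul cl S.
have [t1 t2] : count (@is_T N) P = 0 /\ count (has (@is_T N)) (seqc P) = 0.
  by apply: plain_count => // o /and3P [].
have [c1 c2] : count (@is_CNOT N) P = 0 /\ count (has (@is_CNOT N)) (seqc P) = 0.
  by apply: plain_count => // o /and3P [].
have := @impl_labelled N X s1 s2 (seqc P).
rewrite /T_count /T_depth /CNOT_count /CNOT_depth flatten_seqc t1 t2 c1 c2; apply=> //.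
exact: plain_layers.
Qed.

Lemma plain_flatten (T : Type) (f : T -> seq (op N)) l :
  (forall x, plain (f x)) -> plain (flatten (map f l)).
Proof. by move=> H; elim: l => //= x l IH; rewrite /plain all_cat -!/(plain _) H. Qed.

Lemma plain_ccZ (j : nat) q : plain (ccZ j q). Proof. by []. Qed.

Lemma plain_erase q l : plain (erase q l).
Proof.
by rewrite /erase /plain !all_cat -!/(plain _) plain_flatten // => r; exact: plain_ccZ.
Qed.

Lemma labs_flatten_nil (T : Type) (f : T -> seq (op N)) l :
  (forall x, labs (f x) = [::]) -> labs (flatten (map f l)) = [::].
Proof. by move=> H; elim: l => //= x l IH; rewrite labs_cat H IH. Qed.

Lemma labs_erase q l : labs (erase q l) = [:: q : nat].
Proof. by rewrite /erase !labs_cat labs_flatten_nil. Qed.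

Lemma closed_erase q l : cc_closed [::] (seqc (erase q l)).
Proof.
rewrite /erase cc_closed_seqc_cat /=; apply: cc_closed_all.
rewrite all_cat /= !inE eqxx /= andbT; elim: l => //= r l IH.
by rewrite !inE eqxx.
Qed.

Lemma impl_erase X (s1 s2 : X -> basis N) (es : seq ('I_N * seq 'I_N)) :
  uniq (map fst es) ->
  (forall q l r, (q, l) \in es -> r \in l -> r \notin map fst es) ->
  (forall x q l, (q, l) \in es -> s1 x q = xorl (s1 x) l /\ s2 x q = false) ->
  (forall x q, q \notin map fst es -> s2 x q = s1 x q) ->
  impl s1 s2 0 0 0 0.
Proof.
move=> us H2 H1 H3; apply: (impl_plain (P := flatten [seq erase e.1 e.2 | e <- es])).
- by apply: plain_flatten => e; apply: plain_erase.
- have -> : labs (flatten [seq erase e.1 e.2 | e <- es]) = [seq nat_of_ord q | q <- map fst es].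
    elim: (es) => // e l IH.
    by rewrite -[flatten _]/(erase e.1 e.2 ++ flatten [seq erase e.1 e.2 | e <- l]) labs_cat labs_erase IH.
  by rewrite map_inj_uniq //; exact: ord_inj.
- elim: (es) => // e l IH.
  rewrite -[flatten _]/(erase e.1 e.2 ++ flatten [seq erase e.1 e.2 | e <- l]).
  rewrite cc_closed_seqc_cat closed_erase.
  by apply: cc_closed_sub IH => j; rewrite in_nil.
move=> r; exists (r2 ^+ size es)%R => x.
by apply: erase_family => // [q l i|q i]; [exact: H1|exact: H3].
Qed.

Lemma impl_not X (s1 s2 : X -> basis N) (l : seq 'I_N) :
  uniq l -> (forall x q, s2 x q = s1 x q (+) (q \in l)) -> impl s1 s2 0 0 0 0.
Proof.
move=> ul H; apply: (impl_plain (P := flatten [seq notP q | q <- l])).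
- exact: plain_flatten.
- by rewrite labs_flatten_nil.
- apply: cc_closed_all; elim: (l) => //= q l' IH.
move=> r; exists 1%R => x; rewrite qscale1.
have -> : s2 x = fun q => s1 x q (+) (q \in l) by apply: functional_extensionality.
elim: l (s1 x) ul {H} => [|q l IH] v.
  by move=> _; congr ket; apply: functional_extensionality => q; rewrite addbF.
rewrite cons_uniq => /andP [nq ul].
rewrite -[flatten _]/(notP q ++ flatten [seq notP q | q <- l]) lrun_cat notP_ket IH //.
congr ket; apply: functional_extensionality => q'; rewrite inE /upd.
by case: eqP => [->|//]; rewrite (negbTE nq) addbF addbT.
Qed.

End Families.

(** * Stages of CNOTs, of AND gates and of their uncomputation *)

Section Stages.
Variables (N : nat).
Implicit Types (s v : basis N) (psi phi : qstate N) (o : op N) (q c t d p a b z w : 'I_N).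
Implicit Types (P : seq (op N)) (C : circuit N).

Lemma closed_noOCC seen C :
  all (fun o => if o is OCC _ _ then false else true) (flatten C) -> cc_closed seen C.
Proof.
elim: C seen => //= L C IH seen; rewrite all_cat => /andP [l c]; rewrite IH // andbT.
by apply: sub_all l => -[].
Qed.

(** As controls and targets never meet, the grouping [cl] only decides which CNOTs share a layer;
    the effect is that of the whole list. *)
Lemma impl_cx X (s1 s2 : X -> basis N) (cl : seq (seq ('I_N * 'I_N))) :
  (forall l, l \in cl -> uniq (flatten [seq [:: e.1; e.2] | e <- l])) ->
  (forall e e', e \in flatten cl -> e' \in flatten cl -> e.1 != e'.2) ->
  (forall x q, s2 x q = s1 x q (+) \big[addb/false]_(e <- flatten cl | e.2 == q) s1 x e.1) ->
  impl s1 s2 0 0 (size (flatten cl)) (size cl).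
Proof.
move=> ul ne H; pose C := [seq cxs l | l <- cl].
have fl : flatten C = cxs (flatten cl) by rewrite /C /cxs map_flatten.
have nT l : count (@is_T N) (cxs l) = 0 by elim: l.
have nM l : labs (cxs l : seq (op N)) = [::] by elim: l.
have := @impl_labelled N X s1 s2 C.
have -> : T_count C = 0 by rewrite /T_count fl nT.
have -> : T_depth C = 0.
  apply/eqP; rewrite -leqn0 leqNgt -has_count /C has_map; apply/hasPn => l _ /=.
  by rewrite has_count nT.
have -> : CNOT_count C = size (flatten cl).
  by rewrite /CNOT_count fl; elim: (flatten cl) => //= e l ->.
move=> W; refine (impl_le (W _ _ _ _) _ _ _) => //.
- rewrite all_map; apply/allP => l /ul /=; rewrite /layer_ok /cxs -map_comp.
  by rewrite (@eq_map _ _ _ (fun e => [:: e.1; e.2])).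
- by rewrite fl nM.
- apply: closed_noOCC; rewrite fl; by elim: (flatten cl).
- move=> r; exists 1%R => x; rewrite fl cxs_ket // qscale1; congr ket.
  exact: functional_extensionality.
- by rewrite /CNOT_depth /C (leq_trans (count_size _ _)) ?size_map.
Qed.

Definition quad := ('I_N * 'I_N * 'I_N * 'I_N)%type.
Definition quad_qs (g : quad) : seq 'I_N := let: (a, b, z, w) := g in [:: a; b; z; w].
Definition quadC (g : quad) : circuit N := let: (a, b, z, w) := g in andC a b z w.

Lemma quad_supp g : {subset supp (flatten (quadC g)) <= quad_qs g}.
Proof.
move: g => [[[a b] z] w] q /=; rewrite !inE.
by case: (q == a); case: (q == b); case: (q == z); case: (q == w).
Qed.

Lemma uniq_mem_flatten (T U : eqType) (f : T -> seq U) (l : seq T) x :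
  uniq (flatten (map f l)) -> x \in l -> uniq (f x).
Proof.
elim: l => //= y l IH; rewrite cat_uniq inE => /and3P [u0 _ u1] /orP [/eqP -> //|].
exact: IH.
Qed.

Lemma and_family r (gs : seq quad) v v' :
  uniq (flatten (map quad_qs gs)) ->
  (forall a b z w, (a, b, z, w) \in gs -> [/\ v z = false, v w = false & v' z = v a && v b]) ->
  (forall q, q \notin [seq g.1.2 | g <- gs] -> v' q = v q) ->
  lrun r (flatten [seq flatten (quadC g) | g <- gs]) (ket v) = qscale (r2 ^+ size gs)%R (ket v').
Proof.
elim: gs v => [|[[[a b] z] w] gs IH] v un H1 H2.
  by rewrite expr0 qscale1; congr ket; apply: functional_extensionality => q; rewrite H2.
have [z0 w0 e1] := H1 a b z w (mem_head _ _).
rewrite -[flatten _]/(flatten (andC a b z w) ++ flatten [seq flatten (quadC g) | g <- gs]) lrun_cat.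
move: un; rewrite -[flatten _]/([:: a; b; z; w] ++ flatten (map quad_qs gs)) cat_uniq => /and3P [u0 /hasPn nn un].
rewrite and_ket // lrun_scale (IH (upd v z (v a && v b))) // ?qscaleM -?exprS //.
- move=> a' b' z' w' i; have [|z0' w0' e1'] := H1 a' b' z' w'; first by rewrite inE i orbT.
  have N3 q : q \in [:: a'; b'; z'; w'] -> q != z.
    move=> iq; have /nn : q \in flatten (map quad_qs gs) by apply/flatten_mapP; exists (a', b', z', w').
    by apply: contraNneq => ->; rewrite !inE eqxx !orbT.
  by rewrite e1' !upd_ne ?N3 // !inE eqxx ?orbT.
- move=> q nq; rewrite /upd; case: eqP => [->//|/eqP ne]; apply: H2.
  by rewrite inE negb_or ne.
Qed.

Lemma impl_and X (s1 s2 : X -> basis N) (gs : seq quad) :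
  uniq (flatten (map quad_qs gs)) ->
  (forall x a b z w, (a, b, z, w) \in gs ->
     [/\ s1 x z = false, s1 x w = false & s2 x z = s1 x a && s1 x b]) ->
  (forall x q, q \notin [seq g.1.2 | g <- gs] -> s2 x q = s1 x q) ->
  impl s1 s2 (4 * size gs) (0 < size gs) (6 * size gs) 4.
Proof.
move=> un H1 H2; pose C := parl quadC gs.
have unq (g : quad) : g \in gs -> uniq (quad_qs g) by exact: uniq_mem_flatten.
have := @impl_labelled N X s1 s2 C.
rewrite /T_count /T_depth /CNOT_count /CNOT_depth.
rewrite (@count_parl _ _ _ _ 4); last by move=> [[[a b] z] w].
rewrite (@count_parl _ _ _ _ 6); last by move=> [[[a b] z] w].
(* The 20 layers of [andC]: one for the Hadamard gate, five of [and_mid], twelve erasing [w], two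
   for H and S on [z]. This shape marks the T layer, the next one the four CNOT layers. *)
rewrite (@depth_parl _ _ _ _ [:: false; false; false; true; false; false; false; false; false;
  false; false; false; false; false; false; false; false; false; false; false]); last by move=> [[[a b] z] w].
rewrite (@depth_parl _ _ _ _ [:: false; true; true; false; true; true; false; false; false;
  false; false; false; false; false; false; false; false; false; false; false]); last by move=> [[[a b] z] w].
rewrite /= mul1n => W; refine (impl_le (W _ _ _ _) _ _ _) => //.
- apply: (layers_parl quad_supp) => // -[[[a b] z] w] /unq /uniq4P [[ab az aw] [bz bw] zw].
  by rewrite /= /layer_ok /= !inE !negb_or ?ab ?az ?aw ?bz ?bw ?zw ?(eq_sym z) ?(eq_sym w) ?ab ?az ?aw ?bz ?bw ?zw.
- by apply: (uniq_labs_parl quad_supp) => // -[[[a b] z] w].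
- apply: closed_parl => -[[[a b] z] w]; rewrite /= !inE !eqxx //.
- move=> r; exists (r2 ^+ size gs)%R => x; rewrite (lrun_parl quad_supp) // {W C}.
  exact: (and_family r un (H1 x) (H2 x)).
- by case: (size gs).
Qed.

Definition trip := ('I_N * 'I_N * 'I_N)%type.
Definition trip_qs (g : trip) : seq 'I_N := let: (a, b, z) := g in [:: a; b; z].
Definition tripC (g : trip) : circuit N :=
  let: (a, b, z) := g in seqc (measX z ++ ccCZ z a b ++ ccX z z).

Lemma trip_supp g : {subset supp (flatten (tripC g)) <= trip_qs g}.
Proof.
by move: g => [[a b] z] q /=; rewrite !inE; case: (q == a); case: (q == b); case: (q == z).
Qed.

Lemma uand_family r (gs : seq trip) v v' :
  uniq (flatten (map trip_qs gs)) ->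
  (forall a b z, (a, b, z) \in gs -> v z = v a && v b /\ v' z = false) ->
  (forall q, q \notin [seq g.2 | g <- gs] -> v' q = v q) ->
  lrun r (flatten [seq flatten (tripC g) | g <- gs]) (ket v) = qscale (r2 ^+ size gs)%R (ket v').
Proof.
elim: gs v => [|[[a b] z] gs IH] v un H1 H2.
  by rewrite expr0 qscale1; congr ket; apply: functional_extensionality => q; rewrite H2.
have [e0 e1] := H1 a b z (mem_head _ _).
rewrite -[flatten _]/(flatten (seqc (measX z ++ ccCZ z a b ++ ccX z z)) ++
  flatten [seq flatten (tripC g) | g <- gs]) lrun_cat flatten_seqc.
move: un; rewrite -[flatten _]/([:: a; b; z] ++ flatten (map trip_qs gs)) cat_uniq => /and3P [u0 /hasPn nn un].
rewrite uand_ket // lrun_scale (IH (upd v z false)) // ?qscaleM -?exprS //.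
- move=> a' b' z' i; have [|e0' e1'] := H1 a' b' z'; first by rewrite inE i orbT.
  have N3 q : q \in [:: a'; b'; z'] -> q != z.
    move=> iq; have /nn : q \in flatten (map trip_qs gs) by apply/flatten_mapP; exists (a', b', z').
    by apply: contraNneq => ->; rewrite !inE eqxx !orbT.
  by rewrite e1' !upd_ne ?N3 // !inE eqxx ?orbT.
- move=> q nq; rewrite /upd; case: eqP => [->//|/eqP ne]; apply: H2.
  by rewrite inE negb_or ne.
Qed.

Lemma impl_uand X (s1 s2 : X -> basis N) (gs : seq trip) :
  uniq (flatten (map trip_qs gs)) ->
  (forall x a b z, (a, b, z) \in gs -> s1 x z = s1 x a && s1 x b /\ s2 x z = false) ->
  (forall x q, q \notin [seq g.2 | g <- gs] -> s2 x q = s1 x q) ->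
  impl s1 s2 0 0 (size gs) 1.
Proof.
move=> un H1 H2; pose C := parl tripC gs.
have unq (g : trip) : g \in gs -> uniq (trip_qs g) by exact: uniq_mem_flatten.
have := @impl_labelled N X s1 s2 C.
rewrite /T_count /T_depth /CNOT_count /CNOT_depth.
rewrite (@count_parl _ _ _ _ 0); last by move=> [[a b] z].
rewrite (@count_parl _ _ _ _ 1); last by move=> [[a b] z].
rewrite (@depth_parl _ _ _ _ (nseq 9 false)); last by move=> [[a b] z].
rewrite (@depth_parl _ _ _ _ [:: false; false; false; true; false; false; false; false; false]);
  last by move=> [[a b] z].
rewrite /= mul1n => W; refine (impl_le (W _ _ _ _) _ _ _) => //.
- apply: (layers_parl trip_supp) => // -[[a b] z] /unq /uniq3P [ab az bz].
  by rewrite /= /layer_ok /= !inE ab.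
- by apply: (uniq_labs_parl trip_supp) => // -[[a b] z].
- by apply: closed_parl => -[[a b] z]; rewrite /= !inE !eqxx.
- move=> r; exists (r2 ^+ size gs)%R => x; rewrite (lrun_parl trip_supp) // {W C}.
  exact: (uand_family r un (H1 x) (H2 x)).
- by case: (size gs).
Qed.

End Stages.

(** * Fan-out by chains of measured parities *)

Section FanOut.
Variables (N : nat).
Implicit Types (s v : basis N) (psi phi : qstate N) (o : op N) (q c d p : 'I_N).
Implicit Types (P : seq (op N)) (C : circuit N) (l : seq ('I_N * 'I_N)) (t : 'I_N * 'I_N * 'I_N).

Fixpoint mk_links d l : seq ('I_N * 'I_N * 'I_N) :=
  if l is (c, p) :: l' then (d, c, p) :: mk_links c l' else [::].

Definition linkl t : circuit N := link t.1.1 t.1.2 t.2.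

Definition flinks (ts : seq ('I_N * 'I_N * 'I_N)) : circuit N :=
  [:: [seq OCl (CH t.1.2) | t <- ts]; [seq OCl (CX t.1.2 t.2) | t <- ts];
      [seq OCl (CX t.1.1 t.2) | t <- ts]; [seq OMeas t.2 | t <- ts]].

(** [t'.1.1] may equal [t.1.2], since the next link of a chain starts at the copy just made. This is
    harmless: it is read there in the third layer, and the last operation of [t] on its copy lies in
    the second. *)
Fixpoint links_ok (ts : seq ('I_N * 'I_N * 'I_N)) : bool :=
  if ts is t :: ts' then
    [&& uniq [:: t.1.1; t.1.2; t.2],
        all (fun t' => [&& t'.1.2 \notin [:: t.1.1; t.1.2; t.2], t'.2 \notin [:: t.1.1; t.1.2; t.2]
                         & t'.1.1 \notin [:: t.1.1; t.2]]) ts'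
      & links_ok ts']
  else true.

Lemma par_ok_links t ts : links_ok (t :: ts) -> par_ok (linkl t) (flinks ts).
Proof.
case: t => [[d c] p] /= /and3P [_ /allP H _].
have D (f : 'I_N * 'I_N * 'I_N -> op N) P :
    (forall t' q, t' \in ts -> q \in op_qubits (f t') -> q \notin supp P) ->
    disj P (map f ts).
  by move=> K; apply: disjP => q q1 /supp_mapP [t' /K k /k]; rewrite q1.
rewrite /linkl /= andbT; apply/and4P; split; apply: D => t' q /H /and3P [];
  rewrite !inE !negb_or => /and3P [h1 h2 h3] /and3P [h4 h5 h6] /andP [h7 h8];
  rewrite /supp /= ?inE.
- by move=> /eqP ->; rewrite h1 h2 h3.
- by case/orP => /eqP ->; rewrite ?h1 ?h2 ?h3 ?h4 ?h5 ?h6.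
- by case/orP => /eqP ->; rewrite ?h7 ?h8 ?h4 ?h6.
- by move=> /eqP ->; rewrite h6.
Qed.

Lemma lrun_flinks r ts psi : links_ok ts ->
  lrun r (flatten (flinks ts)) psi = lrun r (flatten [seq flatten (linkl t) | t <- ts]) psi.
Proof.
elim: ts psi => // t ts IH psi ok.
rewrite -[flinks _]/(zipcat (linkl t) (flinks ts)) lrun_zipcat ?par_ok_links // IH.
  by rewrite -lrun_cat.
by case/and3P: ok.
Qed.

Lemma layers_flinks ts : links_ok ts -> all (@layer_ok N) (flinks ts).
Proof.
elim: ts => // t ts IH ok.
rewrite -[flinks _]/(zipcat (linkl t) (flinks ts)) layers_zipcat ?par_ok_links //.
  case: t ok => [[d c] p] /and3P [/uniq3P [dc dp cp] _ _].
  by rewrite /= /layer_ok /= !inE cp dp.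
by apply: IH; case/and3P: ok.
Qed.

(** The outcome at [p] flips [c] and everything copied from it, so it is corrected on [c] and on all
    later copies. It is also applied to [p], which was left equal to its own outcome and thereby
    returns to 0. *)
Fixpoint corr l : seq (op N) :=
  if l is (c, p) :: l' then corr l' ++ flatten [seq ccX p q | q <- [:: c, p & map fst l']]
  else [::].

Definition ch_qs (ch : 'I_N * seq ('I_N * 'I_N)) : seq 'I_N :=
  ch.1 :: flatten [seq [:: e.1; e.2] | e <- ch.2].

Lemma ccXs_ket r (j : nat) (qs : seq 'I_N) v : uniq qs ->
  lrun r (flatten [seq ccX j q | q <- qs]) (ket v) = ket (fun q => v q (+) (r j && (q \in qs))).
Proof.
elim: qs v => [|q qs IH] v.
  by move=> _; congr ket; apply: functional_extensionality => q; rewrite andbF addbF.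
rewrite cons_uniq => /andP [nq uq].
rewrite -[flatten _]/(ccX j q ++ flatten [seq ccX j q | q <- qs]) lrun_cat ccX_ket IH //.
congr ket; apply: functional_extensionality => q'; rewrite inE /upd.
by case: eqP => [->|//]; rewrite (negbTE nq) andbF addbF andbT.
Qed.

Lemma fst_sub l : {subset map fst l <= flatten [seq [:: e.1; e.2] | e <- l]}.
Proof.
elim: l => //= e l IH q; rewrite !inE => /orP [->//|/IH ->]; by rewrite !orbT.
Qed.

Lemma uniq_fst l : uniq (flatten [seq [:: e.1; e.2] | e <- l]) -> uniq (map fst l).
Proof.
elim: l => //= e l IH; rewrite inE negb_or => /and3P [/andP [_ n] _ /IH ->]; rewrite andbT.
by apply: contra n; exact: fst_sub.
Qed.

(** After the first link [c] holds v d + r p, and by induction so do the later copies once their own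
    corrections are done; the corrections by r p, coming last, remove it from all of them. *)
Lemma chain_ket r d l v : uniq (ch_qs (d, l)) ->
  (forall c p, (c, p) \in l -> v c = false /\ v p = false) ->
  lrun r (flatten [seq flatten (linkl t) | t <- mk_links d l] ++ corr l) (ket v) =
  qscale (r2 ^+ size l)%R (ket (fun q => if q \in map fst l then v d else v q)).
Proof.
elim: l d v => [|[c p] l IH] d v un z; first by rewrite expr0 qscale1.
move: un; rewrite -[ch_qs _]/([:: d, c, p & flatten [seq [:: e.1; e.2] | e <- l]]).
set Q := flatten _; rewrite !cons_uniq !inE !negb_or => /and4P [/and3P [dc dp dQ] /andP [cp cQ] pQ uQ].
have [c0 p0] := z c p (mem_head _ _).
rewrite -[corr _]/(corr l ++ flatten [seq ccX p q | q <- [:: c, p & map fst l]]).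
rewrite -[flatten _]/(flatten (link d c p) ++ flatten [seq flatten (linkl t) | t <- mk_links c l]).
set A := flatten (link d c p); set B := flatten _; set D := flatten _.
have -> : (A ++ B) ++ corr l ++ D = A ++ (B ++ corr l) ++ D by rewrite !catA.
rewrite lrun_cat link_ket //; last by rewrite /= !inE negb_or dc dp cp.
rewrite lrun_scale lrun_cat IH.
- have uf : uniq [:: c, p & map fst l].
    rewrite /= inE negb_or cp uniq_fst // andbT /=.
    by apply/andP; split; [apply: contra cQ|apply: contra pQ]; exact: fst_sub.
  rewrite lrun_scale ccXs_ket // qscaleM -exprS; congr (qscale _ (ket _)).
  apply: functional_extensionality => q; rewrite !inE /upd eqxx (negbTE cp).
  have nl x : x \notin Q -> x \in map fst l = false by move=> h; apply: contraNF h; exact: fst_sub.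
  case: (q =P c) => [->|_] /=.
    by rewrite nl // (negbTE cp) andbT addbK.
  case: (q =P p) => [->|_] /=; first by rewrite nl // andbT addbb p0.
  by case: ifP => _; rewrite ?andbT ?addbK ?andbF ?addbF.
- by rewrite /ch_qs cons_uniq cQ.
move=> c' p' i; have iQ : (c' \in Q) && (p' \in Q).
  by apply/andP; split; apply/flatten_mapP; exists (c', p'); rewrite ?inE ?eqxx ?orbT.
have ne x : x \in Q -> (x != c) && (x != p).
  by move=> xQ; apply/andP; split; [apply: contraNneq cQ|apply: contraNneq pQ] => <-.
case/andP: iQ => /ne /andP [h1 h2] /ne /andP [h3 h4]; rewrite !upd_ne //.
by apply: z; rewrite inE i orbT.
Qed.

Definition all_links (chs : seq ('I_N * seq ('I_N * 'I_N))) :=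
  flatten [seq mk_links ch.1 ch.2 | ch <- chs].

Lemma mk_links_sub d l t : t \in mk_links d l ->
  let Q := flatten [seq [:: e.1; e.2] | e <- l] in
  [/\ t.1.1 \in d :: Q, t.1.2 \in Q & t.2 \in Q].
Proof.
elim: l d => //= -[c p] l IH d; rewrite inE => /orP [/eqP -> /=|/IH /=].
  by rewrite !inE !eqxx ?orbT.
by rewrite !inE => -[/orP [] -> -> ->]; rewrite ?orbT.
Qed.

Lemma all_links_sub chs t : t \in all_links chs ->
  let Q := flatten (map ch_qs chs) in [/\ t.1.1 \in Q, t.1.2 \in Q & t.2 \in Q].
Proof.
move=> /flatten_mapP [ch i /mk_links_sub [h1 h2 h3]] /=.
by split; apply/flatten_mapP; exists ch; rewrite // /ch_qs inE ?h2 ?h3 ?orbT.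
Qed.

Lemma links_ok_all chs : uniq (flatten (map ch_qs chs)) -> links_ok (all_links chs).
Proof.
elim: chs => // -[d l] chs IH un.
have {}IH : links_ok (all_links chs) by apply: IH; move: un; rewrite /= cat_uniq => /andP [_ /and3P []].
rewrite -[all_links _]/(mk_links d l ++ all_links chs).
move: un; rewrite -[flatten _]/(ch_qs (d, l) ++ flatten (map ch_qs chs)).
elim: l d => [|[c p] l IHl] d //.
rewrite -[ch_qs _]/([:: d, c, p & flatten [seq [:: e.1; e.2] | e <- l]]).
set Q := flatten [seq _ | e <- l]; set R := flatten (map _ chs).
rewrite !cat_cons !cons_uniq !inE !negb_or => /and4P [/and3P [dc dp dQ] /andP [cp cQ] pQ uQ].
apply/and3P; split; first by rewrite /= !inE negb_or dc dp cp.
- apply/allP => t; rewrite -/(cat _ _) mem_cat => ti.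
  have [h1 h2 h3] : [/\ t.1.1 \in c :: Q ++ R, t.1.2 \in Q ++ R & t.2 \in Q ++ R].
    rewrite !inE !mem_cat; case/orP: ti => [/mk_links_sub|/all_links_sub] [].
      by rewrite inE => /orP [] -> -> ->; rewrite ?orbT.
    by move=> -> -> ->; rewrite !orbT.
  have K x : x \in Q ++ R -> x \notin [:: d; c; p].
    move=> xi; rewrite !inE !negb_or.
    by apply/and3P; split; [apply: contraNneq dQ|apply: contraNneq cQ|apply: contraNneq pQ] => <-.
  apply/and3P; split; [exact: K|exact: K|].
  move: h1; rewrite inE => /orP [/eqP ->|/K]; last by rewrite !inE !negb_or => /and3P [-> _ ->].
  by rewrite !inE negb_or eq_sym dc cp.
- by apply: IHl; rewrite /ch_qs /= cQ.
Qed.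

Lemma supp_links ts q : q \in supp (flatten [seq flatten (linkl t) | t <- ts]) ->
  exists2 t, t \in ts & q \in [:: t.1.1; t.1.2; t.2].
Proof.
elim: ts => // t ts IH.
rewrite -[flatten _]/(flatten (linkl t) ++ flatten [seq flatten (linkl t) | t <- ts]) supp_cat mem_cat.
case/orP => [h|/IH [t' i h]]; last by exists t'; rewrite // inE i orbT.
exists t; rewrite ?mem_head //; move: h; rewrite /linkl /supp /= !inE.
by case: (q == t.1.1); case: (q == t.1.2); case: (q == t.2).
Qed.

Lemma supp_ccXs (j : nat) (qs : seq 'I_N) : {subset supp (flatten [seq ccX j q | q <- qs]) <= qs}.
Proof.
elim: qs => // q qs IH x.
rewrite -[flatten _]/(ccX j q ++ flatten [seq ccX j q | q <- qs]) supp_cat mem_cat.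
case/orP => [|/IH h]; rewrite in_cons; last by rewrite h orbT.
by rewrite /supp /= !inE; case: (x == q).
Qed.

Lemma supp_corr l : {subset supp (corr l) <= flatten [seq [:: e.1; e.2] | e <- l]}.
Proof.
elim: l => // -[c p] l IH q.
rewrite -[corr _]/(corr l ++ flatten [seq ccX p q | q <- [:: c, p & map fst l]]).
rewrite supp_cat mem_cat => /orP [/IH h|/supp_ccXs].
  by rewrite /= !inE h !orbT.
by rewrite /= !inE => /or3P [->|->|/fst_sub ->]; rewrite ?orbT.
Qed.

Lemma fan_ket r chs v v' : uniq (flatten (map ch_qs chs)) ->
  (forall d l c p, (d, l) \in chs -> (c, p) \in l -> [/\ v c = false, v p = false & v' c = v d]) ->
  (forall q, (forall d l, (d, l) \in chs -> q \notin map fst l) -> v' q = v q) ->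
  lrun r (flatten [seq flatten (linkl t) | t <- all_links chs] ++ flatten [seq corr ch.2 | ch <- chs])
    (ket v) = qscale (r2 ^+ size (all_links chs))%R (ket v').
Proof.
elim: chs v => [|[d l] chs IH] v un H1 H2.
  rewrite expr0 qscale1; congr ket; apply: functional_extensionality => q.
  by rewrite H2.
move: un; rewrite -[flatten _]/(ch_qs (d, l) ++ flatten (map ch_qs chs)) cat_uniq.
move=> /and3P [u1 /hasPn nn u2].
rewrite -[all_links _]/(mk_links d l ++ all_links chs) map_cat flatten_cat.
rewrite -[flatten [seq corr ch.2 | ch <- _]]/(corr l ++ flatten [seq corr ch.2 | ch <- chs]).
set A1 := flatten _; set A2 := flatten _; set C2 := flatten _.
(* The corrections of this chain commute with the links of the other chains, so the chain can be
   completed before they run. *)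
have dj : disj A2 (corr l).
  apply: disjP => q /supp_links [t /all_links_sub [h1 h2 h3] qt] /supp_corr qc.
  have /nn : q \in flatten (map ch_qs chs) by move: qt; rewrite !inE => /or3P [] /eqP ->.
  by rewrite /= /ch_qs inE qc orbT.
rewrite !(lrun_cat _ (A1 ++ A2)) (lrun_cat _ A1) (lrun_cat _ (corr l)) (lrunC _ _ dj).
rewrite -(lrun_cat _ A1) -(lrun_cat _ A2) chain_ket //; last first.
  by move=> c p i; have [||h1 h2 _] := H1 d l c p; rewrite ?mem_head.
set v1 := fun q => _; rewrite lrun_scale (IH v1) //.
- rewrite qscaleM -exprD size_cat; congr (qscale (_ ^+ (_ + _))%R _).
  by elim: (l) (d) => //= -[c p] l' IHl d'; rewrite (IHl c).
- move=> d' l' c p i i'; have [||h1 h2 h3] := H1 d' l' c p; rewrite ?inE ?i ?orbT //.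
  have K x : x \in ch_qs (d', l') -> v1 x = v x.
    move=> xi; rewrite /v1 ifN //; apply/negP => /fst_sub xl.
    have /nn : x \in flatten (map ch_qs chs) by apply/flatten_mapP; exists (d', l').
    by rewrite /= /ch_qs inE xl orbT.
  have iQ : (c \in flatten [seq [:: e.1; e.2] | e <- l']) && (p \in flatten [seq [:: e.1; e.2] | e <- l']).
    by apply/andP; split; apply/flatten_mapP; exists (c, p); rewrite ?inE ?eqxx ?orbT.
  case/andP: iQ => i1 i2.
  by rewrite !K /ch_qs ?mem_head ?inE ?i1 ?i2 ?orbT.
- move=> q nq; rewrite /v1; case: ifPn => [/mapP [[c p] i /= ->]|nl].
    by have [||_ _ ->] := H1 d l c p; rewrite ?mem_head.
  by apply: H2 => d' l'; rewrite inE => /orP [/eqP [_ ->] //|]; exact: nq.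
Qed.

Lemma impl_fan X (s1 s2 : X -> basis N) chs : uniq (flatten (map ch_qs chs)) ->
  (forall x d l c p, (d, l) \in chs -> (c, p) \in l ->
     [/\ s1 x c = false, s1 x p = false & s2 x c = s1 x d]) ->
  (forall x q, (forall d l, (d, l) \in chs -> q \notin map fst l) -> s2 x q = s1 x q) ->
  impl s1 s2 0 0 (2 * size (all_links chs)) (2 * (0 < size (all_links chs))).
Proof.
move=> un H1 H2; set ls := all_links chs; pose P := flatten [seq corr ch.2 | ch <- chs].
have lok : links_ok ls by exact: links_ok_all.
have plc l : plain (corr l).
  elim: l => //= -[c p] l IH.
  rewrite /plain all_cat -!/(plain _) IH -/(flatten [seq ccX p q | q <- [:: c, p & map fst l]]).
  exact: plain_flatten.
have pl : plain P by apply: plain_flatten.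
have lc l : labs (corr l) = [::].
  elim: l => // -[c p] l IH.
  rewrite -[corr _]/(corr l ++ flatten [seq ccX p q | q <- [:: c, p & map fst l]]).
  by rewrite labs_cat IH labs_flatten_nil.
have lP : labs P = [::] by rewrite labs_flatten_nil.
have lf : labs (flatten (flinks ls)) = [seq nat_of_ord t.2 | t <- ls].
  have lm (f : 'I_N * 'I_N * 'I_N -> op N) : (forall t, labs [:: f t] = [::]) -> labs (map f ls) = [::].
    by move=> h; elim: (ls) => // t ts IH; rewrite -[map f _]/([:: f t] ++ map f ts) labs_cat h IH.
  rewrite /= !labs_cat cats0 (lm (fun t => OCl (CH t.1.2))) //.
  rewrite (lm (fun t => OCl (CX t.1.2 t.2))) // (lm (fun t => OCl (CX t.1.1 t.2))) //.
  by elim: (ls) => //= t ts ->.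
have [t1 t2] : count (@is_T N) P = 0 /\ count (has (@is_T N)) (seqc P) = 0.
  by apply: plain_count => // o /and3P [].
have [c1 c2] : count (@is_CNOT N) P = 0 /\ count (has (@is_CNOT N)) (seqc P) = 0.
  by apply: plain_count => // o /and3P [].
have := @impl_labelled N X s1 s2 (flinks ls ++ seqc P).
rewrite /T_count /T_depth /CNOT_count /CNOT_depth flatten_cat flatten_seqc.
rewrite !(count_cat _ (flatten (flinks ls)) P) !(count_cat _ (flinks ls) (seqc P)) t1 t2 c1 c2 !addn0.
have cm (f : 'I_N * 'I_N * 'I_N -> op N) (a : pred (op N)) k : (forall t, a (f t) = k) ->
    count a (map f ls) = k * size ls.
  by move=> h; elim: (ls) => [|t ts IH] /=; rewrite ?muln0 // h IH mulnS.
have hm (f : 'I_N * 'I_N * 'I_N -> op N) (a : pred (op N)) k : (forall t, a (f t) = k) ->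
    has a (map f ls) = k && (0 < size ls).
  by move=> h; rewrite has_count (cm _ _ k h); case: (k); rewrite ?mul1n.
have -> : count (@is_T N) (flatten (flinks ls)) = 0.
  by rewrite /= !count_cat !(cm _ _ false).
have -> : count (@is_CNOT N) (flatten (flinks ls)) = 2 * size ls.
  by rewrite /= !count_cat (cm (fun t => OCl (CH t.1.2)) _ false) // (cm (fun t => OCl (CX t.1.2 t.2)) _ true) //
    (cm (fun t => OCl (CX t.1.1 t.2)) _ true) // (cm (fun t => OMeas t.2) _ false) //=; lia.
have -> : count (has (@is_T N)) (flinks ls) = 0 by rewrite /= !(hm _ _ false).
have -> : count (has (@is_CNOT N)) (flinks ls) = 2 * (0 < size ls).
  by rewrite /= (hm (fun t => OCl (CH t.1.2)) _ false) // (hm (fun t => OCl (CX t.1.2 t.2)) _ true) //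
    (hm (fun t => OCl (CX t.1.1 t.2)) _ true) // (hm (fun t => OMeas t.2) _ false) //=; lia.
apply.
- by rewrite all_cat layers_flinks // plain_layers.
- rewrite labs_cat lP cats0 lf map_comp map_inj_uniq //; last exact: ord_inj.
  elim: (ls) lok => //= t ts IH /and3P [_ /allP h /IH ->]; rewrite andbT.
  apply/mapP => -[t' /h /and3P [_ h2 _] e]; by move: h2; rewrite !inE e eqxx !orbT.
- rewrite cc_closed_cat closed_noOCC; last by rewrite /= !all_cat !all_map; elim: (ls).
  apply: cc_closed_all; move: (labs (flatten (flinks ls))) lf => LS lf; rewrite cat0s.
  have E l d : {subset [seq nat_of_ord t.2 | t <- mk_links d l] <= LS} ->
      all (fun o => if o is OCC j _ then j \in LS else true) (corr l).
    elim: l d => // -[c p] l IH d h.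
    rewrite -[corr _]/(corr l ++ flatten [seq ccX p q | q <- [:: c, p & map fst l]]) all_cat.
    rewrite (IH c) ?andTb => [|x xi]; last by apply: h; rewrite inE xi orbT.
    have pin : (p : nat) \in LS by apply: h; rewrite inE eqxx.
    elim: ([:: c, p & _]) => // q qs IHq.
    rewrite -[flatten (map _ (q :: qs))]/(ccX p q ++ flatten [seq ccX p q | q <- qs]) all_cat.
    by apply/andP; split; [rewrite /= pin|exact: IHq].
  rewrite -[X in all _ X]/P /P.
  have : {subset [seq nat_of_ord t.2 | t <- all_links chs] <= LS} by rewrite lf.
  rewrite /all_links; elim: (chs) => // -[d l] chs' IH h.
  rewrite -[flatten (map _ ((d, l) :: chs'))]/(corr l ++ flatten [seq corr ch.2 | ch <- chs']) all_cat (E l d) /=; last first.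
    by move=> x xi; apply: h; rewrite /= map_cat mem_cat xi.
  by apply: IH => x xi; apply: h; rewrite /= map_cat mem_cat xi orbT.
move=> r; exists (r2 ^+ size ls)%R => x.
rewrite lrun_cat lrun_flinks // -lrun_cat; exact: (fan_ket r un (H1 x) (H2 x)).
Qed.

End FanOut.

(** * Distribution of copies to the outputs *)

Lemma uniq_pairs (T : eqType) (l : seq (T * T)) :
  uniq (map fst l) -> uniq (map snd l) ->
  (forall e e', e \in l -> e' \in l -> e.1 != e'.2) ->
  uniq (flatten [seq [:: e.1; e.2] | e <- l]).
Proof.
elim: l => //= e l IH /andP [f1 u1] /andP [f2 u2] H.
have fl q : q \in flatten [seq [:: e.1; e.2] | e <- l] -> (q \in map fst l) || (q \in map snd l).
  move=> /flatten_mapP [e' i]; rewrite !inE => /orP [] /eqP ->; by rewrite map_f // ?orbT.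
rewrite IH // ?andbT; last by move=> e1 e2 i1 i2; apply: H; rewrite inE ?i1 ?i2 orbT.
rewrite inE negb_or H ?inE ?eqxx //=; apply/andP; split; apply/negP => /fl /orP [].
- by apply/negP.
- by case/mapP => e' i /eqP; apply/negP/H; rewrite inE ?eqxx ?i ?orbT.
- by case/mapP => e' i /esym /eqP; apply/negP/H; rewrite inE ?eqxx ?i ?orbT.
- by apply/negP.
Qed.

Lemma uniq_flatten_map (T U : eqType) (f : T -> seq U) (l : seq T) :
  uniq l -> (forall x, x \in l -> uniq (f x)) ->
  (forall x y q, x \in l -> y \in l -> q \in f x -> q \in f y -> x = y) ->
  uniq (flatten (map f l)).
Proof.
elim: l => //= x l IH /andP [nx ul] H1 H2; rewrite cat_uniq H1 ?mem_head //=; apply/andP; split.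
  apply/hasPn => q /flatten_mapP [y yl qy]; apply/negP => /= qx.
  by move: nx; rewrite (H2 x y q) ?mem_head ?yl // inE yl orbT.
apply: IH => // [y yl|y z q yl zl]; first by apply: H1; rewrite inE yl orbT.
by apply: H2; rewrite inE ?yl ?zl orbT.
Qed.

Section Scatter.
Variables (N m T : nat) (S : finType) (h : S -> 'I_N) (P : S -> nat).
Notation cell := {s : S & 'I_(P s)}.
Variables (cq pq : cell -> 'I_N) (yq : 'I_m -> 'I_N).
Variable sched : 'I_T -> 'I_m -> option (S * nat).
Hypotheses (h_inj : injective h) (c_inj : injective cq) (p_inj : injective pq) (y_inj : injective yq).
Hypotheses (hc : forall s t, h s != cq t) (hp : forall s t, h s != pq t) (cp : forall t t', cq t != pq t').
Hypotheses (yh : forall j s, yq j != h s) (yc : forall j t, yq j != cq t) (yp : forall j t, yq j != pq t).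
Hypothesis sched_bound : forall i j s r, sched i j = Some (s, r) -> r <= (P s).*2.
Hypothesis sched_inj : forall i j j' u, sched i j = Some u -> sched i j' = Some u -> j = j'.

Definition cell_of (s : S) (i : 'I_(P s)) : cell := Tagged (fun s => 'I_(P s)) i.

(** Copy 0 of a source is the source itself; copies 2i + 1 and 2i + 2 are the copy qubit and the
    parity qubit of its i-th cell. The remaining case is a default, excluded by [sched_bound]. *)
Definition copyq (u : S * nat) : 'I_N :=
  if u.2 is r.+1 then
    if insub r./2 is Some i then (if odd r then pq else cq) (cell_of (i : 'I_(P u.1))) else h u.1
  else h u.1.

Lemma copyqP s r : r <= (P s).*2 ->
  (r = 0 /\ copyq (s, r) = h s) \/
  (exists t : cell, tag t = s /\
     ((r = (tagged t).*2.+1 /\ copyq (s, r) = cq t) \/ (r = (tagged t).*2.+2 /\ copyq (s, r) = pq t))).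
Proof.
case: r => [|r]; first by left.
move=> rP; right; have rh : r./2 < P s by lia.
exists (cell_of (Ordinal rh)); split=> //; rewrite /copyq /= insubT /=.
by case: ifP => o; [right|left]; split=> //; lia.
Qed.

Lemma copyq_inj s r s' r' : r <= (P s).*2 -> r' <= (P s').*2 ->
  copyq (s, r) = copyq (s', r') -> (s, r) = (s', r').
Proof.
move=> /copyqP [[-> ->]|[t [<- [[-> ->]|[-> ->]]]]] /copyqP [[-> ->]|[t' [<- [[-> ->]|[-> ->]]]]] e.
- by rewrite (h_inj e).
- by move/eqP: e; rewrite (negbTE (hc _ _)).
- by move/eqP: e; rewrite (negbTE (hp _ _)).
- by move/esym/eqP: e; rewrite (negbTE (hc _ _)).
- by rewrite (c_inj e).
- by move/eqP: e; rewrite (negbTE (cp _ _)).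
- by move/esym/eqP: e; rewrite (negbTE (hp _ _)).
- by move/esym/eqP: e; rewrite (negbTE (cp _ _)).
- by rewrite (p_inj e).
Qed.

Lemma copyq_y s r j : r <= (P s).*2 -> copyq (s, r) != yq j.
Proof. by move=> /copyqP [[_ ->]|[t [_ [[_ ->]|[_ ->]]]]]; rewrite eq_sym. Qed.

Definition val_at (v : basis N) i j : bool := if sched i j is Some u then v (h u.1) else false.

Definition chains : seq ('I_N * seq ('I_N * 'I_N)) :=
  [seq (h s, [seq (cq (cell_of i), pq (cell_of i)) | i : 'I_(P s)]) | s : S].

Lemma size_chains : size (all_links chains) = \sum_s P s.
Proof.
rewrite /all_links /chains /image_mem size_flatten /shape -2!map_comp sumnE big_map big_enum /=.
apply: eq_bigr => s _; rewrite -[RHS]card_ord cardE.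
rewrite enumT; elim: (Finite.enum _) (h s) => //= i l IH q; by rewrite IH.
Qed.

Lemma uniq_chains : uniq (flatten (map (@ch_qs N) chains)).
Proof.
rewrite -map_comp; apply: uniq_flatten_map; first exact: enum_uniq.
  move=> s _ /=; rewrite /ch_qs /= -map_comp; apply/andP; split.
    apply/negP => /flatten_mapP [i _]; rewrite !inE /= => /orP [] /eqP /eqP.
      by rewrite (negbTE (hc _ _)).
    by rewrite (negbTE (hp _ _)).
  have e_inj : injective (@cell_of s).
    move=> i i' /eqP; rewrite /cell_of -tag_eqE /tag_eq /= eqxx /= tagged_asE => /eqP //.
  apply: uniq_flatten_map; first exact: enum_uniq.
    by move=> i _ /=; rewrite inE cp.
  move=> i i' q _ _ /=; rewrite !inE => /orP [] /eqP -> /orP [] /eqP e.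
  - exact/e_inj/c_inj.
  - by move/eqP: e; rewrite (negbTE (cp _ _)).
  - by move/esym/eqP: e; rewrite (negbTE (cp _ _)).
  - exact/e_inj/p_inj.
have E s q : q \in ch_qs (h s, [seq (cq (cell_of i), pq (cell_of i)) | i : 'I_(P s)]) ->
    q = h s \/ exists t : cell, tag t = s /\ (q = cq t \/ q = pq t).
  rewrite /ch_qs inE => /orP [/eqP -> |]; first by left.
  rewrite /= -map_comp => /flatten_mapP [i _]; rewrite !inE => /orP [] /eqP ->; right;
    exists (cell_of i); split=> //; [by left|by right].
move=> s s' q _ _ /= /E [->|[t [<- [->|->]]]] /E [e|[t' [<- [e|e]]]].
- exact: h_inj.
- by move/eqP: e; rewrite (negbTE (hc _ _)).
- by move/eqP: e; rewrite (negbTE (hp _ _)).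
- by move/esym/eqP: e; rewrite (negbTE (hc _ _)).
- by rewrite (c_inj e).
- by move/eqP: e; rewrite (negbTE (cp _ _)).
- by move/esym/eqP: e; rewrite (negbTE (hp _ _)).
- by move/esym/eqP: e; rewrite (negbTE (cp _ _)).
- by rewrite (p_inj e).
Qed.

Variables (X : Type) (s1 s2 : X -> basis N).
Hypothesis zero : forall x t, s1 x (cq t) = false /\ s1 x (pq t) = false.
Hypothesis s2y : forall x j, s2 x (yq j) = s1 x (yq j) (+) \big[addb/false]_(i < T) val_at (s1 x) i j.
Hypothesis s2q : forall x q, (forall j, q != yq j) -> s2 x q = s1 x q.

(** [sa] is the state after the links. In [sb s] all copies are filled and the other qubits are as
    in [s], so it describes the states both before and after the outputs change. *)
Let sa x : basis N := fun q => if [pick t | q == cq t] is Some t then s1 x (h (tag t)) else s1 x q.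
Let sb (s : X -> basis N) x : basis N :=
  fun q => if [pick t | (q == cq t) || (q == pq t)] is Some t then s1 x (h (tag t)) else s x q.

(** Each cell takes two CNOTs for its link and one that makes its parity qubit, back in 0, a second
    copy; this fills three layers. T layers serve the outputs, and all copies are erased by
    measurements. *)
Lemma impl_scatter :
  impl s1 s2 0 0 (3 * \sum_s P s + \sum_(i < T) \sum_(j < m) sched i j) (3 + T).
Proof.
have saE x t : sa x (cq t) = s1 x (h (tag t)).
  by rewrite /sa; case: pickP => [t' /eqP /c_inj <-|/(_ t)] //; rewrite eqxx.
have saN x q : (forall t, q != cq t) -> sa x q = s1 x q.
  by rewrite /sa => H; case: pickP => // t; rewrite (negbTE (H t)).
have sbE s x t : sb s x (cq t) = s1 x (h (tag t)) /\ sb s x (pq t) = s1 x (h (tag t)).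
  rewrite /sb; split; case: pickP => [t'|/(_ t)]; rewrite ?eqxx ?orbT //.
    by rewrite (negbTE (cp _ _)) orbF => /eqP /c_inj <-.
  by rewrite eq_sym (negbTE (cp _ _)) /= => /eqP /p_inj <-.
have sbN s x q : (forall t, q != cq t) -> (forall t, q != pq t) -> sb s x q = s x q.
  by rewrite /sb => H H'; case: pickP => // t; rewrite (negbTE (H t)) (negbTE (H' t)).
have I1 : impl s1 sa 0 0 (2 * \sum_s P s) (2 * (0 < \sum_s P s)).
  rewrite -size_chains; apply: impl_fan; first exact: uniq_chains.
    move=> x d l c p /mapP [s _ [-> ->]] /mapP [i _ [-> ->]].
    by have [-> ->] := zero x (cell_of i); rewrite saE.
  move=> x q H; apply: saN => -[s i]; apply/eqP => e.
  have /H /mapP [] : (h s, [seq (cq (cell_of i), pq (cell_of i)) | i : 'I_(P s)]) \in chains.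
    by apply/mapP; exists s; rewrite ?mem_enum.
  by exists (cq (cell_of i), pq (cell_of i)) => //; apply/mapP; exists i; rewrite ?mem_enum.
have I2 : impl sa (sb s1) 0 0 (\sum_s P s) 1.
  have -> : \sum_s P s = size (flatten [:: [seq (cq t, pq t) | t : cell]]).
    by rewrite /= cats0 size_map -cardE card_tagged sumnE big_map big_enum /=; apply: eq_bigr => s _; rewrite card_ord.
  apply: (impl_cx (cl := [:: [seq (cq t, pq t) | t : cell]])).
  - move=> l; rewrite inE => /eqP ->; apply: uniq_pairs.
    + by rewrite -map_comp map_inj_uniq ?enum_uniq //; exact: c_inj.
    + by rewrite -map_comp map_inj_uniq ?enum_uniq //; exact: p_inj.
    + by move=> e e' /mapP [t _ ->] /mapP [t' _ ->] /=.
  - by move=> e e'; rewrite /= cats0 => /mapP [t _ ->] /mapP [t' _ ->] /=.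
  - move=> x q; rewrite /= cats0 big_map big_enum_cond /=.
    have [t /eqP ->|nq] := pickP (fun t => q == pq t).
      rewrite (sbE s1 x t).2 (big_pred1 t) => [|t'] /=; last by rewrite (inj_eq p_inj).
      by rewrite saE saN ?(zero x t).2 // => t'; rewrite eq_sym.
    rewrite big_pred0 ?addbF => [|t]; last by rewrite eq_sym nq.
    have [t /eqP ->|nq'] := pickP (fun t => q == cq t); first by rewrite (sbE s1 x t).1 saE.
    by rewrite sbN ?saN // => t; rewrite ?nq ?nq'.
pose ctl i j := if sched i j is Some u then copyq u else yq j.
pose layer i := [seq (ctl i j, yq j) | j <- enum 'I_m & isSome (sched i j)].
have I3 : impl (sb s1) (sb s2) 0 0 (\sum_(i < T) \sum_(j < m) sched i j) T.
  have E1 : \sum_(i < T) \sum_(j < m) sched i j = size (flatten [seq layer i | i : 'I_T]).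
    rewrite size_flatten /shape -map_comp sumnE big_map big_enum /=; apply: eq_bigr => i _.
    rewrite size_map size_filter -sum1_count big_enum_cond [RHS]big_mkcond /=.
    by apply: eq_bigr => j _; case: (sched i j).
  have E2 : T = size [seq layer i | i : 'I_T] by rewrite size_map size_enum_ord.
  have lay i e : e \in layer i -> exists j s r, [/\ sched i j = Some (s, r), e.1 = copyq (s, r) & e.2 = yq j].
    move=> /mapP [j]; rewrite mem_filter => /andP [si _ ->] /=; rewrite /ctl.
    by case e1: (sched i j) si => [[s r]|] // _; exists j, s, r.
  have dj e e' : e \in flatten [seq layer i | i : 'I_T] -> e' \in flatten [seq layer i | i : 'I_T] -> e.1 != e'.2.
    move=> /flatten_mapP [i _ /lay [j [s [r [/sched_bound b -> _]]]]].
    by move=> /flatten_mapP [i' _ /lay [j' [s' [r' [_ _ ->]]]]]; exact: copyq_y.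
  suff W : impl (sb s1) (sb s2) 0 0 (size (flatten [seq layer i | i : 'I_T])) (size [seq layer i | i : 'I_T]).
    by rewrite E1; move: W; rewrite -E2.
  apply: impl_cx => //.
  - move=> l /mapP [i _ ->]; apply: uniq_pairs.
    + rewrite -map_comp map_inj_in_uniq ?(filter_uniq _ (enum_uniq _)) // => j j'.
      rewrite !mem_filter /= /ctl => /andP [+ _] /andP [+ _].
      case e: (sched i j) => [[s r]|] //; case e': (sched i j') => [[s' r']|] // _ _ E.
      apply: (sched_inj e); rewrite e'; congr Some; apply/esym/copyq_inj => //; exact: sched_bound e || exact: sched_bound e'.
    + by rewrite -map_comp map_inj_uniq ?(filter_uniq _ (enum_uniq _)) //; exact: y_inj.
    + by move=> e e' h1 h2; apply: dj; apply/flatten_mapP; exists i; rewrite ?mem_enum.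
  - move=> x q; rewrite big_flatten big_map big_enum /=.
    have [j /eqP ->|nq] := pickP (fun j => q == yq j).
      rewrite !sbN ?s2y; try by move=> *; exact: yc || exact: yp.
      congr addb; apply: eq_bigr => i _; rewrite big_map big_filter_cond big_enum_cond /=.
      rewrite /val_at /ctl; case e: (sched i j) => [[s r]|].
        rewrite (big_pred1 j) => [|j'] /=; last first.
          by rewrite (inj_eq y_inj); case: eqP => [->|]; rewrite ?e ?andbF.
        rewrite e; case: (copyqP (sched_bound e)) => [[_ ->]|[t [<- [[_ ->]|[_ ->]]]]].
        - by rewrite sbN.
        - by rewrite (sbE s1 x t).1.
        - by rewrite (sbE s1 x t).2.
      rewrite big_pred0 // => j'; rewrite (inj_eq y_inj).
      by case: eqP => [->|]; rewrite ?e ?andbF.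
    rewrite big1 ?addbF => [|i _]; last first.
      rewrite big_map big_filter_cond big_enum_cond big_pred0 // => j.
      by rewrite eq_sym nq andbF.
    have [t qt|nq'] := pickP (fun t => (q == cq t) || (q == pq t)).
      by case/orP: qt => /eqP ->; rewrite ?(sbE _ x t).1 ?(sbE _ x t).2.
    have nc t : q != cq t by have /negbT := nq' t; rewrite negb_or => /andP [].
    have np t : q != pq t by have /negbT := nq' t; rewrite negb_or => /andP [].
    by rewrite !sbN // s2q // => j; rewrite nq.
have I4 : impl (sb s2) s2 0 0 0 0.
  pose es := [seq (cq t, [:: h (tag t)]) | t : cell] ++ [seq (pq t, [:: h (tag t)]) | t : cell].
  have fe : map fst es = [seq cq t | t : cell] ++ [seq pq t | t : cell].
    by rewrite map_cat; congr cat; rewrite /image_mem -map_comp; apply: eq_map.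
  have inE1 q l : (q, l) \in es -> exists t : cell, l = [:: h (tag t)] /\ (q = cq t \/ q = pq t).
    by rewrite mem_cat => /orP [] /mapP [t _ [-> ->]]; exists t; split=> //; [left|right].
  have cy t j : cq t != yq j by rewrite eq_sym.
  have py t j : pq t != yq j by rewrite eq_sym.
  have hy s j : h s != yq j by rewrite eq_sym.
  apply: (impl_erase (es := es)).
  - rewrite fe cat_uniq; apply/and3P; split; try by rewrite map_inj_uniq ?enum_uniq.
    apply/hasPn => q /mapP [t _ ->] /=.
    by apply/mapP => -[t' _ /esym/eqP]; rewrite (negbTE (cp _ _)).
  - move=> q l r /inE1 [t [-> _]]; rewrite inE => /eqP ->; rewrite fe mem_cat negb_or.
    by apply/andP; split; apply/mapP => -[t' _ /eqP]; rewrite ?(negbTE (hc _ _)) ?(negbTE (hp _ _)).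
  - move=> x q l /inE1 [t [-> H]]; have [z1 z2] := zero x t.
    have hE : sb s2 x (h (tag t)) = s1 x (h (tag t)) by rewrite sbN // s2q.
    rewrite /xorl big_seq1 hE.
    by case: H => ->; rewrite ?(sbE s2 x t).1 ?(sbE s2 x t).2 s2q ?z1 ?z2.
  - move=> x q; rewrite fe mem_cat negb_or => /andP [n1 n2]; rewrite sbN // => t.
      by apply: contra n1 => /eqP ->; apply: map_f; rewrite mem_enum.
    by apply: contra n2 => /eqP ->; apply: map_f; rewrite mem_enum.
have := impl_seq (impl_seq (impl_seq I1 I2) I3) I4; rewrite ?addn0 => I.
apply: impl_le I _ _ _ => //; first by lia.
by case: (0 < _); lia.
Qed.

End Scatter.

(** * Monomials, level by level *)

Section Splitting.
Variable n : nat.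
Implicit Types I J : {set 'I_n}.

Definition lv I := up_log 2 #|I|.
Definition halfA I : {set 'I_n} := [set x in take (uphalf #|I|) (enum I)].
Definition halfB I : {set 'I_n} := [set x in drop (uphalf #|I|) (enum I)].

Lemma halfU I : halfA I :|: halfB I = I.
Proof. by apply/setP => x; rewrite !inE -mem_cat cat_take_drop mem_enum. Qed.

Lemma card_halfA I : #|halfA I| = uphalf #|I|.
Proof.
rewrite cardsE (card_uniqP _) ?take_uniq ?enum_uniq // size_take -cardE.
by case: ltnP => //; lia.
Qed.

Lemma card_halfB I : #|halfB I| = #|I|./2.
Proof. by rewrite cardsE (card_uniqP _) ?drop_uniq ?enum_uniq // size_drop -cardE; lia. Qed.

Lemma halfA_ne_halfB I : 1 < #|I| -> halfA I != halfB I.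
Proof.
move=> h; apply/eqP => e; have : #|halfB I| > 0 by rewrite card_halfB; lia.
case/card_gt0P => x xB; have xA : x \in halfA I by rewrite e.
move: xA xB; rewrite !inE => xA xB.
have := enum_uniq (mem I); rewrite -(cat_take_drop (uphalf #|I|) (enum I)) cat_uniq.
by case/and3P => _ /hasPn /(_ x xB) /=; rewrite xA.
Qed.

(** Halving with rounding up lowers ceil(log2 d), so both factors of a monomial are available at an
    earlier level. *)
Lemma up_log_half d e : 1 < d -> e <= uphalf d -> up_log 2 e < up_log 2 d.
Proof.
move=> d1 ed; have k0 : 0 < up_log 2 d by rewrite up_log_gt0.
rewrite -(prednK k0) ltnS; apply: up_log_min => //.
have := up_logP d (isT : 1 < 2); rewrite -{1}(prednK k0) expnS; lia.
Qed.

Definition mono I (x : {ffun 'I_n -> bool}) := [forall i in I, x i].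

Lemma monoU I J x : mono (I :|: J) x = mono I x && mono J x.
Proof.
apply/forall_inP/andP => [h|[/forall_inP h1 /forall_inP h2] i].
  by split; apply/forall_inP => i ii; apply: h; rewrite inE ii ?orbT.
by rewrite inE => /orP [/h1|/h2].
Qed.

Definition mon := {I : {set 'I_n} | 1 < #|I|}.

Lemma card_mon : #|{: mon}| + n + 1 = 2 ^ n.
Proof.
have -> : 2 ^ n = #|{: {set 'I_n}}| by rewrite -cardsT -powersetT card_powerset cardsT card_ord.
rewrite card_sig -(cardC (fun I : {set 'I_n} => 1 < #|I|)) -addnA; congr (_ + _).
have -> : #|predC (fun I : {set 'I_n} => 1 < #|I|)| =
    #|[set set0 : {set 'I_n}] :|: [set [set i] | i : 'I_n]|.
  apply: eq_card => I; rewrite !inE -leqNgt.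
  apply/idP/orP => [|[/eqP ->|/imsetP [i _ ->]]]; rewrite ?cards0 ?cards1 //.
  rewrite leq_eqVlt ltnS leqn0 cards_eq0 => /orP [/cards1P [i ->]|]; last by left.
  by right; apply/imsetP; exists i.
rewrite cardsU cards1 card_imset ?card_ord; last exact: set1_inj.
rewrite (_ : _ :&: _ = set0) ?cards0; first lia.
apply/setP => I; rewrite !inE; apply/negbTE/negP => /andP [/eqP -> /imsetP [i _ /setP /(_ i)]].
by rewrite !inE eqxx.
Qed.

Implicit Types e : mon.

Definition level k : seq mon := [seq e <- enum {: mon} | lv (val e) == k].

Definition nmon k := \sum_(e : mon | lv (val e) > k) 1.

Lemma size_level k : size (level k) = \sum_(e : mon | lv (val e) == k) 1.
Proof. by rewrite size_filter -sum1_count big_enum_cond. Qed.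

Lemma nmonS k : nmon k = size (level k.+1) + nmon k.+1.
Proof.
rewrite size_level /nmon [LHS]big_mkcond [X in _ = X + _]big_mkcond [X in _ = _ + X]big_mkcond -big_split /=; apply: eq_bigr => e _.
by case: ifP; case: ifP; case: ifP; lia.
Qed.

(** Needed because the T depth is claimed as an equality: an empty level would contribute no T
    layer. *)
Lemma level_gt0 k : 0 < k <= up_log 2 n -> 0 < size (level k).
Proof.
(* The least d with ceil(log2 d) = k; it is at most n because k <= ceil(log2 n). *)
move=> /andP [k0 kn]; pose d := (2 ^ k.-1).+1.
have dn : d <= n.
  rewrite leqNgt ltnS; apply/negP => h; have := up_log_min (isT : 1 < 2) h; lia.
pose I : {set 'I_n} := [set i : 'I_n | i < d].
have cI : #|I| = d.
  rewrite -sum1_card (eq_bigl (fun i : 'I_n => i < d)) => [|i]; last by rewrite inE.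
  by rewrite (big_ord_narrow dn) sum1_card card_ord.
have I1 : 1 < #|I| by rewrite cI ltnS expn_gt0.
have lI : lv I = k.
  by rewrite /lv cI -[RHS](prednK k0); apply: up_log_eq => //; rewrite ltnS leqnn /= expnS /d; have := expn_gt0 2 k.-1; lia.
rewrite size_filter -has_count; apply/hasP; exists (Sub I I1); first by rewrite mem_enum.
by rewrite SubK lI.
Qed.

Lemma nmonL : nmon (up_log 2 n) = 0.
Proof.
rewrite /nmon big_pred0 // => e; apply/negbTE; rewrite -leqNgt.
by apply: leq_up_log; rewrite -[X in _ <= X]card_ord max_card.
Qed.

Lemma nmon0 : nmon 0 = #|{: mon}|.
Proof.
rewrite /nmon (eq_bigl predT) ?sum1_card // => e /=.
by rewrite /lv up_log_gt0 /= (valP e).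
Qed.

End Splitting.

(** * Qubits, uses and copies within a level *)

Section Levels.
Variables (n m D : nat).
Notation mon := (mon n).
Notation level := (level n).
Notation nmon := (nmon n).
(** The pair (e, b) stands for the occurrence of a factor in the AND gate of e: [halfA] for b =
    false, [halfB] for b = true. *)
Definition use := (mon * bool)%type.
(** A target qubit per monomial, a copy qubit per use, and a pool of D scratch qubits. The pool is
    back in 0 after each level's AND gates and after the output stage, so both share it and D is
    later the larger of the two demands, not their sum. *)
Definition anc := (mon + use + 'I_D)%type.
Definition role := ('I_n + 'I_m + anc)%type.
Notation N := (n + m + #|{: anc}|).
Implicit Types (e : mon) (u : use) (J : {set 'I_n}).

Definition rX (i : 'I_n) : role := inl (inl i).
Definition rY (j : 'I_m) : role := inl (inr j).
Definition rZ e : role := inr (inl (inl e)).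
Definition rC u : role := inr (inl (inr u)).
Definition rP (d : 'I_D) : role := inr (inr d).

Definition enc (r : role) : 'I_N :=
  match r with
  | inl (inl i) => in_q m #|{: anc}| i
  | inl (inr j) => out_q n #|{: anc}| j
  | inr c => anc_q n m (enum_rank c)
  end.

Lemma enc_inj : injective enc.
Proof.
move=> [[i|j]|c] [[i'|j']|c'] /= /(congr1 val) /= h.
- by congr (inl (inl _)); apply: ord_inj.
- by exfalso; have := ltn_ord i; lia.
- by exfalso; have := ltn_ord i; lia.
- by exfalso; have := ltn_ord i'; lia.
- by congr (inl (inr _)); apply: ord_inj; lia.
- by exfalso; have := ltn_ord j; lia.
- by exfalso; have := ltn_ord i'; lia.
- by exfalso; have := ltn_ord j'; lia.
- by congr inr; apply/enum_rank_inj/ord_inj/(@addnI (n + m)).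
Qed.

Arguments enc : simpl never.

Lemma enc_surj q : exists r, q = enc r.
Proof.
have [|g _ gK] := inj_card_bij enc_inj; last by exists (g q); rewrite gK.
by rewrite !card_sum !card_ord.
Qed.

Definition st (g : role -> bool) : basis N :=
  fun q => if [pick r | enc r == q] is Some r then g r else false.

Lemma stE g r : st g (enc r) = g r.
Proof. by rewrite /st; case: pickP => [r' /eqP /enc_inj -> //|/(_ r)]; rewrite eqxx. Qed.

Lemma enc_eq r r' : (enc r == enc r') = (r == r').
Proof. exact: inj_eq enc_inj r r'. Qed.

Definition src u : {set 'I_n} := if u.2 then halfB (val u.1) else halfA (val u.1).

Lemma src_gt0 u : 0 < #|src u|.
Proof.
have h : 1 < #|val u.1| := valP u.1.
by rewrite /src; case: (u.2); rewrite ?card_halfA ?card_halfB; lia.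
Qed.

Lemma lv_src u : lv (src u) < lv (val u.1).
Proof.
apply: up_log_half; first exact: valP u.1.
by have h : 1 < #|val u.1| := valP u.1; rewrite /src; case: (u.2); rewrite ?card_halfA ?card_halfB; lia.
Qed.

Variable i0 : 'I_n.

Definition srole J : role :=
  if insub J is Some e then rZ e else if [pick i in J] is Some i then rX i else rX i0.

Lemma srole_mon e : srole (val e) = rZ e.
Proof. by rewrite /srole valK. Qed.

Lemma srole1 i : srole [set i] = rX i.
Proof.
rewrite /srole insubF ?cards1 //; case: pickP => [i'|/(_ i)]; rewrite inE ?eqxx //.
by move=> /eqP ->.
Qed.

Lemma sroleP J : 0 < #|J| ->
  (exists2 e, J = val e & srole J = rZ e) \/ (exists2 i, J = [set i] & srole J = rX i).
Proof.
move=> J0; case: (ltnP 1 #|J|) => J1.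
  by left; exists (Sub J J1); rewrite ?SubK // -srole_mon SubK.
have /cards1P [i ->] : #|J| == 1 by lia.
by right; exists i; rewrite ?srole1.
Qed.

Lemma srole_inj J J' : 0 < #|J| -> 0 < #|J'| -> srole J = srole J' -> J = J'.
Proof. by move=> /sroleP [] [x -> ->] /sroleP [] [x' -> ->] // [->]. Qed.

Definition us k J : seq use := [seq u <- enum {: use} | (lv (val u.1) == k) && (src u == J)].
(** Among the uses of one monomial at one level, the first reads the qubit of the monomial itself;
    the others need a copy. *)
Definition first u : bool := index u (us (lv (val u.1)) (src u)) == 0.

Lemma mem_us k J u : (u \in us k J) = (lv (val u.1) == k) && (src u == J).
Proof. by rewrite mem_filter mem_enum andbT. Qed.

Lemma uniq_us k J : uniq (us k J).
Proof. exact/filter_uniq/enum_uniq. Qed.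

Lemma mem_behead_us k J u :
  (u \in behead (us k J)) = [&& lv (val u.1) == k, src u == J & ~~ first u].
Proof.
have [e1|] := boolP ((lv (val u.1) == k) && (src u == J)); last first.
  move=> h; rewrite andbA (negbTE h) andFb; apply: contraNF h; rewrite -mem_us => /mem_behead //.
have ui : u \in us k J by rewrite mem_us.
case/andP: e1 => /eqP e1 /eqP e2; rewrite e1 e2 !eqxx /first e1 e2 /=.
have := uniq_us k J; case: (us k J) ui => //= u' l; rewrite inE => h /andP [nu _].
case: (u' =P u) => [<-|ne]; first by rewrite (negbTE nu).
by move: h; rewrite eq_sym; case: eqP.
Qed.

Hypothesis leD : #|{: mon}| <= D.

Definition slot u : role := if first u then srole (src u) else rC u.
Definition wrk e : role := rP (widen_ord leD (enum_rank e)).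
(** Parity qubits are borrowed: the links of a level run before its AND gates, when the target and
    the work qubit of the gate of [u.1] are still 0. They serve the two uses of that gate and cost
    no ancilla. *)
Definition par u : role := if u.2 then rZ u.1 else wrk u.1.

Lemma wrk_inj : injective wrk.
Proof. by move=> e e' [] /ord_inj /enum_rank_inj. Qed.

Lemma par_inj : injective par.
Proof.
move=> [e b] [e' b']; rewrite /par /=; case: b; case: b' => //; first by case=> ->.
by move/wrk_inj ->.
Qed.

Lemma first_inj u u' : lv (val u.1) = lv (val u'.1) -> src u = src u' -> first u -> first u' -> u = u'.
Proof.
rewrite /first => -> ->; set l := us _ _ => h h'.
have ui : u' \in l by rewrite mem_us !eqxx.
case: l ui h h' => //= x l _; case: (x =P u) => // <- _; by case: (x =P u').
Qed.

(** Within a level different uses read different qubits, which lets all its AND gates run at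
    once. *)
Lemma slot_inj u u' : lv (val u.1) = lv (val u'.1) -> slot u = slot u' -> u = u'.
Proof.
move=> e; rewrite /slot; case f: (first u); case f': (first u').
- by move/(srole_inj (src_gt0 u) (src_gt0 u')) => es; exact: (first_inj e es f f').
- by case: (sroleP (src_gt0 u)) => -[x _ ->].
- by case: (sroleP (src_gt0 u')) => -[x _ ->].
- by case.
Qed.

Definition params := ({ffun 'I_n -> bool} * {ffun 'I_m -> bool})%type.

(* The value of each qubit once the monomials of level at most [kz] and the
   copies for the levels at most [kc] have been computed. *)
Definition gst (kz kc : nat) (p : params) (r : role) : bool :=
  match r with
  | inl (inl i) => p.1 i
  | inl (inr j) => p.2 j
  | inr (inl (inl e)) => (lv (val e) <= kz) && mono (val e) p.1
  | inr (inl (inr u)) => [&& lv (val u.1) <= kc, ~~ first u & mono (src u) p.1]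
  | inr (inr d) => false
  end.
Definition fam kz kc (p : params) : basis N := st (gst kz kc p).

Lemma gst_srole kz kc p J : 0 < #|J| -> lv J <= kz -> gst kz kc p (srole J) = mono J p.1.
Proof.
move=> J0 h; case: (sroleP J0) => -[x e ->] /=; first by rewrite -e h.
rewrite e; apply/idP/forall_inP => [h1 i|]; first by rewrite inE => /eqP ->.
by apply; rewrite inE.
Qed.

Lemma gst_slot kz kc p u : lv (val u.1) <= kc -> lv (val u.1) <= kz.+1 ->
  gst kz kc p (slot u) = mono (src u) p.1.
Proof.
move=> h h'; rewrite /slot; case: ifP => f; last by rewrite /= h f.
by apply: gst_srole; [exact: src_gt0|have := lv_src u; lia].
Qed.

Lemma mono_split e x : mono (val e) x = mono (src (e, false)) x && mono (src (e, true)) x.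
Proof. by rewrite -monoU /src /= halfU. Qed.

Definition chs k : seq ('I_N * seq ('I_N * 'I_N)) :=
  [seq (enc (srole J), [seq (enc (rC u), enc (par u)) | u <- behead (us k J)])
     | J <- enum {set 'I_n} & us k J != [::]].

Definition nlinks k := size (all_links (chs k)).

Lemma us_ne k J : us k J != [::] -> 0 < #|J| /\ lv J < k.
Proof.
rewrite -has_filter => /hasP [u _ /andP [/eqP <- /eqP <-]].
by split; [exact: src_gt0|exact: lv_src].
Qed.

Lemma chs_mem k d l c p : (d, l) \in chs k -> (c, p) \in l ->
  exists u, [/\ lv (val u.1) = k, ~~ first u, d = enc (srole (src u)), c = enc (rC u) & p = enc (par u)].
Proof.
move=> /mapP [J _ [-> ->]] /mapP [u]; rewrite mem_behead_us => /and3P [/eqP e1 /eqP <- f] [-> ->].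
by exists u.
Qed.

Lemma srole_ne_C J u : 0 < #|J| -> (srole J == rC u) = false.
Proof. by move=> /sroleP [] [x _ ->]; apply/eqP. Qed.

Lemma srole_ne_wrk J e : 0 < #|J| -> (srole J == wrk e) = false.
Proof. by move=> /sroleP [] [x _ ->]; apply/eqP. Qed.

Lemma srole_ne_Z J e : 0 < #|J| -> lv J < lv (val e) -> (srole J == rZ e) = false.
Proof.
move=> J0 h; apply/negP => /eqP; case: (sroleP J0) => -[x e1 ->] // [e2].
by move: h; rewrite e1 e2 ltnn.
Qed.

Lemma srole_ne_par J u : 0 < #|J| -> lv J < lv (val u.1) -> (srole J == par u) = false.
Proof. by move=> J0 h; rewrite /par; case: ifP => _; rewrite ?srole_ne_Z ?srole_ne_wrk. Qed.

Lemma C_ne_par u u' : (rC u == par u') = false.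
Proof. by rewrite /par; case: ifP => _; apply/eqP. Qed.

Lemma uniq_chs k : uniq (flatten (map (@ch_qs N) (chs k))).
Proof.
rewrite /chs -map_comp; apply: uniq_flatten_map; first exact/filter_uniq/enum_uniq.
  move=> J; rewrite mem_filter => /andP [/us_ne [J0 Jk] _] /=.
  rewrite /ch_qs /= -map_comp; apply/andP; split.
    apply/flatten_mapP => -[u]; rewrite mem_behead_us => /and3P [/eqP uk _ _].
    by rewrite /= !inE !enc_eq srole_ne_C ?srole_ne_par // uk.
  apply: uniq_flatten_map; first by have := uniq_us k J; case: (us k J) => //= ? ? /andP [].
    by move=> u _ /=; rewrite inE enc_eq C_ne_par.
  move=> u u' q _ _ /=; rewrite !inE => /orP [] /eqP -> /orP [] /eqP /enc_inj.
  - by case.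
  - by move/eqP; rewrite C_ne_par.
  - by move/esym/eqP; rewrite C_ne_par.
  - by move/par_inj.
move=> J J' q; rewrite !mem_filter => /andP [/us_ne [J0 Jk] _] /andP [/us_ne [J0' Jk'] _] /=.
rewrite /ch_qs /= !inE.
have E J1 : q \in flatten [seq [:: g.1; g.2] | g <- [seq (enc (rC u), enc (par u)) | u <- behead (us k J1)]] ->
    exists u, [/\ lv (val u.1) = k, src u = J1 & q = enc (rC u) \/ q = enc (par u)].
  rewrite -map_comp => /flatten_mapP [u]; rewrite mem_behead_us => /and3P [/eqP e1 /eqP e2 _].
  by rewrite !inE => /orP [] /eqP ->; exists u; split=> //; [left|right].
move=> /orP [/eqP e1|/E [u [k1 <- H]]] /orP [/eqP e2|/E [u' [k1' <- H']]].
- by move: e2; rewrite e1 => /enc_inj /(srole_inj J0 J0').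
- by move: H'; rewrite e1 => -[] /enc_inj/eqP; rewrite ?srole_ne_C ?srole_ne_par ?k1'.
- by move: H; rewrite e2 => -[] /enc_inj/eqP; rewrite ?srole_ne_C ?srole_ne_par ?k1.
case: H => e1; case: H' => e2; move: e2; rewrite e1 => /enc_inj.
- by case=> ->.
- by move/eqP; rewrite C_ne_par.
- by move/esym/eqP; rewrite C_ne_par.
- by move/par_inj ->.
Qed.

Lemma fan_level k : impl (fam k k) (fam k k.+1) 0 0 (2 * nlinks k.+1) (2 * (0 < nlinks k.+1)).
Proof.
apply: impl_fan; first exact: uniq_chs.
  move=> x d l c p h1 h2; have [u [e1 f -> -> ->]] := chs_mem h1 h2.
  rewrite /fam !stE /= e1 ltnn leqnn f /=; split=> //.
    by rewrite /par; case: ifP => //= _; rewrite e1 ltnn.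
  by rewrite gst_srole ?src_gt0 //; have := lv_src u; rewrite e1 ltnS.
move=> x q; have [r ->] := enc_surj q => H; rewrite /fam !stE.
case: r H => [[i|j]|[[e|u]|d]] //= H.
case: (leqP (lv (val u.1)) k) => [h|h]; first by rewrite (leq_trans h).
case: (lv (val u.1) =P k.+1) => [e1|ne]; last by rewrite leqNgt ltn_neqAle h eq_sym andbT; move/eqP: ne => ->.
rewrite e1 leqnn /=; case f: (first u) => //=.
have : (enc (srole (src u)), [seq (enc (rC u), enc (par u)) | u <- behead (us k.+1 (src u))]) \in chs k.+1.
  apply/mapP; exists (src u) => //; rewrite mem_filter mem_enum andbT -has_filter.
  by apply/hasP; exists u; rewrite ?mem_enum // e1 !eqxx.
move/H/mapP => []; exists (enc (rC u), enc (par u)) => //; apply/mapP; exists u => //.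
by rewrite mem_behead_us e1 !eqxx f.
Qed.

Definition quad_of e : quad N :=
  (enc (slot (e, false)), enc (slot (e, true)), enc (rZ e), enc (wrk e)).
Definition trip_of e : trip N := (enc (slot (e, false)), enc (slot (e, true)), enc (rZ e)).

Lemma slot_ne_Z u e : lv (val u.1) <= lv (val e) -> (slot u == rZ e) = false.
Proof.
rewrite /slot => h; case: ifP => _; last by apply/eqP.
by apply: srole_ne_Z; [exact: src_gt0|exact: leq_trans (lv_src u) h].
Qed.

Lemma slot_ne_wrk u e : (slot u == wrk e) = false.
Proof. by rewrite /slot; case: ifP => _; rewrite ?srole_ne_wrk ?src_gt0 //; apply/eqP. Qed.

Lemma Z_ne_wrk e e' : (rZ e == wrk e') = false.
Proof. by apply/eqP. Qed.

Lemma uniq_quads k : uniq (flatten (map (@quad_qs N) (map quad_of (level k)))).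
Proof.
rewrite -map_comp; apply: uniq_flatten_map; first exact/filter_uniq/enum_uniq.
  move=> e _; rewrite /= !inE !enc_eq !slot_ne_Z // !slot_ne_wrk Z_ne_wrk /= orbF andbT.
  by apply/eqP => /slot_inj -/(_ erefl) [].
move=> e e' q; rewrite !mem_filter => /andP [/eqP k1 _] /andP [/eqP k2 _] /=.
have sl b b' : slot (e, b) = slot (e', b') -> e = e' by move/slot_inj => /= -/(_ (etrans k1 (esym k2))) [].
have ne b : (slot (e, b) == rZ e') = false by rewrite slot_ne_Z //= k1 k2.
have ne' b : (slot (e', b) == rZ e) = false by rewrite slot_ne_Z //= k1 k2.
rewrite !inE => /or4P [] /eqP ->; rewrite !enc_eq ?ne ?slot_ne_wrk ?Z_ne_wrk ?(eq_sym (rZ e)) ?(eq_sym (wrk e))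
  ?ne' ?slot_ne_wrk ?Z_ne_wrk ?orbF /=.
- by case/orP => /eqP /sl.
- by case/orP => /eqP /sl.
- by move=> /eqP [].
- by move=> /eqP /wrk_inj.
Qed.

Lemma uniq_trips k : uniq (flatten (map (@trip_qs N) (map trip_of (level k)))).
Proof.
have := uniq_quads k; elim: (level k) => //= e l IH.
rewrite !inE !negb_or => /and5P [/and4P [-> -> _ n1] /and3P [-> _ n2] /andP [_ n3] n4 u].
have ss q : q \notin flatten [seq quad_qs i | i <- [seq quad_of i | i <- l]] ->
    q \notin flatten [seq trip_qs i | i <- [seq trip_of i | i <- l]].
  apply: contra; rewrite -!map_comp => /flatten_mapP [e' i h]; apply/flatten_mapP; exists e' => //.
  by move: h; rewrite /= !inE => /or3P [] ->; rewrite ?orbT.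
by rewrite IH // !ss.
Qed.

Lemma and_level k : impl (fam k k.+1) (fam k.+1 k.+1)
  (4 * size (level k.+1)) (0 < size (level k.+1)) (6 * size (level k.+1)) 4.
Proof.
rewrite -(size_map quad_of); apply: impl_and; first exact: uniq_quads.
  move=> x a b z w /mapP [e]; rewrite mem_filter => /andP [/eqP ek _] [-> -> -> ->].
  by rewrite /fam !stE !gst_slot /= ?ek ?leqnn // ltnn mono_split.
move=> x q; have [r ->] := enc_surj q => H; rewrite /fam !stE.
case: r H => [[i|j]|[[e|u]|d]] //= H.
case: (leqP (lv (val e)) k) => [h|h]; first by rewrite (leq_trans h).
case: (lv (val e) =P k.+1) => [e1|ne]; last by rewrite leqNgt ltn_neqAle h eq_sym andbT; move/eqP: ne => ->.
case/negP: H; rewrite -map_comp; apply/mapP; exists e => //.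
by rewrite mem_filter e1 eqxx mem_enum.
Qed.

Lemma uand_level k : impl (fam k.+1 k.+1) (fam k k.+1) 0 0 (size (level k.+1)) 1.
Proof.
rewrite -(size_map trip_of); apply: impl_uand; first exact: uniq_trips.
  move=> x a b z /mapP [e]; rewrite mem_filter => /andP [/eqP ek _] [-> -> ->].
  by rewrite /fam !stE !gst_slot /= ?ek ?leqnn // ltnn mono_split.
move=> x q; have [r ->] := enc_surj q => H; rewrite /fam !stE.
case: r H => [[i|j]|[[e|u]|d]] //= H.
case: (leqP (lv (val e)) k) => [h|h]; first by rewrite (leq_trans h).
case: (lv (val e) =P k.+1) => [e1|ne]; last by rewrite leqNgt ltn_neqAle h eq_sym andbT; move/eqP: ne => ->.
case/negP: H; rewrite -map_comp; apply/mapP; exists e => //.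
by rewrite mem_filter e1 eqxx mem_enum.
Qed.

Lemma erase_level k : impl (fam k k.+1) (fam k k) 0 0 0 0.
Proof.
pose es := [seq (enc (rC u), [:: enc (srole (src u))]) | u <- enum {: use} & (lv (val u.1) == k.+1) && ~~ first u].
have ines q l : (q, l) \in es ->
    exists u, [/\ lv (val u.1) = k.+1, ~~ first u, q = enc (rC u) & l = [:: enc (srole (src u))]].
  by move=> /mapP [u]; rewrite mem_filter => /andP [/andP [/eqP h f] _] [-> ->]; exists u.
have mes : map fst es = [seq enc (rC u) | u <- enum {: use} & (lv (val u.1) == k.+1) && ~~ first u].
  by rewrite /es -map_comp.
apply: (impl_erase (es := es)).
- rewrite mes map_inj_uniq; first exact/filter_uniq/enum_uniq.
  by move=> u u' /enc_inj [].
- move=> q l r /ines [u [_ _ _ ->]]; rewrite inE => /eqP ->; rewrite mes.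
  by apply/mapP => -[u' _ /enc_inj/eqP]; rewrite srole_ne_C ?src_gt0.
- move=> x q l /ines [u [e1 f -> ->]]; rewrite /xorl big_seq1 /fam !stE /= e1 leqnn ltnn f /=.
  by rewrite gst_srole ?src_gt0 //; have := lv_src u; rewrite e1 ltnS.
move=> x q; have [r ->] := enc_surj q => H; rewrite /fam !stE.
case: r H => [[i|j]|[[e|u]|d]] //= H.
case: (leqP (lv (val u.1)) k) => [h|h]; first by rewrite (leq_trans h).
case: (lv (val u.1) =P k.+1) => [e1|ne]; last by rewrite leqNgt ltn_neqAle h eq_sym andbT; move/eqP: ne => ->.
rewrite e1 leqnn /=; case f: (first u) => //=; case/negP: H; rewrite mes.
by apply/mapP; exists u; rewrite // mem_filter e1 eqxx f mem_enum.
Qed.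

(** The copies are kept during [mid], since uncomputing the AND gates needs their inputs again. The
    7 CNOTs per monomial are 6 + 1 and the 5 layers are 4 + 1, for the AND gates and their
    uncomputation. *)
Lemma impl_level (F : params -> params) k tc td cc cd : (forall p, (F p).1 = p.1) ->
  impl (fam k.+1 k.+1) (fam k.+1 k.+1 \o F) tc td cc cd ->
  impl (fam k k) (fam k k \o F) (4 * size (level k.+1) + tc) ((0 < size (level k.+1)) + td)
    (2 * nlinks k.+1 + 7 * size (level k.+1) + cc) (2 * (0 < nlinks k.+1) + 5 + cd).
Proof.
move=> F1 mid.
have I := impl_seq (impl_seq (impl_seq (impl_seq (fan_level k) (and_level k)) mid)
  (impl_reindex F (uand_level k))) (impl_reindex F (erase_level k)).
by rewrite !addn0 !add0n in I; apply: impl_le I _ _ _; lia.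
Qed.

Lemma nlinksE k : nlinks k = \sum_(J | us k J != [::]) size (behead (us k J)).
Proof.
rewrite /nlinks /all_links /chs size_flatten /shape -2!map_comp sumnE big_map big_filter big_enum_cond /=.
apply: eq_bigr => J _ /=; elim: (behead _) (enc _) => //= u l IH q; by rewrite IH.
Qed.

(** A monomial has two uses. At 2 CNOTs per link this gives 4, which with the 7 of [impl_level]
    makes the 11 of [impl_levels]. *)
Lemma nlinks_le k : nlinks k <= 2 * size (level k).
Proof.
rewrite nlinksE; apply: (@leq_trans (\sum_J size (us k J))).
  rewrite big_mkcond leq_sum // => J _; case: ifP => // _; rewrite size_behead; lia.
have -> : \sum_J size (us k J) = \sum_J \sum_(u : use) ((lv (val u.1) == k) && (src u == J)).
  by apply: eq_bigr => J _; rewrite size_filter -sum1_count big_enum_cond big_mkcond.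
rewrite exchange_big /= (eq_bigr (fun u : use => (lv (val u.1) == k) : nat)) => [|u _]; last first.
  rewrite (bigD1 (src u)) //= eqxx andbT big1 ?addn0 // => J ne.
  by rewrite (eq_sym (src u)) (negbTE ne) andbF.
rewrite -(pair_bigA _ (fun e (b : bool) => (lv (val e) == k) : nat)) /=.
rewrite size_filter -sum1_count big_enum_cond [X in _ <= 2 * X]big_mkcond /= big_distrr /=.
apply: leq_sum => e _; rewrite big_bool; case: (_ == k) => /=; lia.
Qed.

(* Monomials of all levels are computed, then [mid] is run, then they are
   uncomputed in the reverse order. *)
Lemma impl_levels (F : params -> params) L tc td cc cd : (forall p, (F p).1 = p.1) ->
  L <= up_log 2 n ->
  impl (fam L L) (fam L L \o F) tc td cc cd ->
  impl (fam 0 0) (fam 0 0 \o F) (4 * (nmon 0 - nmon L) + tc) (L + td)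
    (11 * (nmon 0 - nmon L) + cc) (7 * L + cd).
Proof.
move=> F1; elim: L tc td cc cd => [|L IH] tc td cc cd Ln mid; first by rewrite subnn.
have I := IH _ _ _ _ (ltnW Ln) (impl_level F1 mid).
have lt : nmon L <= nmon 0.
  by rewrite /nmon big_mkcond [X in _ <= X]big_mkcond leq_sum // => e _; case: ifP => // h; rewrite (leq_trans _ h).
have E := nmonS n L; have h0 := @level_gt0 n L.+1 Ln; have nl := nlinks_le L.+1.
have -> : L.+1 + td = L + ((0 < size (level L.+1)) + td) by rewrite h0 addnS.
apply: impl_le I _ _ _; try lia.
Qed.

End Levels.
Arguments enc : simpl never.

(** * Algebraic normal form *)

Section NormalForm.
Variable n : nat.

(** Moebius inversion over subsets mod 2, by induction on the size: the coefficient of a set of size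
    k + 1 is the value of [G] there plus the coefficients of its proper subsets. *)
Lemma anf_set (G : {set 'I_n} -> bool) :
  exists a : {set 'I_n} -> bool, forall X : {set 'I_n}, G X = \big[addb/false]_(I : {set 'I_n} | I \subset X) a I.
Proof.
suff H k : exists a : {set 'I_n} -> bool,
    forall X : {set 'I_n}, #|X| <= k -> G X = \big[addb/false]_(I : {set 'I_n} | I \subset X) a I.
  by have [a Ha] := H n; exists a => X; apply: Ha; rewrite -[X in _ <= X]card_ord max_card.
elim: k => [|k [a IH]].
  exists (fun=> G set0) => X; rewrite leqn0 cards_eq0 => /eqP ->.
  by rewrite (big_pred1 set0) // => I; rewrite subset0.
exists (fun I : {set 'I_n} => if #|I| <= k then a I else G I (+) \big[addb/false]_(J : {set 'I_n} | J \proper I) a J) => X Xk.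
case: (leqP #|X| k) => h.
  rewrite IH //; apply: eq_bigr => I IX; by rewrite (leq_trans (subset_leq_card IX) h).
rewrite (bigD1 X) //= leqNgt h /= [X in _ = _ (+) X](eq_big (fun I : {set 'I_n} => I \proper X) a).
- by rewrite -addbA addbb addbF.
- by move=> I; rewrite properEneq andbC.
- move=> I /andP [IX ne]; have /proper_card : I \proper X by rewrite properEneq ne.
  by move=> c; rewrite ifT // -ltnS (leq_trans c).
Qed.

(** The constant term is set apart: it is realized by a NOT gate on the output and needs no source
    qubit. *)
Lemma anf (f : {ffun 'I_n -> bool} -> bool) : exists a : {set 'I_n} -> bool,
  forall x, f x = a set0 (+) \big[addb/false]_(I : {set 'I_n} | I != set0) (a I && mono I x).
Proof.
have [a Ha] := anf_set (fun X => f [ffun i => i \in X]); exists a => x.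
have -> : f x = f [ffun i => i \in [set i | x i]].
  by congr f; apply/ffunP => i; rewrite ffunE inE.
rewrite Ha (bigD1 set0) ?sub0set //=; congr addb.
rewrite big_mkcond [RHS]big_mkcond; apply: eq_bigr => I _; rewrite andbC; case: (I != set0) => //=.
have -> : mono I x = (I \subset [set i | x i]).
  apply/forall_inP/subsetP => h i /h; by rewrite inE.
by case: (_ \subset _); rewrite ?andbT ?andbF.
Qed.

End NormalForm.

(** * From stages to a circuit for the function *)

Section Assembly.
Variables (n m D : nat).
Notation a := #|{: anc n D}|.
Notation N := (n + m + a).

(** Monomials of degree at least 2 have positive level, so at level 0 every ancilla is in 0. *)
Lemma fam0_basis x y : ket (@fam n m D 0 0 (x, y)) = @basis_state n m a x y.
Proof.
have lv0 (e : mon n) : (lv (val e) <= 0) = false.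
  by rewrite leqNgt /lv up_log_gt0 /= (valP e).
have gA (c : anc n D) : gst 0 0 (x, y) (inr c) = false.
  by case: c => [[e|u]|d] //=; rewrite lv0.
apply: functional_extensionality => s; rewrite /ket /basis_state.
have -> // : [forall i, s i == @fam n m D 0 0 (x, y) i] =
  [forall i, s (in_q m a i) == x i] && [forall j, s (out_q n a j) == y j]
  && [forall k, ~~ s (anc_q n m k)].
apply/forallP/andP => [h|[/andP [/forallP h1 /forallP h2] /forallP h3] q].
  have H r : s (enc r) = gst 0 0 (x, y) r by rewrite (eqP (h (enc r))) /fam stE.
  split; [apply/andP; split|]; apply/forallP.
  - by move=> i; apply/eqP; exact: (H (rX m D i)).
  - by move=> j; apply/eqP; exact: (H (rY n D j)).
  - move=> k; have := H (inr (enum_val k)); rewrite gA /enc enum_valK => -> //.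
have [r ->] := enc_surj q; rewrite /fam stE.
case: r => [[i|j]|c]; [exact: h1|exact: h2|rewrite gA].
by rewrite eqbF_neg; exact: h3.
Qed.

Lemma assemble (f : {ffun 'I_n -> bool} -> {ffun 'I_m -> bool}) tc td cc cd :
  impl (@fam n m D 0 0) (@fam n m D 0 0 \o fun p => (p.1, xorv p.2 (f p.1))) tc td cc cd ->
  exists C : circuit N, [/\ wf_circuit C, implements f C, T_depth C = td, T_count C <= tc
    & CNOT_count C <= cc /\ CNOT_depth C <= cd].
Proof.
move=> [k /(_ 0) [C [ok _ [T1 T2] [C1 C2] H]]]; exists C; split=> // b.
have [c E] := H b; exists c => x y s; have := E (x, y); rewrite fam0_basis /= fam0_basis.
by rewrite /run /nrun => ->.
Qed.

Lemma card_anc : a = 3 * #|{: mon n}| + D.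
Proof. by rewrite !card_sum card_prod card_bool card_ord -mulnS mulnC. Qed.

End Assembly.

(** * Output stage *)

Section Output.
Variables (n m D T : nat) (i0 : 'I_n) (S Hd : finType) (P : S -> nat).
Notation cell := {s : S & 'I_(P s)}.
Notation L := (up_log 2 n).
Notation set_n := {set 'I_n}.
Hypothesis leS : #|{: (Hd + cell + cell)%type}| <= D.
(** A source is a head, that is, an ancilla holding the sum of the monomials in [hv d], or the qubit
    of a monomial. A pair (J, d) in [cl] is a CNOT adding J to the head d, and
    [sched i j = Some (s, r)] lets output j read copy r of s in layer i. *)
Variables (hd : S -> Hd + set_n) (hv : Hd -> {set set_n}) (cl : seq (seq (set_n * Hd))).
Variable sched : 'I_T -> 'I_m -> option (S * nat).
Hypotheses (hd_inj : injective hd) (hd0 : forall s J, hd s = inr J -> 0 < #|J|).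
Hypothesis hv0 : forall d J, J \in hv d -> 0 < #|J|.
Hypothesis cl_uniq : forall l, l \in cl -> uniq (map fst l) && uniq (map snd l).
Hypothesis cl0 : forall e, e \in flatten cl -> 0 < #|e.1|.

Definition hval d (x : {ffun 'I_n -> bool}) : bool := \big[addb/false]_(J : set_n | J \in hv d) mono J x.
Hypothesis cl_val : forall d x, \big[addb/false]_(e <- flatten cl | e.2 == d) mono e.1 x = hval d x.
Hypothesis sched_bound : forall i j s r, sched i j = Some (s, r) -> r <= (P s).*2.
Hypothesis sched_inj : forall i j j' u, sched i j = Some u -> sched i j' = Some u -> j = j'.

Definition src_val s x : bool := match hd s with inl d => hval d x | inr J => mono J x end.

Definition scat (x : {ffun 'I_n -> bool}) : {ffun 'I_m -> bool} :=
  [ffun j => \big[addb/false]_(i < T) (if sched i j is Some u then src_val u.1 x else false)].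

Definition pl (c : Hd + cell + cell) : role n m D := rP n m (widen_ord leS (enum_rank c)).

Lemma pl_inj : injective pl.
Proof. by move=> c c' [] /ord_inj /enum_rank_inj. Qed.

Definition srcr s : role n m D := match hd s with inl d => pl (inl (inl d)) | inr J => srole m D i0 J end.

Lemma srole_ne_pl (J : set_n) c : 0 < #|J| -> (srole m D i0 J == pl c) = false.
Proof. by move=> /(sroleP m D i0) [] [x _ ->]; apply/eqP. Qed.

Lemma srcr_inj : injective srcr.
Proof.
move=> s s'; rewrite /srcr; case e: (hd s) => [d|J]; case e': (hd s') => [d'|J'].
- by move/pl_inj => [E]; apply: hd_inj; rewrite e e' E.
- by move/esym/eqP; rewrite srole_ne_pl //; apply: hd0 e'.
- by move/eqP; rewrite srole_ne_pl //; apply: hd0 e.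
- by move/(srole_inj (hd0 e) (hd0 e')) => E; apply: hd_inj; rewrite e e' E.
Qed.

Lemma srcr_ne s (b : bool) t : (srcr s == pl (if b then inl (inr t) else inr t)) = false.
Proof.
rewrite /srcr; case e: (hd s) => [d|J]; last by rewrite srole_ne_pl //; apply: hd0 e.
by rewrite (inj_eq pl_inj); case: b.
Qed.

Definition hgst (p : params n m) (r : role n m D) : bool :=
  if [pick d | r == pl (inl (inl d))] is Some d then hval d p.1 else gst L L p r.
Definition hfam p := st (hgst p).

Lemma hgst_head p d : hgst p (pl (inl (inl d))) = hval d p.1.
Proof.
by rewrite /hgst; case: pickP => [d' /eqP /pl_inj [->] //|/(_ d)]; rewrite eqxx.
Qed.

Lemma hgst_other p r : (forall d, (r == pl (inl (inl d))) = false) -> hgst p r = gst L L p r.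
Proof. by rewrite /hgst => H; case: pickP => // d; rewrite H. Qed.

Lemma lvL (J : set_n) : lv J <= L.
Proof. by apply: leq_up_log; rewrite -[X in _ <= X]card_ord max_card. Qed.

Lemma gst_src p (J : set_n) : 0 < #|J| -> gst L L p (srole m D i0 J) = mono J p.1.
Proof. by move=> J0; rewrite gst_srole // lvL. Qed.

Definition shift (p : params n m) : params n m := (p.1, xorv p.2 (scat p.1)).

Lemma impl_heads : impl (@fam n m D L L) hfam 0 0 (size (flatten cl)) (size cl).
Proof.
pose enc2 (e : set_n * Hd) := (enc (srole m D i0 e.1), enc (pl (inl (inl e.2)))).
have fl : flatten (map (map enc2) cl) = map enc2 (flatten cl) by rewrite map_flatten.
rewrite -(size_map (map enc2)) -(size_map enc2) -fl.
apply: impl_cx.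
- move=> l /mapP [l' il ->]; have /andP [u1 u2] := cl_uniq il.
  have l0 e : e \in l' -> 0 < #|e.1|.
    by move=> ie; apply: cl0; apply/flattenP; exists l'.
  apply: uniq_pairs.
  + have -> : map fst (map enc2 l') = map (fun J => enc (srole m D i0 J)) (map fst l').
      by rewrite -!map_comp.
    rewrite map_inj_in_uniq // => J J' /mapP [e ie ->] /mapP [e' ie' ->] /enc_inj.
    exact: srole_inj (l0 _ ie) (l0 _ ie').
  + have -> : map snd (map enc2 l') = map (fun d => enc (pl (inl (inl d)))) (map snd l').
      by rewrite -!map_comp.
    by rewrite map_inj_uniq // => d d' /enc_inj /pl_inj [].
  + move=> e e' /mapP [g ig ->] /mapP [g' _ ->] /=.
    by rewrite enc_eq srole_ne_pl // l0.
- move=> e e'; rewrite fl => /mapP [g ig ->] /mapP [g' _ ->] /=.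
  by rewrite enc_eq srole_ne_pl // cl0.
move=> p q; have [r ->] := enc_surj q; rewrite /hfam /fam !stE fl big_map.
rewrite big_seq_cond (eq_bigr (fun e => mono e.1 p.1)) => [|e /andP [ie _]]; last first.
  by rewrite stE gst_src // cl0.
rewrite -big_seq_cond /=.
have [d /eqP ->|nd] := pickP (fun d => r == pl (inl (inl d))).
  rewrite hgst_head (eq_bigl (fun e : set_n * Hd => e.2 == d)) ?cl_val // => e.
  by rewrite enc_eq (inj_eq pl_inj).
rewrite hgst_other // big_pred0 ?addbF // => e.
by rewrite enc_eq eq_sym nd.
Qed.

(** The monomials summed in a head are still present, so X measurements with Z corrections on them
    erase it. *)
Lemma impl_unheads : impl hfam (@fam n m D L L) 0 0 0 0.
Proof.
pose es := [seq (enc (pl (inl (inl d))), [seq enc (srole m D i0 J) | J <- enum (hv d)]) | d <- enum Hd].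
have mes : map fst es = [seq enc (pl (inl (inl d))) | d <- enum Hd] by rewrite /es -map_comp.
apply: (impl_erase (es := es)).
- by rewrite mes map_inj_uniq ?enum_uniq // => d d' /enc_inj /pl_inj [].
- move=> q l r /mapP [d _ [_ ->]] /mapP [J]; rewrite mem_enum => Jd ->; rewrite mes.
  by apply/mapP => -[d' _ /enc_inj /eqP]; rewrite srole_ne_pl // (hv0 Jd).
- move=> p q l /mapP [d _ [-> ->]]; rewrite /hfam /fam !stE hgst_head; split=> //.
  rewrite /xorl big_map big_enum; apply: eq_bigr => J Jd.
  rewrite stE hgst_other ?gst_src ?(hv0 Jd) // => d'.
  by rewrite srole_ne_pl // (hv0 Jd).
move=> p q; have [r ->] := enc_surj q => H; rewrite /hfam /fam !stE hgst_other // => d.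
apply/negbTE; apply: contra H => /eqP ->; rewrite mes.
by apply/mapP; exists d; rewrite ?mem_enum.
Qed.

Lemma hgst_srcr p s : hgst p (srcr s) = src_val s p.1.
Proof.
rewrite /srcr /src_val; case e: (hd s) => [d|J]; first exact: hgst_head.
have J0 := hd0 e; by rewrite hgst_other ?gst_src // => d; rewrite srole_ne_pl.
Qed.

Lemma impl_output : impl (@fam n m D L L) (@fam n m D L L \o shift) 0 0
  (size (flatten cl) + (3 * \sum_s P s + \sum_(i < T) \sum_(j < m) sched i j)) (size cl + (3 + T)).
Proof.
have cellz p c : (forall d, (pl c == pl (inl (inl d))) = false) -> hgst p (pl c) = false.
  by move=> h; rewrite hgst_other.
have I2 : impl hfam (hfam \o shift) 0 0 (3 * \sum_s P s + \sum_(i < T) \sum_(j < m) sched i j) (3 + T).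
  apply: (@impl_scatter _ m T S (fun s => enc (srcr s)) P (fun t => enc (pl (inl (inr t))))
    (fun t => enc (pl (inr t))) (fun j => enc (rY n D j)) sched) => //.
  - by move=> s s' /enc_inj /srcr_inj.
  - by move=> t t' /enc_inj /pl_inj [].
  - by move=> t t' /enc_inj /pl_inj [].
  - by move=> j j' /enc_inj [].
  - by move=> s t; rewrite enc_eq (srcr_ne s true).
  - by move=> s t; rewrite enc_eq (srcr_ne s false).
  - by move=> t t'; rewrite enc_eq (inj_eq pl_inj).
  - move=> j s; rewrite enc_eq /srcr; case e: (hd s) => [d|J] //.
    by case: (sroleP m D i0 (hd0 e)) => -[x _ ->].
  - by move=> j t; rewrite enc_eq.
  - by move=> j t; rewrite enc_eq.
  - by move=> p t; rewrite /hfam !stE !cellz // => d; rewrite (inj_eq pl_inj).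
  - move=> p j; rewrite /hfam /= !stE !hgst_other //= /shift /= !ffunE; congr addb.
    apply: eq_bigr => i _; rewrite /val_at; case: (sched i j) => // u.
    by rewrite stE hgst_srcr.
  - move=> p q; have [r ->] := enc_surj q => H; rewrite /hfam /= !stE /hgst.
    case: pickP => // _; case: r H => [[i|j]|[[e|u]|d]] //= H.
    by have := H j; rewrite eqxx.
have I := impl_seq (impl_seq impl_heads I2) (impl_reindex shift impl_unheads).
by rewrite !addn0 in I.
Qed.

Lemma impl_output_not (f : {ffun 'I_n -> bool} -> {ffun 'I_m -> bool}) (k : 'I_m -> bool) :
  (forall x j, f x j = k j (+) scat x j) ->
  impl (@fam n m D L L) (@fam n m D L L \o fun p => (p.1, xorv p.2 (f p.1))) 0 0
  (size (flatten cl) + (3 * \sum_s P s + \sum_(i < T) \sum_(j < m) sched i j)) (size cl + (3 + T)).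
Proof.
move=> fE; pose l := [seq enc (rY n D j) | j <- enum 'I_m & k j].
have I : impl (@fam n m D L L \o shift) (@fam n m D L L \o fun p => (p.1, xorv p.2 (f p.1))) 0 0 0 0.
  apply: (impl_not (l := l)).
    rewrite map_inj_uniq ?(filter_uniq _ (enum_uniq _)) // => j j' /enc_inj [] //.
  move=> p q; have [r ->] := enc_surj q; rewrite /fam /= !stE.
  have ml : (enc r \in l) = if r is inl (inr j) then k j else false.
    apply/mapP/idP => [[j]|]; first by rewrite mem_filter => /andP [kj _] /enc_inj ->.
    by case: r => [[i|j]|c] // kj; exists j => //; rewrite mem_filter kj mem_enum.
  rewrite ml; case: r {ml} => [[i|j]|[[e|u]|d]] /=; rewrite ?addbF //.
  by rewrite ![xorv _ _ _]ffunE fE -addbA (addbC (k j)).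
by have := impl_seq impl_output I; rewrite !addn0.
Qed.

End Output.

(** * At least three inputs *)

Definition within_bounds (n m : nat) (f : {ffun 'I_n -> bool} -> {ffun 'I_m -> bool}) : Prop :=
  exists (a : nat) (C : circuit (n + m + a)),
    wf_circuit C /\
    implements f C /\
    T_depth C = up_log 2 n /\
    (a%:Z <= 2 ^+ n.-1 * (3 * n%:Z - 2) - 3 * n%:Z + m%:Z + 1)%R /\
    (T_count C <= 2 ^ n.+1 * (n - 2) + 4)%N /\
    ((CNOT_count C)%:Z
       <= 2 ^+ n.-1 * (11 * n%:Z + 2 * m%:Z - 18) - 4 * n%:Z - m%:Z + 9)%R /\
    ((CNOT_depth C)%:Z <= 2 ^+ n + 2 * n%:Z + 9 * (up_log 2 n)%:Z - 3)%R.

Lemma subset_of_card (T : finType) (A : {set T}) k : k <= #|A| -> exists2 B : {set T}, B \subset A & #|B| = k.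
Proof.
move=> kA; exists [set x in take k (enum A)].
  by apply/subsetP => x; rewrite inE => /mem_take; rewrite mem_enum.
rewrite cardsE (card_uniqP _) ?take_uniq ?enum_uniq // size_take -cardE.
by case: ltnP => //; lia.
Qed.

Lemma big_andb (I : Type) (r : seq I) (P : pred I) (c : bool) (F : I -> bool) :
  \big[addb/false]_(i <- r | P i) (c && F i) = c && \big[addb/false]_(i <- r | P i) F i.
Proof. by case: c => //=; rewrite big1. Qed.

(** Here u = 2^(n-1), NA counts the AND gates and w the cells. With d = n - 3, the claims are linear
    in the products d * u and m * u. For n = 3 the ancilla bound has no slack, so u = 4 is needed
    exactly. For CNOTs, cells occur only if 2u < m, and then the 2m saved CNOTs absorb the 3w
    spent. *)
Lemma large_arith (n m u NA w L a tc cc cd : nat) : 2 < n -> 0 < m -> NA + n + 1 = 2 * u ->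
  2 * w <= m.-1 + 2 * u -> (w = 0 \/ 2 * u < m) -> (n = 3 /\ u = 4 \/ 3 < n) -> 1 < L ->
  a <= 3 * NA + maxn NA (1 + 2 * w) -> tc <= 4 * NA + 0 ->
  cc <= 11 * NA + (4 + (3 * w + m * (2 * u - 3))) -> cd <= 7 * L + (4 + (3 + 2 * u)) ->
  (a%:Z <= u%:Z * (3 * n%:Z - 2) - 3 * n%:Z + m%:Z + 1)%R /\
  tc <= 2 * (2 * u) * (n - 2) + 4 /\
  (cc%:Z <= u%:Z * (11 * n%:Z + 2 * m%:Z - 18) - 4 * n%:Z - m%:Z + 9)%R /\
  (cd%:Z <= (2 * u)%:Z + 2 * n%:Z + 9 * L%:Z - 3)%R.
Proof.
move=> hn hm NAE w1 w2 u4 hL ha ht hc hd.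
have [d nd] : exists d, n = d + 3 by exists (n - 3); lia.
have du : 3 < n -> u <= d * u by rewrite nd => h; rewrite leq_pmull //; lia.
have u2 : 2 <= u by lia.
have [e ue] : exists e, u = e + 2 by exists (u - 2); lia.
have E1 : m * (2 * u - 3) = 2 * (m * u) - 3 * m by rewrite mulnBr; lia.
have E2 : 3 * m <= 2 * (m * u) by rewrite ue; lia.
have E3 : (u%:Z * (3 * n%:Z - 2) = 3 * (d * u)%:Z + 7 * u%:Z)%R by rewrite nd !PoszD PoszM; ring.
have E4 : (u%:Z * (11 * n%:Z + 2 * m%:Z - 18) = 11 * (d * u)%:Z + 15 * u%:Z + 2 * (m * u)%:Z)%R.
  by rewrite nd !PoszD !PoszM; ring.
have E5 : 2 * (2 * u) * (n - 2) = 4 * (d * u) + 4 * u by rewrite nd; lia.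
rewrite E3 E4 E5; rewrite E1 in hc.
move: (d * u) (m * u) {E1 E3 E4 E5} du E2 hc => X Y du E2 hc.
split; first by lia.
split; first by lia.
split; last by lia.
lia.
Qed.

Section Large.
Variables (n m : nat) (hn : 2 < n) (hm : 0 < m).
Notation set_n := {set 'I_n}.
Notation T := #|{: set_n}|.
Variable coef : 'I_m -> set_n -> bool.
Variable Q : {set set_n}.
Hypotheses (Q4 : #|Q| = 4) (Q0 : set0 \notin Q).

Lemma card_sets : T = 2 ^ n.
Proof. by rewrite -cardsT -powersetT card_powerset cardsT card_ord. Qed.

Let T0 : 0 < T. Proof. by rewrite card_sets expn_gt0. Qed.

(* When an output needs at least three of the four monomials of [Q], it uses
   their sum instead, together with the monomials that it does not need. *)
Definition flip j : bool := 2 < #|[set J in Q | coef j J]|.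
Definition coef' j (J : set_n) : bool :=
  if J == set0 then flip j else coef j J (+) (flip j && (J \in Q)).

(** Constant terms are NOT gates, so the index [set0] is free and denotes the sum over [Q]. The
    number of sources thus stays at T = 2^n, one per layer of the schedule. *)
Definition lhd (J : set_n) : unit + set_n := if J == set0 then inl tt else inr J.
Definition lcl : seq (seq (set_n * unit)) := [seq [:: (J, tt)] | J <- enum Q].

Definition rot (j : nat) (i : 'I_T) : 'I_T := Ordinal (ltn_pmod (i + j) T0).

Lemma rot_inj j : injective (rot j).
Proof.
move=> i i' /(congr1 val) /= /eqP; rewrite eqn_modDr !modn_small // => /eqP; exact: ord_inj.
Qed.

(** In layer i output j looks at source i + j mod T. Outputs of one block (equal [j %/ T]) look at
    different sources, different blocks use different copies, and in T layers each output meets each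
    source once. *)
Definition lsched (i : 'I_T) (j : 'I_m) : option (set_n * nat) :=
  let J := enum_val (rot j i) in if coef' j J then Some (J, j %/ T) else None.

(** Block 0 reads the sources themselves; each of the [m.-1 %/ T] further blocks needs a copy, and a
    cell provides two. *)
Definition ncop := uphalf (m.-1 %/ T).

Lemma lsched_bound i j J r : lsched i j = Some (J, r) -> r <= ncop.*2.
Proof.
rewrite /lsched; case: ifP => // _ [_ <-]; have : j %/ T <= m.-1 %/ T.
  by apply: leq_div2r; have := ltn_ord j; lia.
rewrite /ncop; lia.
Qed.

Lemma lsched_inj i j j' u : lsched i j = Some u -> lsched i j' = Some u -> j = j'.
Proof.
rewrite /lsched; case: ifP => // _ [<-]; case: ifP => // _ [/enum_val_inj /(congr1 val) /= /eqP + e].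
rewrite eqn_modDl => /eqP e'; apply: ord_inj.
by rewrite (divn_eq j T) (divn_eq j' T) e e'.
Qed.

Lemma sum_rot (R : Type) (idx : R) (op : Monoid.com_law idx) j (F : set_n -> R) :
  \big[op/idx]_(i < T) F (enum_val (rot j i)) = \big[op/idx]_J F J.
Proof.
transitivity (\big[op/idx]_(i < T) F (enum_val i)); last first.
  by rewrite -(big_enum_val (A := {: set_n}) F).
by rewrite [RHS](reindex_inj (@rot_inj j)).
Qed.

(** Outside [Q] there are T - 5 nonempty sets. Let k be the number of monomials of [Q] needed: they
    cost k if k <= 2, and otherwise 1 + (4 - k) through the head, hence at most 2 in both cases. *)
Lemma sum_coef' j : \sum_J coef' j J <= T - 3.
Proof.
have TE : T = 2 ^ n := card_sets.
have T8 : 8 <= T by rewrite TE (@leq_exp2l 2 3 n).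
have E : \sum_J coef' j J = flip j + \sum_(J in Q) (coef j J (+) flip j) + \sum_(J in ~: (set0 |: Q)) coef j J.
  rewrite (bigD1 set0) //= {1}/coef' eqxx -addnA; congr (_ + _).
  rewrite (bigID (mem Q)) /=; congr (_ + _).
    apply: eq_big => J; first by case: eqP => [->|]; rewrite ?(negbTE Q0) ?andbF.
    by move=> /andP [ne JQ]; rewrite /coef' (negbTE ne) JQ andbT.
  apply: eq_big => J; first by rewrite !inE negb_or.
  by move=> /andP [ne JQ]; rewrite /coef' (negbTE ne) (negbTE JQ) andbF addbF.
have B1 : \sum_(J in ~: (set0 |: Q)) coef j J <= T - 5.
  apply: (@leq_trans (\sum_(J in ~: (set0 |: Q)) 1)); first by apply: leq_sum => J _; case: (coef j J).
  by rewrite sum1_card cardsCs setCK cardsU1 Q0 Q4.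
have B2 : \sum_(J in Q) coef j J = #|[set J in Q | coef j J]|.
  rewrite -sum1_card big_mkcond [RHS]big_mkcond; apply: eq_bigr => J _.
  by rewrite inE; case: (J \in Q) => //; case: (coef j J).
have B3 : \sum_(J in Q) (coef j J (+) true) + \sum_(J in Q) coef j J = 4.
  by rewrite -big_split /= -Q4 -sum1_card; apply: eq_bigr => J _; case: (coef j J).
rewrite E; move: B2 B3; rewrite /flip; case: ltnP => h /= B2 B3.
  have AR (x1 x2 x3 t k : nat) : x2 = k -> x1 + x2 = 4 -> 2 < k -> x3 <= t - 5 -> 8 <= t ->
    1 + x1 + x3 <= t - 3 by lia.
  exact: AR B2 B3 h B1 T8.
rewrite [X in 0 + X](eq_bigr (fun J => coef j J : nat)) => [|J _]; last by rewrite addbF.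
have AR (x2 x3 t k : nat) : x2 = k -> k <= 2 -> x3 <= t - 5 -> 8 <= t -> 0 + x2 + x3 <= t - 3 by lia.
exact: AR B2 h B1 T8.
Qed.

(** For a flipped output the head adds every monomial of [Q], and complementing the coefficients
    adds each of them once more; mod 2 this cancels. *)
Lemma sum_val j x (h := fun J => if J == set0 then \big[addb/false]_(I : set_n | I \in Q) mono I x else mono J x) :
  \big[addb/false]_(J : set_n) (coef' j J && h J) =
  \big[addb/false]_(J : set_n | J != set0) (coef j J && mono J x).
Proof.
rewrite (bigD1 set0) //= {1}/coef' {1}/h eqxx.
have -> : \big[addb/false]_(J : set_n | J != set0) (coef' j J && h J) =
    \big[addb/false]_(J : set_n | J != set0) (coef j J && mono J x) (+)
    (flip j && \big[addb/false]_(J : set_n | J != set0) ((J \in Q) && mono J x)).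
  rewrite -big_andb -big_split /=; apply: eq_bigr => J ne.
  by rewrite /coef' /h (negbTE ne) andb_addl andbA.
rewrite addbC -addbA [X in _ (+) X](_ : _ = false) ?addbF //.
have -> : \big[addb/false]_(J : set_n | J != set0) ((J \in Q) && mono J x) =
          \big[addb/false]_(I : set_n | I \in Q) mono I x.
  rewrite big_mkcond [RHS]big_mkcond; apply: eq_bigr => J _.
  by case: eqP => [->|] /=; [rewrite (negbTE Q0)|case: (J \in Q)].
by rewrite addbb.
Qed.

Variable f : {ffun 'I_n -> bool} -> {ffun 'I_m -> bool}.
Hypothesis fE : forall x j, f x j =
  coef j set0 (+) \big[addb/false]_(J : set_n | J != set0) (coef j J && mono J x).

Lemma large_bounds : within_bounds f.
Proof.
have i0 : 'I_n by exists 0; lia.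
pose P (J : set_n) := ncop.
pose A := (unit + {J : set_n & 'I_(P J)} + {J : set_n & 'I_(P J)})%type.
pose D := maxn #|{: mon n}| #|{: A}|.
have TE : T = 2 ^ n := card_sets.
have cP : \sum_(J : set_n) P J = T * ncop by rewrite sum_nat_const.
have cA : #|{: A}| = 1 + 2 * (T * ncop).
  have c1 : #|{: {J : set_n & 'I_(P J)}}| = T * ncop.
    by rewrite card_tagged sumnE big_map big_enum -cP /=; apply: eq_bigr => J _; rewrite card_ord.
  by rewrite !card_sum !c1 card_unit; lia.
have leD : #|{: mon n}| <= D by exact: leq_maxl.
have leS : #|{: A}| <= D by exact: leq_maxr.
have hdi : injective lhd.
  by move=> J J'; rewrite /lhd; case: eqP => [->|_]; case: eqP => [->|_] // [].
have hd0 J J' : lhd J = inr J' -> 0 < #|J'|.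
  by rewrite /lhd; case: eqP => // /eqP ne [<-]; rewrite card_gt0.
have Qg J : J \in Q -> 0 < #|J|.
  by move=> JQ; rewrite card_gt0; apply: contraNneq Q0 => <-.
have fl : flatten lcl = [seq (J, tt) | J <- enum Q] by rewrite /lcl; elim: (enum Q) => //= J l ->.
have I := @impl_output_not n m D T i0 set_n unit P leS lhd (fun=> Q) lcl lsched hdi hd0
  (fun _ => Qg) _ _ _ lsched_bound lsched_inj f (fun j => coef j set0) _.
have {I}I : impl (@fam n m D (up_log 2 n) (up_log 2 n))
    (@fam n m D (up_log 2 n) (up_log 2 n) \o fun p => (p.1, xorv p.2 (f p.1))) 0 0
    (4 + (3 * (T * ncop) + m * (T - 3))) (4 + (3 + T)).
  have s1 : size (flatten lcl) = 4 by rewrite fl size_map -cardE.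
  have s2 : size lcl = 4 by rewrite size_map -cardE.
  rewrite s1 s2 cP in I; apply: impl_le (I _ _ _ _) _ _ _ => //.
  - by move=> l /mapP [J _ ->].
  - by move=> e; rewrite fl => /mapP [J]; rewrite mem_enum => /Qg h ->.
  - move=> [] x; rewrite fl big_map /hval /=.
    rewrite (eq_bigl (fun=> true)) // big_enum //.
  - move=> x j; rewrite fE; congr addb; rewrite /scat ffunE -sum_val -(sum_rot _ j).
    apply: eq_bigr => i _; rewrite /lsched; case: (coef' j _) => //=.
    by rewrite /src_val /lhd; case: eqP.
  rewrite !leq_add2l exchange_big /= -[m in m * _]card_ord -sum_nat_const leq_sum // => j _.
  have := sum_coef' j; rewrite -(sum_rot _ j) => h.
  apply: leq_trans h; apply: leq_sum => i _; rewrite /lsched; by case: (coef' j _).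
have {I}I := impl_levels (F := fun p => (p.1, xorv p.2 (f p.1))) i0 leD (fun=> erefl) (leqnn _) I.
have [C [wf im td tc [cc cd]]] := assemble I.
exists #|{: anc n D}|, C; split=> //; split=> //.
rewrite nmonL nmon0 subn0 in tc cc.
have NA := card_mon n.
set u := 2 ^ n.-1; have Tu : T = 2 * u by rewrite TE -(prednK (ltnW (ltnW hn))) expnS.
(* With q the integer part of (m - 1) / T: twice the number of cells per source is at most q + 1,
   and q T <= m - 1. If q > 0 then T < m. *)
have [w1 w2] : 2 * (T * ncop) <= m.-1 + T /\ (T * ncop = 0 \/ T < m).
  rewrite /ncop; set q := m.-1 %/ T; have qT : q * T <= m.-1 by exact: leq_trunc_div.
  split; last first.
    case: (posnP q) => [->|q0]; first by left; rewrite muln0.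
    by right; apply: leq_ltn_trans (_ : m.-1 < m); [apply: leq_trans qT; rewrite leq_pmull|lia].
  rewrite mulnCA.
  apply: (@leq_trans (T * q.+1)); last by rewrite mulnS addnC leq_add2r mulnC.
  rewrite leq_mul2l; apply/orP; right; lia.
have u4 : n = 3 /\ u = 4 \/ 4 <= n.
  case: (ltnP 3 n) => h; [by right|left].
  have n3 : n = 3 by apply/eqP; rewrite eqn_leq h hn.
  by rewrite /u n3.
have L2 : 2 <= up_log 2 n.
  by rewrite ltnNge; apply/negP => h; have := up_logP n (isT : 1 < 2); have := leq_pexp2l (isT : 0 < 2) h; lia.
split; first by rewrite td addn0.
have e1 : (2 ^+ n.-1 = u%:Z)%R by rewrite /u -natrX natz.
have e2 : (2 ^+ n = (2 * u)%:Z)%R by rewrite -Tu TE -natrX natz.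
have e3 : 2 ^ n.+1 = 2 * (2 * u) by rewrite expnS -TE Tu.
rewrite Tu in w1 w2 cc cd; rewrite -TE Tu in NA; rewrite e1 e2 e3.
apply: (large_arith (NA := #|{: mon n}|) (w := T * ncop)) => //.
- by rewrite Tu.
- by rewrite Tu.
- by rewrite card_anc leq_add2l /D cA.
- by rewrite Tu.
Qed.

End Large.

(** * Two inputs *)

Section Two.
Variables (m : nat) (hm : 0 < m).
Notation set2 := {set 'I_2}.
Notation set3 := {set 'I_3}.
Variable coef : 'I_m -> set2 -> bool.
Implicit Types (c : set3) (i : 'I_3) (j : 'I_m).

(** The default value of [nth] provides the third monomial x_1 x_2, at index 2. *)
Definition mon2 i : set2 := nth setT [:: [set ord0]; [set ord_max]] i.

Lemma mon2_gt0 i : 0 < #|mon2 i|.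
Proof. by case: i => -[|[|[|]]] //= h; rewrite /mon2 /= ?cards1 // cardsT card_ord. Qed.

Lemma mon2_inj : injective mon2.
Proof.
move=> [[|[|[|]]] //= h] [[|[|[|]]] //= h']; rewrite /mon2 /= => /setP E; apply: ord_inj => //=;
  by have := E ord0; have := E ord_max; rewrite !inE.
Qed.

Lemma mon2_onto : mon2 @: [set: 'I_3] = [set J : set2 | J != set0].
Proof.
apply/eqP; rewrite eqEcard; apply/andP; split.
  by apply/subsetP => J /imsetP [i _ ->]; rewrite inE -card_gt0 mon2_gt0.
rewrite card_imset ?cardsT ?card_ord; last exact: mon2_inj.
have -> : [set J : set2 | J != set0] = ~: [set set0] by apply/setP => J; rewrite !inE.
by rewrite cardsC1 -cardsT -powersetT card_powerset cardsT card_ord.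
Qed.

(* Outputs are grouped by the linear combination of x_1, x_2 and x_1 x_2 that
   they need; each combination in use is copied from one qubit. *)
Definition cls j : set3 := [set i | coef j (mon2 i)].
Definition used := {c : set3 | (c != set0) && [exists j, cls j == c]}.
Definition heads := {s in [pred s : used | 1 < #|val s|]}.
Implicit Types (s : used) (d : heads).

Definition hcls d : set3 := val (val d).
(** A combination with one term is read from the qubit of that monomial; only longer ones get a
    head. The default [ord0] is never reached, as the classes in [used] are nonempty. *)
Definition hd2 s : heads + set2 :=
  if insub s is Some d then inl d else inr (mon2 (odflt ord0 [pick i in val s])).
Definition hv2 d : {set set2} := mon2 @: hcls d.

Lemma used_gt0 s : 0 < #|val s|.
Proof. by have /andP [h _] := valP s; rewrite card_gt0. Qed.

Lemma hd2P s : (exists2 d, s = val d & hd2 s = inl d) \/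
  (exists2 i, val s = [set i] & hd2 s = inr (mon2 i)).
Proof.
rewrite /hd2; case: insubP => [d _ <-|h]; first by left; exists d.
have /cards1P [i e] : #|val s| == 1.
  by rewrite eqn_leq used_gt0 andbT leqNgt.
right; exists i => //; rewrite e; case: pickP => [i'|/(_ i)]; rewrite inE ?eqxx //.
by move=> /eqP ->.
Qed.

Lemma hd2_inj : injective hd2.
Proof.
move=> s s'; case: (hd2P s) => -[x E ->]; case: (hd2P s') => -[x' E' ->] // [].
  by rewrite E E' => ->.
by move/mon2_inj => e; apply: val_inj; rewrite E E' e.
Qed.

Lemma hd2_gt0 s J : hd2 s = inr J -> 0 < #|J|.
Proof. by case: (hd2P s) => -[x _ ->] // [<-]; exact: mon2_gt0. Qed.

Lemma hv2_gt0 d J : J \in hv2 d -> 0 < #|J|.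
Proof. by move=> /imsetP [i _ ->]; exact: mon2_gt0. Qed.

Lemma hval2 d x : hval hv2 d x = \big[addb/false]_(i | i \in hcls d) mono (mon2 i) x.
Proof. by rewrite /hval /hv2 (big_imset (aop := addb) (fun J => mono J x)) //= => i i' _ _ /mon2_inj. Qed.

Lemma src_val2 s x : src_val hd2 hv2 s x = \big[addb/false]_(i | i \in val s) mono (mon2 i) x.
Proof.
rewrite /src_val; case: (hd2P s) => -[y E ->]; first by rewrite hval2 E.
by rewrite E big_set1.
Qed.

(* The layer number [i] adds the source [piv i c] to the head of [c]. *)
Definition piv i c : 'I_3 := if #|c| == 2 then odflt i [pick i' in c :\ i] else i.

Lemma piv2 (a b : 'I_3) : a != b -> piv a [set a; b] = b.
Proof.
move=> ne; rewrite /piv cards2 ne /=; case: pickP => [i|/(_ b)]; rewrite !inE.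
  by case/andP => /negbTE -> /= /eqP.
by rewrite eq_sym ne eqxx orbT.
Qed.

Lemma piv_cases c : 1 < #|c| ->
  (exists a b, [/\ a != b, c = [set a; b], piv a c = b & piv b c = a]) \/
  (c = setT /\ forall i, piv i c = i).
Proof.
move=> c1; case: (boolP (#|c| == 2)) => [/cards2P [a [b [ne e]]]|c2].
  left; exists a, b; split=> //; rewrite e ?piv2 //.
  by rewrite setUC piv2 // eq_sym.
right; split; last by move=> i; rewrite /piv (negbTE c2).
apply/eqP; rewrite eqEcard subsetT cardsT card_ord.
by move: c1 c2; case: #|c| => [|[|[|k]]].
Qed.

(** In layer i a pair {i, b} adds b, and the full set adds i. Hence the class can be recovered from
    the qubit it reads, and the heads filled in one layer have distinct controls. *)
Lemma pivK i c : 1 < #|c| -> i \in c -> c = if piv i c == i then setT else [set i; piv i c].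
Proof.
move=> c1; case: (piv_cases c1) => [[a [b [ne -> e1 e2]]]|[-> ->]]; last by rewrite eqxx.
rewrite !inE => /orP [] /eqP ->; rewrite ?e1 ?e2.
  by rewrite eq_sym (negbTE ne).
by rewrite (negbTE ne) setUC.
Qed.

(** On [c] the map [piv] is a permutation: it swaps the elements of a pair and fixes those of the
    full set. *)
Lemma sum_piv c (F : 'I_3 -> bool) : 1 < #|c| ->
  \big[addb/false]_(i | i \in c) F (piv i c) = \big[addb/false]_(i | i \in c) F i.
Proof.
move=> c1; case: (piv_cases c1) => [[a [b [ne -> e1 e2]]]|[-> e]]; last by apply: eq_bigr => i _; rewrite e.
by rewrite !(big_setU1, big_set1) ?inE //= e1 e2 addbC.
Qed.

Definition layer2 i : seq (set2 * heads) :=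
  [seq (mon2 (piv i (hcls d)), d) | d <- enum {: heads} & i \in hcls d].
Definition cl2 : seq (seq (set2 * heads)) := [seq layer2 i | i <- enum 'I_3].

Lemma hcls_gt1 d : 1 < #|hcls d|.
Proof. exact: (valP d). Qed.

Lemma cl2_uniq l : l \in cl2 -> uniq (map fst l) && uniq (map snd l).
Proof.
move=> /mapP [i _ ->]; rewrite /layer2.
have -> : map fst (layer2 i) = [seq mon2 (piv i (hcls d)) | d <- enum {: heads} & i \in hcls d].
  by rewrite /layer2 -map_comp.
have -> : map snd (layer2 i) = [seq d <- enum {: heads} | i \in hcls d].
  by rewrite /layer2 -map_comp map_id.
rewrite (filter_uniq _ (enum_uniq _)) andbT map_inj_in_uniq ?(filter_uniq _ (enum_uniq _)) //.
move=> d d'; rewrite !mem_filter => /andP [h _] /andP [h' _] /mon2_inj e.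
by apply/val_inj/val_inj; rewrite -/(hcls d) -/(hcls d') (pivK (hcls_gt1 d) h) e -(pivK (hcls_gt1 d') h').
Qed.

Lemma cl2_gt0 e : e \in flatten cl2 -> 0 < #|e.1|.
Proof. by move=> /flatten_mapP [i _ /mapP [d _ ->]]; exact: mon2_gt0. Qed.

Lemma cl2_val d x : \big[addb/false]_(e <- flatten cl2 | e.2 == d) mono e.1 x = hval hv2 d x.
Proof.
rewrite hval2 -(sum_piv (fun i => mono (mon2 i) x) (hcls_gt1 d)) big_flatten big_map big_enum /=.
rewrite [RHS]big_mkcond /=; apply: eq_bigr => i _.
rewrite /layer2 big_map big_filter_cond big_enum_cond /=; case: ifP => h.
  by rewrite (big_pred1 d) // => d' /=; case: eqP => [->|]; rewrite ?h ?andbF.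
by rewrite big_pred0 // => d' /=; case: eqP => [->|]; rewrite ?h ?andbF.
Qed.

Lemma size_cl2 : size (flatten cl2) = \sum_d #|hcls d|.
Proof.
rewrite size_flatten /shape /cl2 -map_comp sumnE big_map big_enum /=.
have -> : \sum_(i < 3) size (layer2 i) = \sum_(i < 3) \sum_d (i \in hcls d).
  apply: eq_bigr => i _; rewrite size_map size_filter -sum1_count big_enum_cond [LHS]big_mkcond /=.
  by apply: eq_bigr => d _; case: (_ \in _).
by rewrite exchange_big; apply: eq_bigr => d _ /=; rewrite -sum1_card [RHS]big_mkcond.
Qed.

Definition msz s := #|[set j | cls j == val s]|.
Definition ncop2 s := uphalf ((msz s).-1 %/ 3).
Definition rank j := index j (enum [set j' | cls j' == cls j]).
(** The outputs of a class are numbered, and number 3r + t reads copy r in layer t: each copy serves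
    three outputs, and three layers suffice. *)
Definition sched2 (t : 'I_3) j : option (used * nat) :=
  if (insub (cls j) : option used) is Some s then if rank j %% 3 == t then Some (s, rank j %/ 3) else None else None.

Lemma sched2P t j s r : sched2 t j = Some (s, r) ->
  [/\ cls j = val s, rank j %% 3 = t & rank j %/ 3 = r].
Proof.
rewrite /sched2; case: insubP => // s' _ e; case: eqP => // h [<- <-]; by split.
Qed.

Lemma rank_lt j s : cls j = val s -> rank j < msz s.
Proof. by move=> e; rewrite /rank /msz -e cardE index_mem mem_enum inE. Qed.

Lemma sched2_bound t j s r : sched2 t j = Some (s, r) -> r <= (ncop2 s).*2.
Proof.
move=> /sched2P [/rank_lt h _ <-]; have : rank j %/ 3 <= (msz s).-1 %/ 3.
  by apply: leq_div2r; move: h; case: (msz s).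
rewrite /ncop2; lia.
Qed.

Lemma sched2_inj t j j' u : sched2 t j = Some u -> sched2 t j' = Some u -> j = j'.
Proof.
case: u => s r /sched2P [e1 e2 e3] /sched2P [e1' e2' e3'].
have : rank j = rank j' by rewrite (divn_eq (rank j) 3) (divn_eq (rank j') 3) e2 e3 e2' e3'.
have jl : j \in enum [set j0 | cls j0 == val s] by rewrite mem_enum inE e1.
have jl' : j' \in enum [set j0 | cls j0 == val s] by rewrite mem_enum inE e1'.
by rewrite /rank e1 e1' => h; rewrite -(nth_index j jl) h nth_index.
Qed.

Lemma scat2 x j : scat hd2 hv2 sched2 x j = \big[addb/false]_(J : set2 | J != set0) (coef j J && mono J x).
Proof.
have -> : \big[addb/false]_(J : set2 | J != set0) (coef j J && mono J x) =
    \big[addb/false]_(i | i \in cls j) mono (mon2 i) x.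
  rewrite (eq_bigl (fun J => J \in mon2 @: [set: 'I_3])) => [|J]; last by rewrite mon2_onto inE.
  rewrite (big_imset (aop := addb) (fun J => coef j J && mono J x)) => [|i i' _ _ /mon2_inj //].
  rewrite [RHS]big_mkcond /=; apply: eq_big => [i|i _]; first by rewrite inE.
  by rewrite inE; case: (coef j _).
rewrite /scat ffunE; case: (altP (cls j =P set0)) => [c0|cn].
  rewrite c0 [RHS]big_pred0 => [|i]; last by rewrite inE.
  apply: big1 => t _; case E: (sched2 t j) => [[s r]|] //.
  have [e _ _] := sched2P E; by have := used_gt0 s; rewrite -e c0 cards0.
have cu : (cls j != set0) && [exists j', cls j' == cls j] by rewrite cn /=; apply/existsP; exists j.
have t3 : rank j %% 3 < 3 by rewrite ltn_mod.
rewrite (bigD1 (Ordinal t3)) //= big1 => [|t ne].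
  by rewrite addbF /sched2 insubT /= eqxx src_val2.
by rewrite /sched2 insubT ifN // eq_sym.
Qed.

Lemma val_count (c : set3) : \sum_(s : used) (val s == c) <= 1.
Proof.
have -> : \sum_(s : used) (val s == c) = #|[set s : used | val s == c]|.
  by rewrite -sum1_card [RHS]big_mkcond; apply: eq_bigr => s _; rewrite inE; case: eqP.
apply/card_le1_eqP => s s'; rewrite !inE => /eqP e /eqP e'; apply: val_inj; by rewrite e e'.
Qed.

Lemma sum_msz : \sum_s msz s <= m.
Proof.
have -> : \sum_s msz s = \sum_(s : used) \sum_(j < m) (val s == cls j).
  apply: eq_bigr => s _; rewrite /msz -sum1_card big_mkcond; apply: eq_bigr => j _.
  by rewrite inE eq_sym; case: eqP.
rewrite exchange_big -[X in _ <= X]card_ord -sum1_card; apply: leq_sum => j _; exact: val_count.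
Qed.

Lemma msz_gt0 s : 0 < msz s.
Proof.
have /andP [_ /existsP [j e]] := valP s; apply/card_gt0P; exists j; by rewrite inE.
Qed.

Lemma sum_sched2 : \sum_(t < 3) \sum_(j < m) sched2 t j <= m.
Proof.
rewrite exchange_big -[X in _ <= X]card_ord -sum1_card; apply: leq_sum => j _ /=.
have t3 : rank j %% 3 < 3 by rewrite ltn_mod.
rewrite (bigD1 (Ordinal t3)) //= big1 ?addn0 => [|t ne]; first by case: (sched2 _ j).
case E: (sched2 t j) => [[s r]|] //; have [_ e _] := sched2P E.
by case/eqP: ne; apply: ord_inj.
Qed.

Lemma sum_heads (F : used -> nat) : \sum_(d : heads) F (val d) = \sum_(s : used | 1 < #|val s|) F s.
Proof. by rewrite -(big_sub [pred s : used | 1 < #|val s|] F). Qed.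

(** Class by class: with k >= 1 outputs, at most one head and the copy and parity qubits of its
    cells are needed, together at most k. *)
Lemma heads_anc : #|{: heads}| + 2 * \sum_s ncop2 s <= m.
Proof.
apply: leq_trans sum_msz; rewrite -sum1_card (sum_heads (fun=> 1)) big_mkcond big_distrr -big_split /=.
apply: leq_sum => s _; have := msz_gt0 s; rewrite /ncop2; case: ifP => _; lia.
Qed.

(** Class by class: with k >= 1 outputs, filling the head and the cells takes at most 2k CNOTs, or
    2k + 1 for the class of all three monomials, which occurs at most once. *)
Lemma heads_cnot : \sum_d #|hcls d| + 3 * \sum_s ncop2 s <= 2 * m + 1.
Proof.
apply: (@leq_trans (2 * \sum_s msz s + \sum_(s : used) (val s == setT))); last first.
  by apply: leq_add; [rewrite leq_mul2l sum_msz|exact: val_count].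
rewrite (sum_heads (fun s => #|val s|)) big_mkcond !big_distrr -!big_split /=.
apply: leq_sum => s _; have := msz_gt0 s; rewrite /ncop2.
have c3 : #|val s| <= 3 by rewrite -[X in _ <= X](card_ord 3) max_card.
have : #|val s| <= 2 + (val s == setT).
  case: (leqP #|val s| 2) => [h|h]; first by rewrite (leq_trans h) // leq_addr.
  have -> : val s == setT by rewrite eqEcard subsetT cardsT card_ord.
  by [].
by move: c3; case: (_ == setT); case: ifP => _; move: #|val s| (msz s) => x y /=; lia.
Qed.

Lemma card_mon2 : #|{: mon 2}| = 1.
Proof. by have := card_mon 2; rewrite -[2 ^ 2]/(1 + 2 + 1) => /addIn /addIn. Qed.

Lemma mon2_eq (e e' : mon 2) : e = e'.
Proof.
have /card_le1_eqP h : #|{: mon 2}| <= 1 by rewrite card_mon2.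
exact: h.
Qed.

(** The only AND gate has two distinct factors, so nothing is copied. The two CNOT layers saved are
    essential: AND gate and uncomputation, heads, copies and outputs take 5 + 3 + 3 + 3 = 14, the
    allowed depth. *)
Lemma nlinks2 D k (i0 : 'I_2) (leD : #|{: mon 2}| <= D) : nlinks m i0 leD k = 0.
Proof.
rewrite nlinksE big1 // => J _; rewrite size_behead.
have := uniq_us k J; have := mem_us k J; case: (us k J) => [|u [|u' l]] // h /= /andP [].
have : src u = src u'.
  have := h u; have := h u'; rewrite !inE !eqxx ?orbT => /esym /andP [_ /eqP ->] /esym /andP [_ /eqP ->] //.
case: u {h} => e b; case: u' => e' b'; rewrite (mon2_eq e' e) inE /src /=.
have := halfA_ne_halfB (valP e); case: b; case: b'; rewrite ?eqxx //= => ne E.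
  by case/eqP: ne.
by case/eqP: ne.
Qed.

Variable f : {ffun 'I_2 -> bool} -> {ffun 'I_m -> bool}.
Hypothesis fE : forall x j, f x j =
  coef j set0 (+) \big[addb/false]_(J : set2 | J != set0) (coef j J && mono J x).

Lemma two_bounds : within_bounds f.
Proof.
pose A := (heads + {s : used & 'I_(ncop2 s)} + {s : used & 'I_(ncop2 s)})%type.
pose D := maxn #|{: mon 2}| #|{: A}|.
have cA : #|{: A}| <= m.
  have c1 : #|{: {s : used & 'I_(ncop2 s)}}| = \sum_s ncop2 s.
    by rewrite card_tagged sumnE big_map big_enum /=; apply: eq_bigr => s _; rewrite card_ord.
  by rewrite !card_sum !c1 -addnA addnn -mul2n heads_anc.
have leD : #|{: mon 2}| <= D by exact: leq_maxl.
have leS : #|{: A}| <= D by exact: leq_maxr.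
have L1 : up_log 2 2 = 1 by exact: up_lognn.
have I := @impl_output_not 2 m D 3 ord0 used heads ncop2 leS hd2 hv2 cl2 sched2 hd2_inj hd2_gt0
  hv2_gt0 cl2_uniq cl2_gt0 cl2_val sched2_bound sched2_inj f (fun j => coef j set0) _.
have {}I := I (fun x j => etrans (fE x j) (congr1 _ (esym (scat2 x j)))).
rewrite L1 in I.
have {}I := impl_level (F := fun p => (p.1, xorv p.2 (f p.1))) ord0 leD (fun=> erefl) I.
have [C [wf im td tc [cc cd]]] := assemble I.
have lv1 : size (level 2 1) = 1.
  by have := nmonS 2 0; rewrite nmon0 -{2}L1 nmonL addn0 card_mon2.
rewrite nlinks2 lv1 in td tc cc cd.
exists #|{: anc 2 D}|, C; split=> //; split=> //.
split; first by rewrite td L1.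
(* Three ancillas for x_1 x_2 and its two uses. The pool needs at most m, as m >= 1 covers the work
   qubit of the AND gate. *)
have aD : #|{: anc 2 D}| <= m + 3.
  rewrite card_anc card_mon2 addnC leq_add2r /D card_mon2 geq_max hm; exact: cA.
have h1 := heads_cnot; have h2 := sum_sched2.
rewrite size_cl2 in cc; rewrite size_map size_enum_ord in cd.
have e1 : (2 ^+ 2.-1 = 2 :> int)%R by [].
have e2 : (2 ^+ 2 = 4 :> int)%R by [].
rewrite L1 e1 e2; split; first by move: aD; lia.
split; first by move: tc; lia.
split; last by move: cd; lia.
have AR (x y z k : nat) : k <= 2 * 0 + 7 * 1 + (x + (3 * y + z)) -> x + 3 * y <= 2 * m + 1 -> z <= m ->
  (k%:Z <= 2 * (11 * 2%:Z + 2 * m%:Z - 18) - 4 * 2%:Z - m%:Z + 9)%R by lia.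
exact: AR cc h1 h2.
Qed.

End Two.

Theorem theorem1 (n m : nat) (hn : (2 <= n)%N) (hm : (1 <= m)%N)
  (f : {ffun 'I_n -> bool} -> {ffun 'I_m -> bool}) :
  exists (a : nat) (C : circuit (n + m + a)),
    wf_circuit C /\
    implements f C /\
    T_depth C = up_log 2 n /\
    (a%:Z <= 2 ^+ n.-1 * (3 * n%:Z - 2) - 3 * n%:Z + m%:Z + 1)%R /\
    (T_count C <= 2 ^ n.+1 * (n - 2) + 4)%N /\
    ((CNOT_count C)%:Z
       <= 2 ^+ n.-1 * (11 * n%:Z + 2 * m%:Z - 18) - 4 * n%:Z - m%:Z + 9)%R /\
    ((CNOT_depth C)%:Z <= 2 ^+ n + 2 * n%:Z + 9 * (up_log 2 n)%:Z - 3)%R.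
Proof.
have [coef fE] : exists coef : 'I_m -> {set 'I_n} -> bool, forall j x, f x j =
    coef j set0 (+) \big[addb/false]_(J : {set 'I_n} | J != set0) (coef j J && mono J x).
  exact: fin_all_exists (fun j => anf (fun x => f x j)).
case: (ltngtP 2 n) => [n3|n1|n2]; [|by rewrite leqNgt n1 in hn|].
(* There are 2^n - 1 >= 7 nonempty sets, enough to choose four. *)
- have [|Q /subsetP Qs Q4] := @subset_of_card _ [set~ (set0 : {set 'I_n})] 4.
    by rewrite cardsC1 card_sets; have := @leq_exp2l 2 3 n isT; rewrite n3; lia.
  have Q0 : set0 \notin Q by apply/negP => /Qs; rewrite !inE eqxx.
  exact: (large_bounds n3 hm Q4 Q0 (fun x j => fE j x)).
by subst n; exact: (two_bounds hm (fun x j => fE j x)).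
Qed.
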